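(* Let $0\le j<k\le n-1$. Let $$(P\varphi)(\zeta)=(1-|\zeta|^2)^{(j-n)/2}(\varphi\circ\pi)(\zeta),\ \zeta\in\Gamma_B(n,k);\qquad (Q\psi)(\mathfrak t)=(\cosh\|\mathfrak t\|)^{k-n}(\psi\circ\pi^{-1})(\mathfrak t),\ \mathfrak t\in\Gamma_H(n,j),$$ and set $R_H^*\varphi=Q\,R_B^*\,P\varphi$ for functions $\varphi$ on $\Gamma_H(n,k)$. Then $$\int_{\Gamma_H(n,k)}(R_Hf)(\mathfrak z)\,\varphi(\mathfrak z)\,d\mathfrak z=\int_{\Gamma_H(n,j)}f(\mathfrak t)\,(R_H^*\varphi)(\mathfrak t)\,d\mathfrak t,$$ provided that either side of this equality is finite when $f$ and $\varphi$ are replaced by $|f|$ and $|\varphi|$, respectively.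
   Context: $n\ge2$; functions are complex-valued; $\sigma_{m-1}=2\pi^{m/2}/\Gamma(m/2)$ is the area of $S^{m-1}$. Affine Grassmannian: $G_{n,d}$ is the Grassmannian of $d$-dimensional linear subspaces of $\mathbb R^n$, $\mathrm{Gr}(n,d)$ the set of $d$-dimensional affine planes $\tau=\xi+u$, $\xi\in G_{n,d}$, $u\in\xi^\perp$, with $|\tau|=|u|$; one writes $f(\tau)=f(\xi,u)$. For $\varphi$ on $\mathrm{Gr}(n,k)$ and $\tau=\xi+u\in\mathrm{Gr}(n,j)$, $(R_A^*\varphi)(\tau)=\int_{\eta\supset\xi}\varphi(\eta,\mathrm{Pr}_{\eta^\perp}u)\,d_\xi\eta$, with $d_\xi\eta$ the invariant probability measure on the $k$-dimensional linear subspaces $\eta\supset\xi$ and $\mathrm{Pr}$ the orthogonal projection. Beltrami–Klein model: $\Gamma_B(n,d)=\{\tau\in\mathrm{Gr}(n,d):|\tau|<1\}$. $(R_B^*\varphi)(\tau)=(R_A^*\tilde\varphi)(\tau)$ for $\tau\in\Gamma_B(n,j)$, where $\tilde\varphi=\varphi$ on $\Gamma_B(n,k)$ and $\tilde\varphi=0$ elsewhere on $\mathrm{Gr}(n,k)$. Hyperboloid model: $\mathbb E^{n,1}$ is $\mathbb R^{n+1}$ with the form $[x,y]=-x_1y_1-\dots-x_ny_n+x_{n+1}y_{n+1}$, with unit vectors $e_1,\dots,e_{n+1}$; $\mathbb H^n=\{x:[x,x]=1,x_{n+1}>0\}$ with distance $d(x,y)=\cosh^{-1}[x,y]$; $\tilde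 o=e_{n+1}$. $\Gamma_H(n,d)$ is the set of $d$-dimensional totally geodesic submanifolds of $\mathbb H^n$, i.e. nonempty intersections of $\mathbb H^n$ with $(d+1)$-dimensional linear subspaces; $\|\mathfrak t\|$ is the geodesic distance from $\tilde o$ to $\mathfrak t$. The bijection $\pi:\Gamma_B(n,d)\to\Gamma_H(n,d)$ is $\pi(\tau)=\mathbb H^n\cap\{\tau+e_{n+1}\}$, where $\{\cdot\}$ is the linear span. Hyperbolic rotations and measures: $\mathbb H^d=\mathbb H^n\cap\mathrm{span}(e_{n-d+1},\dots,e_{n+1})$; $g_{i,n+1}(r)$ is the linear map with $e_i\mapsto e_i\cosh r+e_{n+1}\sinh r$, $e_{n+1}\mapsto e_i\sinh r+e_{n+1}\cosh r$, fixing the other $e_l$; $K=SO(n)$ acts on the first $n$ coordinates. The $SO_0(n,1)$-invariant measure $d\mathfrak t$ on $\Gamma_H(n,d)$ is normalized by $$\int_{\Gamma_H(n,d)}\psi(\mathfrak t)\,d\mathfrak t=\sigma_{n-d-1}\int_0^\infty(\sinh r)^{n-d-1}(\cosh r)^d\int_K\psi(\alpha g_{n-d,n+1}(r)\mathbb H^d)\,d\alpha\,dr.$$ Definition of $R_H$: let $\mathbb R^k=\mathrm{span}(e_{n-k+1},\dots,e_n)$. For $\mathfrak z=\pi(\eta+v)\in\Gamma_H(n,k)$ ($\eta\in G_{n,k}$, $v\in\eta^\perp$), $r=\|\mathfrak z\|$, choose $\gamma\in K$ with $\gamma\mathbb R^k=\eta$ and $\gamma e_{n-k}=v/|v|$ (the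 latter if $v\ne0$). Then $(R_Hf)(\mathfrak z)=\int_{\mathfrak t\subset\mathfrak z}f(\mathfrak t)$ is $$\sigma_{k-j-1}\int_0^\infty(\sinh\rho)^{k-j-1}(\cosh\rho)^j\int_{SO(k)}f\big(\gamma g_{n-k,n+1}(r)\,\alpha\, g_{n-j,n+1}(\rho)\mathbb H^j\big)\,d\alpha\,d\rho,$$ where $SO(k)$ acts on $\mathbb R^k$ with Haar probability measure (for $k=1$, read $O(1)$); it does not depend on the choice of $\gamma$. *)

(* Defs.v *)
From HB Require Import structures.
From mathcomp Require Import all_boot all_order all_algebra.
From mathcomp Require Import all_classical all_reals all_analysis.
From mathcomp Require Import measurable_realfun complex.

Set Implicit Arguments.
Unset Strict Implicit.
Unset Printing Implicit Defensive.

Import Order.TTheory GRing.Theory Num.Theory.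
Import numFieldNormedType.Exports.

Local Open Scope classical_set_scope.
Local Open Scope ring_scope.

(* Measurable types are pointed. *)
HB.instance Definition _ (R : realType) (n : nat) :=
  isPointed.Build {vspace 'cV[R]_n} 0%VS.

Section Functions.
Context {R : realType}.

Definition sinh (r : R) : R := (expR r - expR (- r)) / 2.
Definition cosh (r : R) : R := (expR r + expR (- r)) / 2.

(* The inverse of cosh : [0, +oo[ -> [1, +oo[. *)
Definition acosh (y : R) : R := ln (y + Num.sqrt (y ^+ 2 - 1)).

Definition Gamma (s : R) : R :=
  \int[lebesgue_measure]_(t in `]0, +oo[) (t `^ (s - 1) * expR (- t)).

(* sigma l is the area of the unit sphere S^l in R^(l+1). *)
Definition sigma (l : nat) : R :=
  2 * pi `^ (l.+1%:R / 2) / Gamma (l.+1%:R / 2).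

(* Integrals of complex functions, and integral operators on complex
   functions, are taken on real and imaginary parts separately. *)
Definition cintegral d (T : measurableType d) (mu : {measure set T -> \bar R})
    (D : set T) (h : T -> R[i]) : R[i] :=
  Complex (\int[mu]_(x in D) complex.Re (h x))
          (\int[mu]_(x in D) complex.Im (h x)).

Definition complexify {X Y : Type} (T : (X -> \bar R) -> (Y -> \bar R))
    (f : X -> R[i]) : Y -> R[i] :=
  fun y => Complex (fine (T (fun x => (complex.Re (f x))%:E) y))
                   (fine (T (fun x => (complex.Im (f x))%:E) y)).

Definition cmeasurable d (T : measurableType d) (D : set T) (f : T -> R[i]) :=
  measurable_fun D (fun x => complex.Re (f x)) /\
  measurable_fun D (fun x => complex.Im (f x)).

Definition eabs {X : Type} (f : X -> R[i]) : X -> \bar R :=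
  fun x => (ComplexField.Normc.normc (f x))%:E.

End Functions.

Section Euclidean.
Context {R : realType}.

(* The i-th unit vector of R^N, with i numbered from 1. *)
Definition e {N : nat} (i : nat) : 'cV[R]_N := \col_(l < N) (l.+1 == i)%:R.

Definition dot {N : nat} (x y : 'cV[R]_N) : R := \sum_(l < N) x l 0 * y l 0.

(* The norm `|x| of the library is the sup norm. *)
Definition enorm {N : nat} (x : 'cV[R]_N) : R := Num.sqrt (dot x x).

Definition linspan {N : nat} (S : set 'cV[R]_N) : set 'cV[R]_N :=
  [set x | forall V : {vspace 'cV[R]_N}, S `<=` [set` V] -> x \in V].

Definition orth {N : nat} (S : set 'cV[R]_N) : set 'cV[R]_N :=
  [set x | forall y, S y -> dot x y = 0].

(* The orthogonal projection onto S, when S is a linear subspace. *)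
Definition oproj {N : nat} (S : set 'cV[R]_N) (x : 'cV[R]_N) : 'cV[R]_N :=
  xget 0 [set y | S y /\ forall z, S z -> dot (x - y) z = 0].

Definition projmx {N : nat} (S : set 'cV[R]_N) : 'M[R]_N :=
  \matrix_(a, b) oproj S (e b.+1) a 0.

Definition limage {N : nat} (A : 'M[R]_N) (V : {vspace 'cV[R]_N}) :
  {vspace 'cV[R]_N} := (linfun (mulmx A) @: V)%VS.

Definition orthogonal_group (m : nat) : set 'M[R]_m :=
  [set A | A^T *m A = 1%:M].

(* SO(m), except that O(1) stands for SO(1). *)
Definition rotations (m : nat) : set 'M[R]_m :=
  [set A | orthogonal_group A /\ (m <> 1%N -> \det A = 1)].

Definition borel_mx (m : nat) := g_sigma_algebraType (@open 'M[R]_m).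

Definition is_haar (m : nat) (G : set 'M[R]_m)
    (mu : probability (borel_mx m) R) : Prop :=
  mu G = 1%E /\
  forall A, G A -> forall S : set (borel_mx m), measurable S ->
    mu [set B : 'M[R]_m | S (A *m B)] = mu S.

(* R^d as the span of the last d unit vectors of R^n. *)
Definition coord_space (n d : nat) : {vspace 'cV[R]_n} :=
  <<[seq e i | i <- iota (n - d).+1 d]>>%VS.

End Euclidean.
Arguments rotations {R} m _.

Section Affine.
Context {R : realType}.
Variable n : nat.

(* Borel sets of subspaces, for the topology of orthogonal projections. *)
Definition borel_vspace := g_sigma_algebraType
  [set [set V : {vspace 'cV[R]_n} | U (projmx [set` V])] |
    U in (open : set (set 'M[R]_n))].

Definition subspaces_over (k : nat) (xi : {vspace 'cV[R]_n}) :
  set {vspace 'cV[R]_n} := [set eta | \dim eta = k /\ (xi <= eta)%VS].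

(* Invariance is under the rotations that stabilize xi; they act transitively
   on subspaces_over k xi, so that nu is unique. *)
Definition is_fiber_measure (k : nat) (xi : {vspace 'cV[R]_n})
    (nu : probability borel_vspace R) : Prop :=
  nu (subspaces_over k xi) = 1%E /\
  forall A, rotations n A -> limage A xi = xi ->
  forall S : set borel_vspace, measurable S ->
    nu [set eta : {vspace 'cV[R]_n} | S (limage A eta)] = nu S.

(* (xi, u) stands for the affine plane xi + u. Functions on Gr d and GammaB d
   are total on this type. *)
Definition plane : Type := {vspace 'cV[R]_n} * 'cV[R]_n.

Definition Gr (d : nat) : set plane :=
  [set tau | \dim tau.1 = d /\ orth [set` tau.1] tau.2].

Definition plane_set (tau : plane) : set 'cV[R]_n :=
  [set x + tau.2 | x in [set` tau.1]].

Definition GammaB (d : nat) : set plane :=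
  [set tau | Gr d tau /\ enorm tau.2 < 1].

Definition RAstar (k : nat) (nu : {vspace 'cV[R]_n} -> probability borel_vspace R)
    (phi : plane -> \bar R) (tau : plane) : \bar R :=
  \int[nu tau.1]_(eta in subspaces_over k tau.1)
    phi (eta, oproj (orth [set` eta]) tau.2).

Definition RBstar (k : nat) (nu : {vspace 'cV[R]_n} -> probability borel_vspace R)
    (phi : plane -> \bar R) : plane -> \bar R :=
  RAstar k nu (patch (fun=> 0%E) (GammaB k) phi).

End Affine.
Arguments borel_vspace R n : clear implicits.
Arguments plane R n : clear implicits.
Arguments Gr {R} n d _.
Arguments GammaB {R} n d _.

Section Hyperbolic.
Context {R : realType}.
Variable n : nat.

Definition lform (x y : 'cV[R]_(n + 1)) : R :=
  - dot (usubmx x) (usubmx y) + dot (dsubmx x) (dsubmx y).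

Definition Hyp : set 'cV[R]_(n + 1) :=
  [set x | lform x x = 1 /\ 0 < dsubmx x 0 0].

Definition hdist (x y : 'cV[R]_(n + 1)) : R := acosh (lform x y).

Definition GammaH (d : nat) : set (set 'cV[R]_(n + 1)) :=
  [set t | t !=set0 /\ exists2 V : {vspace 'cV[R]_(n + 1)},
             \dim V = d.+1 & t = Hyp `&` [set` V]].

(* The sets of this sigma-algebra contained in GammaH d are the Borel sets of
   GammaH d, for the topology of the orthogonal projections onto the spans.
   Functions on GammaH d are total on this type; values off GammaH d are not
   used. *)
Definition borel_geod (d : nat) := g_sigma_algebraType
  [set GammaH d `&` [set t | U (projmx (linspan t))] |
    U in (open : set (set 'M[R]_(n + 1)))].

Definition gnorm (t : set 'cV[R]_(n + 1)) : R :=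
  inf [set hdist (e n.+1) x | x in t].

Definition pi_geod (tau : plane R n) : set 'cV[R]_(n + 1) :=
  Hyp `&` linspan [set col_mx x 0 + e n.+1 | x in plane_set tau].

(* The inverse of the bijection pi_geod : GammaB d -> GammaH d. *)
Definition pi_inv (d : nat) (t : set 'cV[R]_(n + 1)) : plane R n :=
  xget (0%VS, 0) [set tau | GammaB n d tau /\ pi_geod tau = t].

(* The action of SO(n) on the first n coordinates. *)
Definition lift_rot (A : 'M[R]_n) : 'M[R]_(n + 1) := block_mx A 0 0 1%:M.

(* The action of SO(k) on the last k of these n coordinates; conform_mx only
   casts (n - k) + k to n. *)
Definition sub_rot (k : nat) (A : 'M[R]_k) : 'M[R]_n :=
  conform_mx 1%:M (block_mx (1%:M : 'M[R]_(n - k)) 0 0 A).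

(* Column b is the image of e_b under g_{i,n+1}(r). *)
Definition hrot (i : nat) (r : R) : 'M[R]_(n + 1) :=
  \matrix_(a, b)
    (if b.+1 == i then cosh r *: e i + sinh r *: e n.+1
     else if b.+1 == n.+1 then sinh r *: e i + cosh r *: e n.+1
     else e b.+1) a 0.

Definition Hsub (d : nat) : set 'cV[R]_(n + 1) :=
  Hyp `&` [set` <<[seq e i | i <- iota (n - d).+1 d.+1]>>%VS].

(* SO_0(n,1): the form, the orientation and the sheet are preserved. *)
Definition SO0 : set 'M[R]_(n + 1) :=
  [set A | (forall x y, lform (A *m x) (A *m y) = lform x y) /\
           \det A = 1 /\ 0 < drsubmx A 0 0].

(* The second clause determines mu on GammaH d. *)
Definition is_geod_measure (haar : forall m, probability (borel_mx m) R)
    (d : nat) (mu : {measure set (borel_geod d) -> \bar R}) : Prop :=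
  (forall A, SO0 A -> forall S : set (borel_geod d), measurable S ->
     S `<=` GammaH d ->
     mu [set t : set 'cV[R]_(n + 1) | S (mulmx A @` t)] = mu S) /\
  (forall psi : borel_geod d -> \bar R,
     measurable_fun (GammaH d : set (borel_geod d)) psi ->
     (forall t, GammaH d t -> 0 <= psi t)%E ->
     (\int[mu]_(t in GammaH d) psi t =
      (sigma (n - d - 1))%:E *
      \int[lebesgue_measure]_(r in `]0%R, +oo[)
        ((sinh r ^+ (n - d - 1) * cosh r ^+ d)%:E *
         \int[haar n]_(a in rotations n)
           psi (mulmx (lift_rot a *m hrot (n - d) r) @` Hsub d)))%E).

(* gamma with gamma R^k = eta and gamma e_(n-k) = v / |v| if v <> 0. *)
Definition frame (k : nat) (tau : plane R n) : 'M[R]_n :=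
  xget 1%:M [set c | rotations n c /\ limage c (coord_space n k) = tau.1 /\
    (tau.2 <> 0 -> c *m e (n - k) = (enorm tau.2)^-1 *: tau.2)].

Definition RH (haar : forall m, probability (borel_mx m) R) (j k : nat)
    (f : set 'cV[R]_(n + 1) -> \bar R) (z : set 'cV[R]_(n + 1)) : \bar R :=
  let c := lift_rot (frame k (pi_inv k z)) in
  let r := gnorm z in
  ((sigma (k - j - 1))%:E *
   \int[lebesgue_measure]_(s in `]0%R, +oo[)
     ((sinh s ^+ (k - j - 1) * cosh s ^+ j)%:E *
      \int[haar k]_(a in rotations k)
        f (mulmx (c *m hrot (n - k) r *m lift_rot (sub_rot a)
                    *m hrot (n - j) s) @` Hsub j)))%E.

Definition opP (j : nat) (phi : set 'cV[R]_(n + 1) -> \bar R)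
    (zeta : plane R n) : \bar R :=
  (((1 - enorm zeta.2 ^+ 2) `^ ((j%:R - n%:R) / 2))%:E * phi (pi_geod zeta))%E.

Definition opQ (j k : nat) (psi : plane R n -> \bar R)
    (t : set 'cV[R]_(n + 1)) : \bar R :=
  ((cosh (gnorm t) ^ (k%:Z - n%:Z))%:E * psi (pi_inv j t))%E.

Definition RHstar (nu : {vspace 'cV[R]_n} -> probability (borel_vspace R n) R)
    (j k : nat) (phi : set 'cV[R]_(n + 1) -> \bar R) :
    set 'cV[R]_(n + 1) -> \bar R :=
  opQ j k (RBstar k nu (opP j phi)).

End Hyperbolic.
Arguments Hyp {R} n _.
Arguments GammaH {R} n d _.
Arguments borel_geod R n d : clear implicits.
Arguments Hsub {R} n d _.
Arguments SO0 {R} n _.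

(* Main.v *)
(** In the Klein model a d-dimensional geodesic is A(R^d + x) for a rotation A
    and a vector x orthogonal to R^d with |x| < 1. For nonnegative f and phi
    let J(x) be the average over a in O(n) of f(a(R^j + x)) phi(a(R^k + q x)),
    where q is the projection along R^k. Unfolding the normalizations of the
    invariant measures, the definitions of the two transforms and Tonelli's
    theorem, both sides become weighted integrals of J: the left-hand side over
    the points with coordinates a = tanh r, b = tanh s / cosh r along e_(n-k)
    and e_(n-j), the right-hand side over the unit ball of the orthogonal
    complement of R^j, in polar coordinates. As J(x) depends only on the
    lengths of the components of x orthogonal to R^k and inside R^k, polar
    coordinates in each of the two blocks reduce the second integral to the
    first, through 1 - a^2 - b^2 = 1 / (cosh r cosh s)^2. The general case
    follows by splitting into real, imaginary, positive and negative parts;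
    almost everywhere finiteness of the transforms comes from the nonnegative
    case. *)
From HB Require Import structures.
Require Import Defs.
From mathcomp Require Import all_boot all_order all_algebra.
From mathcomp Require Import all_classical all_reals all_analysis.
From mathcomp Require Import measurable_realfun complex.
From mathcomp Require Import ring lra zify.
Import Order.TTheory GRing.Theory Num.Theory.
Import numFieldNormedType.Exports.
Local Open Scope classical_set_scope.
Local Open Scope ring_scope.
Set Implicit Arguments.
Unset Strict Implicit.
Unset Printing Implicit Defensive.

(** * Measure theory *)

(** [frame], [pi_inv] and [oproj] are defined by choice, which says nothing about measurability.
    Hence every function of a geodesic is first factored through the matrix of the orthogonal
    projection onto its span, and frames are rebuilt from that matrix by explicit reflections, which
    are measurable entry by entry. The averages are over O(n) rather than SO(n) because the
    orthogonal maps of blocks of coordinates that have to be absorbed may have determinant -1; for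
    the integrands at hand the two averages agree, as these are invariant under a suitable
    reflection. No Jacobian in several variables is computed: integration over R^m is iterated, its
    invariance under O(m) comes from integrating against a Gaussian, polar coordinates come from
    scaling, and only increasing changes of one real variable are differentiated. The constants
    [sigma] enter through the Gaussian integral. The exponent of [opP] produces, at a = tanh r, the
    factor cosh r to the power n - j; this is the power that makes the two densities agree. *)

Section Density.
Context d (T : measurableType d) (R : realType) (mu : {measure set T -> \bar R}).
Variables (w : T -> R) (mw : measurable_fun setT w) (w0 : forall x, 0 <= w x).
Local Open Scope ereal_scope.

(** The proofs are arguments so that the measure structure can be attached to the term
    [mdensity mw w0] itself. *)
Definition mdensity of measurable_fun setT w & (forall x, (0 <= w x)%R) :=
  fun A : set T => \int[mu]_(x in A) (w x)%:E.
Local Notation nu := (mdensity mw w0).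

Let nu0 : nu set0 = 0. Proof. by rewrite /mdensity integral_set0. Qed.
Let nu_ge0 A : 0 <= nu A. Proof. by apply: integral_ge0 => x _; rewrite lee_fin. Qed.
Let nu_sigma_additive : semi_sigma_additive nu.
Proof.
move=> /= F mF tF mUF; rewrite /mdensity; apply: cvg_toP.
  apply: ereal_nondecreasing_is_cvgn => m n mn.
  by apply: lee_sum_nneg_natr => // k _ _; apply: integral_ge0 => x _; rewrite lee_fin.
rewrite ge0_integral_bigcup//=; first by apply: measurable_funTS; exact/measurable_EFinP.
by move=> x _; rewrite lee_fin.
Qed.
HB.instance Definition _ := isMeasure.Build _ _ _ nu nu0 nu_ge0 nu_sigma_additive.

Import HBNNSimple.

Lemma ge0_integral_density (h : T -> \bar R) :
  measurable_fun setT h -> (forall x, 0 <= h x) ->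
  \int[nu]_x h x = \int[mu]_x ((w x)%:E * h x).
Proof.
move=> mh h0; pose g := nnsfun_approx measurableT mh.
have gh x : (EFin \o g ^~ x) n @[n --> \oo] --> h x by exact: cvg_nnsfun_approx.
have mg n : measurable_fun setT (fun x => (g n x)%:E) by exact/measurable_EFinP.
have -> : \int[nu]_x h x = limn (fun n => \int[nu]_x (g n x)%:E).
  rewrite -monotone_convergence//; last 2 first.
  - by move=> n x _; rewrite lee_fin.
  - by move=> x _ a b ab; rewrite lee_fin; exact/lefP/nd_nnsfun_approx.
  by apply: eq_integral => x _; apply/esym/cvg_lim => //; exact: gh.
have -> : \int[mu]_x ((w x)%:E * h x) = limn (fun n => \int[mu]_x ((w x)%:E * (g n x)%:E)).
  rewrite -monotone_convergence//; last 3 first.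
  - by move=> n; apply: emeasurable_funM => //; exact/measurable_EFinP.
  - by move=> n x _; rewrite mule_ge0 ?lee_fin.
  - move=> x _ a b ab; apply: lee_pmul; rewrite ?lee_fin//.
    exact/lefP/nd_nnsfun_approx.
  by apply: eq_integral => x _; apply/esym/cvg_lim => //; apply: cvgeZl => //; exact: gh.
(* By monotone convergence it is enough to treat one simple function, a finite sum over its values
   of multiples of indicators. *)
congr (limn _); apply/funext => n.
transitivity (\int[nu]_x (\sum_(y \in range (g n)) (y * \1_(g n @^-1` [set y]) x)%:E)).
  by apply: eq_integral => t tE; rewrite fimfunE -fsumEFin.
have indich r : measurable_fun setT (fun x => (r * \1_(g n @^-1` [set r]) x)%:E).
  by apply: (measurable_comp measurableT) => //; exact: measurable_funM.
rewrite ge0_integral_fsum//; last by move=> m y Ey; exact: nnfun_muleindic_ge0.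
transitivity (\int[mu]_x (\sum_(y \in range (g n))
    (w x)%:E * (y * \1_(g n @^-1` [set y]) x)%:E)); last first.
  apply: eq_integral => x _.
  by rewrite -ge0_mule_fsumr ?fsumEFin -?fimfunE// => y; exact: nnfun_muleindic_ge0.
rewrite ge0_integral_fsum//; last 2 first.
  - by move=> y; apply: emeasurable_funM => //; exact/measurable_EFinP.
  - by move=> m y Ey; apply: mule_ge0; [rewrite lee_fin|exact: nnfun_muleindic_ge0].
apply: eq_fsbigr => r rg.
have r0 : (0 <= r)%R by move: rg; rewrite inE => -[x _ <-].
transitivity (r%:E * nu (g n @^-1` [set r])).
  by rewrite integralZl_indic_nnsfun// integral_indic// setIT.
rewrite /mdensity [in LHS]integral_mkcond -ge0_integralZl_EFin//; last 2 first.
- by move=> x _; rewrite patchE; case: ifP => // _; rewrite lee_fin.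
- apply/(measurable_restrictT _ _).1 => //; apply: measurable_funTS; exact/measurable_EFinP.
apply: eq_integral => x _.
rewrite patchE indicE; case: ifPn => _; last by rewrite mulr0 !mule0.
by rewrite mulr1 muleC.
Qed.
End Density.

(** * Increasing changes of variable on the half-line *)

Section ChangeOfVariable.
Context (R : realType).
Local Notation mu := (@lebesgue_measure R).
Variables F f : R -> R.
Hypothesis dF : forall x : R, 0 < x -> is_derive x 1 F (f x).
Hypothesis cf : forall x : R, 0 < x -> {for x, continuous f}.
Hypothesis f0 : forall x : R, 0 < x -> 0 < f x.

Let cF (x : R) : 0 < x -> {for x, continuous F}.
Proof.
move=> x0; apply/differentiable_continuous/derivable1_diffP.
by have := dF x0 => -[].
Qed.

Let withinF (a b : R) : 0 < a -> {within `[a, b], continuous F}.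
Proof.
move=> a0; apply: continuous_in_subspaceT => x; rewrite inE/= in_itv/= => /andP[ax _].
exact/cF/(lt_le_trans a0).
Qed.

Lemma derive_gt0_increasing (x y : R) : 0 < x -> x < y -> F x < F y.
Proof.
move=> x0 xy; have [z||z] := @MVT _ F f x y xy.
- by rewrite in_itv/= => /andP[xz _]; apply: dF; exact: lt_trans xz.
- exact: withinF.
rewrite in_itv/= => /andP[xz _] E; rewrite -subr_gt0 E mulr_gt0 ?subr_gt0//.
by apply: f0; exact: lt_trans xz.
Qed.

Let Fle (x y : R) : 0 < x -> x <= y -> F x <= F y.
Proof.
move=> x0; rewrite le_eqVlt => /predU1P[->//|xy]; exact/ltW/derive_gt0_increasing.
Qed.

Let mf_itv (a b : R) : 0 < a -> measurable_fun `[a, b] f.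
Proof.
move=> a0; apply: subspace_continuous_measurable_fun => //.
apply: continuous_in_subspaceT => x; rewrite inE/= in_itv/= => /andP[ax _].
exact/cf/(lt_le_trans a0).
Qed.

Let mF_itv (a b : R) : 0 < a -> measurable_fun `[a, b] F.
Proof.
by move=> a0; apply: subspace_continuous_measurable_fun => //; exact: withinF.
Qed.

Lemma FTC_le (a b : R) : 0 < a -> a <= b ->
  (\int[mu]_(x in `[a, b]) (f x)%:E = (F b - F a)%:E)%E.
Proof.
move=> a0; rewrite le_eqVlt => /predU1P[<-|ab].
  by rewrite set_itv1 integral_set1 subrr.
rewrite (@continuous_FTC2 _ f F)//.
- apply: continuous_in_subspaceT => x; rewrite inE/= in_itv/= => /andP[ax _].
  exact/cf/(lt_le_trans a0).
- split.
  + move=> x; rewrite in_itv/= => /andP[ax _].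
    by have := dF (lt_trans a0 ax) => -[].
  + exact/cvg_at_right_filter/cF.
  + by apply/cvg_at_left_filter/cF; exact: lt_trans ab.
- move=> x; rewrite in_itv/= => /andP[ax _]; rewrite derive1E.
  by have := dF (lt_trans a0 ax) => -[].
Qed.

(** Two finite measures on the line are compared: the image under [F] of the measure with density
    [f] on [a, b], and Lebesgue measure restricted to [F a, F b]. By the fundamental theorem of
    calculus they agree on the rays ]-oo, x[, a generating family stable under intersection. *)
Let cov_itv (a b : R) (h : R -> \bar R) : 0 < a -> a < b ->
  measurable_fun setT h -> (forall x, 0 <= h x)%E ->
  (\int[mu]_(r in `[a, b]) ((f r)%:E * h (F r)) = \int[mu]_(t in `[F a, F b]) h t)%E.
Proof.
move=> a0 ab mh h0.
(* [F] and [f] are only controlled on the positive axis; cut off to [a, b] they are measurable on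
   the whole line. *)
pose w := f \_ `[a, b]; pose G := F \_ `[a, b].
have mw : measurable_fun setT w by apply/(measurable_restrictT _ _).1 => //; exact: mf_itv.
have mG : measurable_fun setT G by apply/(measurable_restrictT _ _).1 => //; exact: mF_itv.
have w0 x : 0 <= w x.
  rewrite /w patchE; case: ifPn => //; rewrite inE/= in_itv/= => /andP[ax _].
  by apply/ltW/f0/(lt_le_trans a0).
pose m1' : {measure set (measurableTypeR R) -> \bar R} :=
  pushforward (mdensity mu mw w0) (G : R -> measurableTypeR R).
pose m1 := m1' mG.
pose v : measurableTypeR R -> R := \1_(`[F a, F b]).
have mv : measurable_fun setT v by exact: measurable_indic.
have v0 x : 0 <= v x by rewrite /v indicE.
pose m2 : {measure set (measurableTypeR R) -> \bar R} := mdensity mu mv v0.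
have m2E (S : set (measurableTypeR R)) : measurable S -> m2 S = mu (S `&` `[F a, F b]).
  by move=> mS; rewrite /m2 /= /mdensity integral_indic// setIC.
have m12 (S : set (measurableTypeR R)) : measurable S -> m1 S = m2 S.
  move=> mS; apply: (@measure_unique _ R (measurableTypeR R) (@RGenInftyO.G R) (fun n => `]-oo, n%:R[%classic) _ _ _ _ m1 m2 _ _ S mS).
  - exact: RGenInftyO.measurableE.
  - move=> _ _ [x ->] [y ->]; exists (Num.min x y); apply/seteqP; split => z/=;
      rewrite !in_itv/= lt_min; [by case=> -> ->|by move/andP].
  - by move=> n; exists n%:R.
  - apply/seteqP; split => // x _; exists (Num.truncn `|x|).+1 => //=.
    by rewrite in_itv/= (le_lt_trans (ler_norm _))// truncnS_gt.
  - move=> _ [x ->]; rewrite m2E// /m1 /m1'/= /pushforward /mdensity.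
    have wE (A : set R) : (\int[mu]_(t in A) (w t)%:E =
        \int[mu]_(t in A `&` `[a, b]) (f t)%:E)%E.
      by rewrite integral_mkcondr; apply: eq_integral => t _; rewrite /w !patchE; case: ifP.
    rewrite wE.
    (* The part of the ray inside [F a, F b] is empty, everything, or [F a, x[ with x = F c for some
       c in [a, b]. *)
    have [xa|ax] := leP x (F a).
      rewrite (_ : _ `&` _ = set0) ?integral_set0; last first.
        apply/seteqP; split => // t [/=] /[swap] tab; rewrite /G patchE mem_set//.
        move: tab; rewrite !in_itv/= => /andP[at_ _] Ft.
        by have := lt_le_trans Ft (le_trans xa (Fle a0 at_)); rewrite ltxx.
      rewrite (_ : _ `&` _ = set0) ?measure0//.
      apply/seteqP; split => // t [/=]; rewrite !in_itv/= => tx /andP[at_ _].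
      by have := lt_le_trans tx (le_trans xa at_); rewrite ltxx.
    have [bx|xb] := ltP (F b) x.
      rewrite (_ : _ `&` _ = `[a, b]%classic); last first.
        apply/seteqP; split => t/=; first by case.
        move=> tab; split => //; rewrite /G patchE mem_set//.
        move: tab; rewrite !in_itv/= => /andP[at_ tb].
        by apply: le_lt_trans bx; apply: Fle => //; exact: lt_le_trans at_.
      rewrite FTC_le ?(ltW ab)// (_ : _ `&` _ = `[F a, F b]%classic); last first.
        apply/seteqP; split => t/=; first by case.
        by rewrite !in_itv/= => /andP[-> tb]; split => //; exact: le_lt_trans bx.
      by rewrite lebesgue_measure_itv/= lte_fin derive_gt0_increasing.
    have [c cab Fc] : exists2 c, c \in `[a, b] & F c = x.
      apply: IVT; [exact: ltW|exact: withinF|].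
      by rewrite min_l ?max_r ?(Fle a0 (ltW ab))// (ltW ax) xb.
    move: cab; rewrite in_itv/= => /andP[ac cb].
    have c0 := lt_le_trans a0 ac.
    rewrite (_ : _ `&` _ = `[a, c[%classic); last first.
      apply/seteqP; split => t/=; rewrite !in_itv/=.
        case=> + tab; rewrite /G patchE mem_set; last by rewrite /= in_itv.
        case/andP: tab => -> tb; rewrite -Fc/= => Ft.
        rewrite ltNge; apply/negP => ct; have := Fle c0 ct.
        by rewrite leNgt Ft.
      case/andP => at_ tc; have tb := le_trans (ltW tc) cb.
      rewrite at_ tb; split => //; rewrite /G patchE mem_set/= ?in_itv/= ?at_ ?tb//.
      by rewrite -Fc; apply: derive_gt0_increasing => //; exact: lt_le_trans at_.
    have mfac : measurable_fun `[a, c[ f.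
      apply: subspace_continuous_measurable_fun => //.
      apply: continuous_in_subspaceT => t; rewrite inE/= in_itv/= => /andP[at_ _].
      exact/cf/(lt_le_trans a0).
    rewrite integral_itv_bndo_bndc; last exact/measurable_EFinP.
    rewrite FTC_le// (_ : _ `&` _ = `[F a, x[%classic); last first.
      apply/seteqP; split => t/=; rewrite !in_itv/=; first by case=> -> /andP[->].
      by case/andP => -> tx; rewrite tx (le_trans (ltW tx) xb).
    rewrite lebesgue_measure_itv/= lte_fin Fc.
    by rewrite ax EFinB.
  - move=> n; rewrite /m1 /m1'/= /pushforward /mdensity.
    apply: (@le_lt_trans _ _ (\int[mu]_t (w t)%:E)%E).
      apply: ge0_subset_integral => //.
      + by rewrite -[X in measurable X]setTI; apply: (mG measurableT).
      + exact/measurable_EFinP.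
      + by move=> t _; rewrite lee_fin.
    rewrite (_ : (\int[mu]_t (w t)%:E = \int[mu]_(t in `[a, b]) (f t)%:E)%E); last first.
      by rewrite [RHS]integral_mkcond; apply: eq_integral => t _; rewrite /w !patchE; case: ifP.
    by rewrite FTC_le ?ltry ?ltW.
transitivity (\int[m1]_t h t)%E; last first.
  rewrite (@eq_measure_integral _ _ _ _ m2)//; last by move=> A mA _; exact: m12.
  rewrite ge0_integral_density// [RHS]integral_mkcond.
  apply: eq_integral => t _; rewrite /v patchE indicE.
  by case: ifP => _; rewrite ?mul1e ?mul0e.
rewrite ge0_integral_pushforward//.
rewrite preimage_setT ge0_integral_density//; first last.
- by move=> x; exact: h0.
- exact: (measurableT_comp mh mG).
transitivity (\int[mu]_x ((w x)%:E * h (G x)))%E => //.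
rewrite integral_mkcond; apply: eq_integral => t _.
rewrite /w /= /G !patchE; case: ifP => // _.
by rewrite mul0e.
Qed.

(** The compact case on [1 / (n + 2), n + 2], followed by monotone convergence along these intervals
    and along their images. *)
Lemma ge0_change_of_variable (h : R -> \bar R) :
  measurable_fun setT h -> (forall x, 0 <= h x)%E ->
  (\int[mu]_(r in `]0%R, +oo[) ((f r)%:E * h (F r)) =
   \int[mu]_(t in F @` `]0%R, +oo[) h t)%E.
Proof.
(* The shift by 2 gives s 0 < 1 < u 0: the compact case asks for a nondegenerate interval. *)
move=> mh h0; pose s n : R := n.+2%:R^-1; pose u n : R := n.+2%:R.
have s0 n : 0 < s n by rewrite invr_gt0.
have su n : s n < u n.
  by rewrite (@lt_trans _ _ 1)// ?ltr1n// invf_lt1// ltr1n.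
have smono m n : (m <= n)%N -> s n <= s m by move=> mn; rewrite lef_pV2 ?posrE ?ltr0n// ler_nat.
have umono m n : (m <= n)%N -> u m <= u n by move=> mn; rewrite ler_nat.
have exh x : 0 < x -> exists n, x \in `[s n, u n].
  move=> x0; exists (maxn (Num.truncn x) (Num.truncn x^-1)); rewrite in_itv/=; apply/andP; split.
    rewrite /s invf_ple ?posrE//; apply: (le_trans (ltW (truncnS_gt _))).
    by rewrite ler_nat ltnS ltnW// ltnS leq_maxr.
  apply: (le_trans (ltW (truncnS_gt _))).
  by rewrite ler_nat ltnS ltnW// ltnS leq_maxl.
have E1 : `]0%R, +oo[%classic = \bigcup_n `[s n, u n]%classic :> set R.
  apply/seteqP; split => x/=.
    by rewrite in_itv/= andbT => /exh[n xn]; exists n.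
  by case=> n _ /=; rewrite !in_itv/= andbT => /andP[sx _]; exact: lt_le_trans sx.
have E2 : F @` `]0%R, +oo[ = \bigcup_n `[F (s n), F (u n)]%classic.
  apply/seteqP; split => y/=.
    case=> x; rewrite in_itv/= andbT => /exh[n]; rewrite in_itv/= => /andP[sx xu] <-.
    exists n => //=; rewrite in_itv/= !Fle//; exact: lt_le_trans sx.
  case=> n _ /=; rewrite in_itv/= => /andP[sy yu].
  have [x xn xy] : exists2 x, x \in `[s n, u n] & F x = y.
    apply: IVT; [exact/ltW/su|exact: withinF|].
    by rewrite min_l ?max_r ?(Fle (s0 n) (ltW (su n)))// sy yu.
  exists x => //; move: xn; rewrite !in_itv/= andbT => /andP[sx _].
  exact: lt_le_trans sx.
have c1 : (\int[mu]_(r in `[s n, u n]) ((f r)%:E * h (F r)))%E @[n --> \oo] -->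
    (\int[mu]_(r in `]0%R, +oo[) ((f r)%:E * h (F r)))%E.
  rewrite E1; apply: ge0_nondecreasing_set_cvg_integral => //.
  - move=> m n mn; rewrite subsetEset => x/=; rewrite !in_itv/= => /andP[sx xu].
    by rewrite (le_trans (smono _ _ mn))// (le_trans xu)// umono.
  - move=> n; apply: emeasurable_funM.
      by apply/measurable_EFinP; exact: mf_itv.
    by apply: (measurable_comp measurableT) => //; exact: mF_itv.
  - move=> n x /=; rewrite in_itv/= => /andP[sx _]; rewrite mule_ge0// lee_fin.
    by apply/ltW/f0; exact: lt_le_trans sx.
have c2 : (\int[mu]_(r in `[F (s n), F (u n)]) h r)%E @[n --> \oo] -->
    (\int[mu]_(t in F @` `]0%R, +oo[) h t)%E.
  rewrite E2; apply: ge0_nondecreasing_set_cvg_integral => //.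
  - move=> m n mn; rewrite subsetEset => x/=; rewrite !in_itv/= => /andP[sx xu].
    by rewrite (le_trans (Fle _ (smono _ _ mn)))// (le_trans xu)// Fle// umono.
  - move=> n; exact: measurable_funTS.
apply: (cvg_unique _ c1) => //.
rewrite (_ : (fun n => _) = (fun n => \int[mu]_(r in `[F (s n), F (u n)]) h r)%E)//.
by apply/funext => n; rewrite cov_itv.
Qed.

End ChangeOfVariable.

(** * Borel measurability of matrix-valued maps *)

Notation bmx R a b := (g_sigma_algebraType (@open 'M[R]_(a, b))).

Section MatrixMeasurability.
Context (R : realType).

Lemma measurable_entry (a b : nat) (i : 'I_a) (j : 'I_b) :
  measurable_fun setT (fun M : bmx R a b => M i j).
Proof.
apply: (measurability _ (RGenOInfty.measurableE R)) => _ [_ [x ->] <-].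
rewrite setTI; apply: sub_sigma_algebra.
apply: (@open_comp _ _ (fun M : 'M[R]_(a, b) => M i j)); last exact: rray_open.
by move=> M _; exact: coord_continuous.
Qed.

Definition mmx d (T : measurableType d) (a b : nat) (F : T -> 'M[R]_(a, b)) :=
  forall i j, measurable_fun setT (fun t => F t i j).

(** An open set of matrices is a countable union of boxes with rational centre and radius 1 / (n +
    1), and the preimage of a box is a finite intersection of conditions on entries. Measurability
    of matrix expressions is thus checked entry by entry. *)
Lemma mmx_measurable d (T : measurableType d) (a b : nat) (F : T -> 'M[R]_(a, b)) :
  mmx F -> measurable_fun setT (F : T -> bmx R a b).
Proof.
move=> mF; apply: (@measurability _ _ T (bmx R a b) setT F (@open 'M[R]_(a, b)) erefl) => _ [U oU <-].
rewrite setTI.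
pose box (q : 'M[rat]_(a, b) * nat) : set 'M[R]_(a, b) :=
  [set M | forall i j, `|M i j - ratr (q.1 i j)| < q.2.+1%:R^-1].
have UE : U = \bigcup_q (if `[< box q `<=` U >] then box q else set0).
  apply/seteqP; split => M; last first.
    by case=> q _; case: ifPn => // /asboolP; exact.
  move=> UM; have /nbhs_ballP[r /= r0 rU] := open_nbhs_nbhs (conj oU UM).
  (* The radius is at most r / 2: the point and any other element of its box are each that close to
     the centre. *)
  pose n := Num.truncn (2 / r); have n0 : 0 < n.+1%:R^-1 :> R by rewrite invr_gt0.
  have nr : n.+1%:R^-1 + n.+1%:R^-1 <= r.
    have : 2 / r < n.+1%:R by rewrite truncnS_gt.
    rewrite ltr_pdivrMr// => H; rewrite -mulr2n -[X in X <= _]mulr_natl ler_pdivrMr// mulrC; exact: ltW.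
  have /choice[q Hq] : forall ij : 'I_a * 'I_b,
      exists q : rat, `|M ij.1 ij.2 - ratr q| < n.+1%:R^-1.
    move=> [i j]/=; have /rat_in_itvoo[q] : M i j - n.+1%:R^-1 < M i j + n.+1%:R^-1.
      by rewrite ltrD2l gtrN.
    rewrite in_itv/= => /andP[q1 q2]; exists q.
    by rewrite ltr_distlC ltrBlDr q2 andbT -ltrBlDr.
  pose Q := (\matrix_(i, j) q (i, j), n).
  exists Q => //; rewrite asboolT; first by move=> i j; rewrite mxE; exact: (Hq (i, j)).
  move=> N HN; apply: rU; split => // i j; rewrite /ball/=.
  have := HN i j; have := Hq (i, j); rewrite /= mxE => h1 h2.
  apply: lt_le_trans nr; rewrite (le_lt_trans (ler_distD (ratr (q (i, j))) _ _))// ltrD//.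
  by rewrite distrC.
rewrite UE preimage_bigcup; apply: countable_bigcupT_measurable => [|q]; first exact: countableP.
case: ifP => _; last by rewrite preimage_set0.
rewrite (_ : F @^-1` box q = \bigcap_(ij in [set: 'I_a * 'I_b])
    (fun t => `|F t ij.1 ij.2 - ratr (q.1 ij.1 ij.2)|) @^-1` `]-oo, q.2.+1%:R^-1[); last first.
  apply/seteqP; split => t/= H; first by move=> [i j] _ /=; rewrite in_itv/=; exact: H.
  by move=> i j; have := H (i, j) I; rewrite /= in_itv.
apply: fin_bigcap_measurable => [|ij _]; first exact: finite_finset.
rewrite -[X in measurable X]setTI.
have : measurable_fun setT (fun t => `|F t ij.1 ij.2 - ratr (q.1 ij.1 ij.2)|).
  apply: measurableT_comp; first exact: normr_measurable.
  by apply: measurable_funB => //; exact: mF.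
by apply.
Qed.

Lemma mmx_id (a b : nat) : @mmx _ (bmx R a b) a b id.
Proof. by move=> i j; exact: measurable_entry. Qed.

Lemma mmx_of_measurable d (T : measurableType d) (a b : nat) (F : T -> bmx R a b) :
  measurable_fun setT F -> mmx F.
Proof. by move=> mF i j; apply: (measurableT_comp (measurable_entry i j)). Qed.

Section MmxOps.
Context d (T : measurableType d).

Lemma mmx_cst (a b : nat) (M : 'M[R]_(a, b)) : @mmx _ T _ _ (fun=> M).
Proof. by move=> i j; exact: measurable_cst. Qed.

Lemma mmxM (a b c : nat) (F : T -> 'M[R]_(a, b)) (G : T -> 'M[R]_(b, c)) :
  mmx F -> mmx G -> mmx (fun t => F t *m G t).
Proof.
move=> mF mG i j; under eq_fun do rewrite mxE.
by apply: measurable_sum => l; exact: measurable_funM.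
Qed.

Lemma mmxD (a b : nat) (F G : T -> 'M[R]_(a, b)) :
  mmx F -> mmx G -> mmx (fun t => F t + G t).
Proof. by move=> mF mG i j; under eq_fun do rewrite mxE; exact: measurable_funD. Qed.

Lemma mmxN (a b : nat) (F : T -> 'M[R]_(a, b)) : mmx F -> mmx (fun t => - F t).
Proof. by move=> mF i j; under eq_fun do rewrite mxE; exact: measurable_funN. Qed.

Lemma mmxB (a b : nat) (F G : T -> 'M[R]_(a, b)) :
  mmx F -> mmx G -> mmx (fun t => F t - G t).
Proof. by move=> mF mG; apply: mmxD => //; exact: mmxN. Qed.

Lemma mmxZ (a b : nat) (c : T -> R) (F : T -> 'M[R]_(a, b)) :
  measurable_fun setT c -> mmx F -> mmx (fun t => c t *: F t).
Proof. by move=> mc mF i j; under eq_fun do rewrite mxE; exact: measurable_funM. Qed.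

Lemma mmxT (a b : nat) (F : T -> 'M[R]_(a, b)) : mmx F -> mmx (fun t => (F t)^T).
Proof. by move=> mF i j; under eq_fun do rewrite mxE; exact: mF. Qed.

Lemma mmx_const (a b : nat) (c : T -> R) :
  measurable_fun setT c -> mmx (fun t => const_mx (c t) : 'M[R]_(a, b)).
Proof. by move=> mc i j; under eq_fun do rewrite mxE. Qed.

Lemma mmx_col_mx (a b c : nat) (F : T -> 'M[R]_(a, c)) (G : T -> 'M[R]_(b, c)) :
  mmx F -> mmx G -> mmx (fun t => col_mx (F t) (G t)).
Proof.
move=> mF mG i j; under eq_fun do rewrite mxE.
by case: (fintype.split i) => l; [exact: mF|exact: mG].
Qed.

Lemma mmx_row_mx (a b c : nat) (F : T -> 'M[R]_(c, a)) (G : T -> 'M[R]_(c, b)) :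
  mmx F -> mmx G -> mmx (fun t => row_mx (F t) (G t)).
Proof.
move=> mF mG i j; under eq_fun do rewrite mxE.
by case: (fintype.split j) => l; [exact: mF|exact: mG].
Qed.

Lemma mmx_ulsubmx (a b c e : nat) (F : T -> 'M[R]_(a + b, c + e)) :
  mmx F -> mmx (fun t => ulsubmx (F t)).
Proof. by move=> mF i j; under eq_fun do rewrite !mxE; exact: mF. Qed.

Lemma mmx_usubmx (a b c : nat) (F : T -> 'M[R]_(a + b, c)) :
  mmx F -> mmx (fun t => usubmx (F t)).
Proof. by move=> mF i j; under eq_fun do rewrite !mxE; exact: mF. Qed.

Lemma measurable_dot (a : nat) (F G : T -> 'cV[R]_a) :
  mmx F -> mmx G -> measurable_fun setT (fun t => dot (F t) (G t)).
Proof. by move=> mF mG; apply: measurable_sum => l; exact: measurable_funM. Qed.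

Lemma measurable_sqrt (g : T -> R) :
  measurable_fun setT g -> measurable_fun setT (fun t => Num.sqrt (g t)).
Proof.
apply: measurableT_comp; apply: continuous_measurable_fun; exact: sqrt_continuous.
Qed.

Lemma measurable_inv (g : T -> R) :
  measurable_fun setT g -> measurable_fun setT (fun t => (g t)^-1).
Proof.
(* The inverse is continuous away from 0, where its value is 0 by convention. *)
move=> mg; pose h (x : R) := if x == 0 then 0 else x^-1.
rewrite (_ : (fun _ => _) = (h \o g)); last first.
  by apply/funext => t; rewrite /h/=; case: eqP => // ->; rewrite invr0.
apply: measurableT_comp => //; apply: measurable_fun_if => //.
- by apply: measurable_fun_eqr.
- rewrite setTI (_ : _ @^-1` _ = ~` [set 0 : R]); last first.
    by apply/seteqP; split => x /=; [move/eqP|move/eqP/negbTE].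
  apply: open_continuous_measurable_fun; first by apply: closed_openC; exact: closed_eq.
  by move=> x; rewrite inE/= => /eqP x0; exact: inv_continuous.
Qed.

Lemma measurable_enorm (a : nat) (F : T -> 'cV[R]_a) :
  mmx F -> measurable_fun setT (fun t => enorm (F t)).
Proof. by move=> mF; apply: measurable_sqrt; exact: measurable_dot. Qed.

End MmxOps.
End MatrixMeasurability.

(** * One-dimensional affine changes of variable *)

Section LebesgueAffine.
Context (R : realType).
Local Notation mu := (@lebesgue_measure R).

(** Lebesgue measure is determined by its values on half-open intervals, where c times its image
    under x -> c x + b takes the same values. *)
Lemma ge0_integral_affine (c b : R) (h : R -> \bar R) : 0 < c ->
  measurable_fun setT h -> (forall x, 0 <= h x)%E ->
  (\int[mu]_x h x = c%:E * \int[mu]_x h (c * x + b)%R)%E.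
Proof.
move=> c0 mh h0.
have mphi : measurable_fun setT (fun x : R => c * x + b).
  by apply: measurable_funD => //; exact: mulrl_measurable.
pose m1' : {measure set (measurableTypeR R) -> \bar R} :=
  pushforward mu ((fun x : R => c * x + b) : R -> measurableTypeR R).
pose m1 := m1' mphi.
pose m2 : {measure set (measurableTypeR R) -> \bar R} := mscale (NngNum (ltW c0)) m1.
have E (S : set (measurableTypeR R)) : measurable S -> mu S = m2 S.
  apply: lebesgue_measure_unique => _ [[s t]] /= st <-.
  rewrite /m2 /= /mscale/= /m1 /m1'/= /pushforward.
  rewrite (_ : _ @^-1` _ = `](s - b) / c, (t - b) / c]%classic); last first.
    apply/seteqP; split => x /=; rewrite !in_itv/=;
      by rewrite ltr_pdivrMr// ler_pdivlMr// ltrBlDr lerBrDr (mulrC x).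
  rewrite !lebesgue_measure_itv/= !lte_fin ltr_pM2r ?invr_gt0// ltrD2r.
  case: ifP => _; last by rewrite mule0.
  by rewrite -!EFinD -EFinM; congr EFin; field; rewrite gt_eqF.
transitivity (\int[m2]_x h x)%E.
  by apply: eq_measure_integral => A mA _; exact: E.
rewrite /m2 ge0_integral_mscale//; congr (_ * _)%E.
by rewrite ge0_integral_pushforward.
Qed.

Lemma ge0_integral_translation (b : R) (h : R -> \bar R) :
  measurable_fun setT h -> (forall x, 0 <= h x)%E ->
  (\int[mu]_x h (x + b)%R = \int[mu]_x h x)%E.
Proof.
move=> mh h0; rewrite [RHS](ge0_integral_affine b ltr01)// mul1e.
by apply: eq_integral => x _; rewrite mul1r.
Qed.

Lemma ge0_integralN (h : R -> \bar R) :
  measurable_fun setT h -> (forall x, 0 <= h x)%E ->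
  (\int[mu]_x h (- x)%R = \int[mu]_x h x)%E.
Proof.
move=> mh h0.
pose m1' : {measure set (measurableTypeR R) -> \bar R} :=
  pushforward mu (-%R : R -> measurableTypeR R).
have mN : measurable_fun setT (-%R : R -> measurableTypeR R) by exact: oppr_measurable.
transitivity (\int[m1' mN]_x h x)%E; first by rewrite ge0_integral_pushforward.
by apply: eq_measure_integral => A mA _; exact: lebesgue_measureN.
Qed.

End LebesgueAffine.

(** * Iterated Lebesgue integration over R^m *)

Section IteratedLebesgue.
Context (R : realType).
Local Notation mu := (@lebesgue_measure R).
Local Open Scope ereal_scope.

Definition cons_cV (a : R) m (x : 'cV[R]_m) : 'cV[R]_m.+1 := col_mx (const_mx a : 'M[R]_1) x.

Lemma cons_cVD a b m (x y : 'cV[R]_m) : (cons_cV a x + cons_cV b y = cons_cV (a + b) (x + y))%R.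
Proof.
by apply/matrixP => i j; rewrite /cons_cV !mxE; case: fintype.split => l; rewrite !mxE.
Qed.

Lemma cons_cVN a m (x : 'cV[R]_m) : (- cons_cV a x = cons_cV (- a) (- x))%R.
Proof.
by apply/matrixP => i j; rewrite /cons_cV !mxE; case: fintype.split => l; rewrite !mxE.
Qed.

Lemma cons_cVZ c a m (x : 'cV[R]_m) : (c *: cons_cV a x = cons_cV (c * a) (c *: x))%R.
Proof.
by apply/matrixP => i j; rewrite /cons_cV !mxE; case: fintype.split => l; rewrite !mxE.
Qed.

Lemma cons_cV_ex m (x : 'cV[R]_m.+1) : exists a y, x = cons_cV a y.
Proof.
exists (usubmx (x : 'cV_(1 + m)) 0%R 0%R), (dsubmx (x : 'cV_(1 + m))).
rewrite -[LHS](@vsubmxK _ 1 m 1) /cons_cV.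
apply/matrixP => i j; rewrite !ord1 [LHS]mxE [RHS]mxE; case: fintype.split => l //.
by rewrite ord1 [RHS]mxE.
Qed.

Lemma dot_cons a b m (x y : 'cV[R]_m) : dot (cons_cV a x) (cons_cV b y) = (a * b + dot x y)%R.
Proof.
rewrite /dot big_ord_recl; congr (_ + _)%R.
  by rewrite !mxE; case: fintype.splitP => // l _; rewrite !mxE.
apply: eq_bigr => i _; rewrite /cons_cV.
have -> : lift ord0 i = rshift 1 i by apply/val_inj.
by rewrite !(@col_mxEd _ 1 m 1).
Qed.

Lemma mmx_cons d (T : measurableType d) m (c : T -> R) (F : T -> 'cV[R]_m) :
  measurable_fun setT c -> mmx F -> mmx (fun t => cons_cV (c t) (F t)).
Proof. by move=> mc mF; apply: (@mmx_col_mx _ _ _ 1 m 1) => //; exact: mmx_const. Qed.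

(* Lebesgue integration over R^m, as an iterated integral. *)
Fixpoint lint (m : nat) : ('cV[R]_m -> \bar R) -> \bar R :=
  match m with
  | 0 => fun h => h 0%R
  | m'.+1 => fun h =>
      \int[mu]_a lint (fun x : 'cV[R]_m' => h (cons_cV a x))
  end.

Lemma lint_ge0 m (h : 'cV[R]_m -> \bar R) : (forall x, 0 <= h x) -> 0 <= lint h.
Proof.
elim: m h => [|m ih] h h0 /=; first exact: h0.
by apply: integral_ge0 => a _; apply: ih.
Qed.

Lemma measurable_col_mx_pair d (Z : measurableType d) m :
  measurable_fun setT (fun p : (Z * measurableTypeR R) * bmx R m 1 =>
    (p.1.1, cons_cV p.1.2 (p.2 : 'cV[R]_m) : bmx R m.+1 1)).
Proof.
apply: measurable_fun_pair.
  by apply: (measurableT_comp measurable_fst); exact: measurable_fst.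
apply: mmx_measurable; apply: mmx_cons.
  by apply: (measurableT_comp measurable_snd); exact: measurable_fst.
by apply: mmx_of_measurable; exact: measurable_snd.
Qed.

(** The parameter space [Z] is arbitrary so that the induction on m can move one coordinate after
    another into it. *)
Lemma measurable_lint d (Z : measurableType d) m (h : Z * bmx R m 1 -> \bar R) :
  measurable_fun setT h -> (forall x, 0 <= h x) ->
  measurable_fun setT (fun z => lint (fun x => h (z, x))).
Proof.
elim: m d Z h => [|m ih] d Z h mh h0 /=.
  by apply: (measurableT_comp mh); apply: measurable_fun_pair.
pose g (p : (Z * measurableTypeR R) * bmx R m 1) := h (p.1.1, cons_cV p.1.2 p.2).
have mg : measurable_fun setT g by apply: (measurableT_comp mh); exact: measurable_col_mx_pair.
have := ih _ (Z * measurableTypeR R)%type g mg (fun=> h0 _).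
move=> /(measurable_fun_fubini_tonelli_F (m2 := mu)); apply => p.
by apply: lint_ge0 => x; exact: h0.
Qed.

Lemma measurable_lintx m (h : bmx R m.+1 1 -> \bar R) :
  measurable_fun setT h -> (forall x, 0 <= h x) ->
  measurable_fun setT (fun a : R => lint (fun x => h (cons_cV a x))).
Proof.
move=> mh h0.
apply: (@measurable_lint _ R m (fun p => h (cons_cV p.1 p.2))) => //.
apply: (measurableT_comp mh); apply: mmx_measurable; apply: mmx_cons.
  by exact: measurable_fst.
by apply: mmx_of_measurable; exact: measurable_snd.
Qed.

Lemma measurable_lintx2 m (h : bmx R m.+1 1 -> \bar R) (a : R) :
  measurable_fun setT h ->
  measurable_fun setT (fun x : bmx R m 1 => h (cons_cV a x)).
Proof.
move=> mh; apply: (measurableT_comp mh); apply: mmx_measurable.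
by apply: mmx_cons; [exact: measurable_cst|exact: mmx_id].
Qed.

Lemma lintZ m (c : \bar R) (h : bmx R m 1 -> \bar R) : 0 <= c ->
  measurable_fun setT h -> (forall x, 0 <= h x) ->
  lint (fun x => c * h x) = c * lint h.
Proof.
move=> c0; elim: m h => [//|m ih] h mh h0 /=.
transitivity (\int[mu]_a (c * lint (fun x => h (cons_cV a x)))).
  by apply: eq_integral => a _; rewrite ih//; exact: measurable_lintx2.
rewrite ge0_integralZl//; first exact: measurable_lintx.
by move=> a _; exact: lint_ge0.
Qed.

(** Tonelli's theorem, one coordinate at a time: with the first coordinate fixed, the remaining ones
    are exchanged with [nu] by induction. *)
Lemma lint_integral d (Z : measurableType d) (nu : {sigma_finite_measure set Z -> \bar R})
    m (h : Z * bmx R m 1 -> \bar R) :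
  measurable_fun setT h -> (forall x, 0 <= h x) ->
  lint (fun x => \int[nu]_z h (z, x)) = \int[nu]_z lint (fun x => h (z, x)).
Proof.
elim: m h => [//|m ih] h mh h0 /=.
pose g (p : (Z * measurableTypeR R) * bmx R m 1) := h (p.1.1, cons_cV p.1.2 p.2).
have mg : measurable_fun setT g by apply: (measurableT_comp mh); exact: measurable_col_mx_pair.
transitivity (\int[mu]_a \int[nu]_z lint (fun x => g ((z, a), x))).
  apply: eq_integral => a _; apply: (ih (fun p => g ((p.1, a), p.2))); last by move=> x; exact: h0.
  apply: (@measurableT_comp _ _ _ _ _ _ g setT (fun p : Z * bmx R m 1 => ((p.1, a), p.2)) mg).
  apply: measurable_fun_pair => //; apply: measurable_fun_pair => //.
rewrite -(@fubini_tonelli _ _ _ _ _ nu mu (fun p => lint (fun x => g (p, x))))//.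
  by apply: (measurable_lint mg) => x; exact: h0.
by move=> p; apply: lint_ge0 => x; exact: h0.
Qed.

Lemma lint_lint m m' (h : bmx R m 1 * bmx R m' 1 -> \bar R) :
  measurable_fun setT h -> (forall x, 0 <= h x) ->
  lint (fun x : 'cV[R]_m => lint (fun y : 'cV[R]_m' => h (x, y))) =
  lint (fun y : 'cV[R]_m' => lint (fun x : 'cV[R]_m => h (x, y))).
Proof.
elim: m h => [//|m ih] h mh h0 /=.
pose g (p : measurableTypeR R * bmx R m' 1 * bmx R m 1) := h (cons_cV p.1.1 p.2, p.1.2).
have mg : measurable_fun setT g.
  apply: (measurableT_comp mh); apply: measurable_fun_pair; last first.
    by apply: (measurableT_comp measurable_snd); exact: measurable_fst.
  apply: mmx_measurable; apply: mmx_cons.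
    by apply: (measurableT_comp measurable_fst); exact: measurable_fst.
  by apply: mmx_of_measurable; exact: measurable_snd.
transitivity (\int[mu]_a lint (fun y : 'cV[R]_m' => lint (fun x : 'cV[R]_m => g ((a, y), x)))).
  apply: eq_integral => a _.
  apply: (ih (fun p => h (cons_cV a p.1, p.2))) => //.
  apply: (measurableT_comp mh); apply: measurable_fun_pair; last exact: measurable_snd.
  apply: mmx_measurable; apply: mmx_cons; first exact: measurable_cst.
  by apply: mmx_of_measurable; exact: measurable_fst.
rewrite -(@lint_integral _ _ mu m' (fun p => lint (fun x => g (p, x))))//.
  by apply: (measurable_lint mg) => x; exact: h0.
by move=> p; apply: lint_ge0 => x; exact: h0.
Qed.

Lemma eq_lint m (h1 h2 : 'cV[R]_m -> \bar R) : h1 =1 h2 -> lint h1 = lint h2.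
Proof. by move=> /funext ->. Qed.

Lemma lint_translation m (c : 'cV[R]_m) (h : bmx R m 1 -> \bar R) :
  measurable_fun setT h -> (forall x, 0 <= h x) ->
  lint (fun x => h (x + c)%R) = lint h.
Proof.
elim: m c h => [|m ih] c h mh h0 /=; first by congr h; apply/matrixP => -[].
have [c1 [c2 ->]] := cons_cV_ex c.
rewrite -[RHS](@ge0_integral_translation _ (c1)%R)//; last 2 first.
- exact: measurable_lintx.
- by move=> a; exact: lint_ge0.
apply: eq_integral => a _.
rewrite -(ih c2 (fun x => h (cons_cV (a + c1)%R x)))//; last first.
  exact: measurable_lintx2.
by apply: eq_lint => x; rewrite cons_cVD.
Qed.

Lemma lintN m (h : bmx R m 1 -> \bar R) :
  measurable_fun setT h -> (forall x, 0 <= h x) ->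
  lint (fun x => h (- x)%R) = lint h.
Proof.
elim: m h => [|m ih] h mh h0 /=; first by congr h; apply/matrixP => -[].
rewrite -[RHS]ge0_integralN//; last 2 first.
- exact: measurable_lintx.
- by move=> a; exact: lint_ge0.
apply: eq_integral => a _.
rewrite -(ih (fun x => h (cons_cV (- a)%R x)))//; last first.
  exact: measurable_lintx2.
by apply: eq_lint => x; rewrite cons_cVN.
Qed.

Lemma lint_scale m (c : R) (h : bmx R m 1 -> \bar R) : (0 < c)%R ->
  measurable_fun setT h -> (forall x, 0 <= h x) ->
  (c ^+ m)%:E * lint (fun x => h (c *: x)%R) = lint h.
Proof.
move=> c0; elim: m h => [|m ih] h mh h0 /=.
  by rewrite expr0 mul1e; congr h; apply/matrixP => -[].
have mhc : measurable_fun setT (fun x : bmx R m.+1 1 => h (c *: x)%R).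
  by apply: (measurableT_comp mh); apply: mmx_measurable; apply: mmxZ => //; exact: mmx_id.
rewrite [RHS](@ge0_integral_affine _ c 0)//; last 2 first.
- exact: measurable_lintx.
- by move=> a; exact: lint_ge0.
rewrite exprS EFinM -muleA; congr (_ * _).
rewrite -ge0_integralZl//; first last.
- by rewrite lee_fin exprn_ge0 ?ltW.
- by move=> a _; exact: lint_ge0.
- exact: (measurable_lintx mhc).
apply: eq_integral => a _; rewrite addr0.
rewrite -(ih (fun x => h (cons_cV (c * a)%R x)))//; last first.
  exact: measurable_lintx2.
by congr (_ * _); apply: eq_lint => x; rewrite cons_cVZ.
Qed.

Lemma lint_gauss m :
  lint (fun x : 'cV[R]_m => (expR (- dot x x))%:E) = (Num.sqrt pi ^+ m)%:E.
Proof.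
elim: m => [|m ih] /=; first by rewrite /dot big_ord0 oppr0 expR0.
transitivity (\int[mu]_a ((Num.sqrt pi ^+ m)%:E * (gauss_fun a)%:E)).
  apply: eq_integral => a _; rewrite muleC -ih -lintZ//.
  - apply: eq_lint => x; by rewrite dot_cons opprD expRD EFinM /gauss_fun expr2.
  - by rewrite lee_fin expR_ge0.
  - apply/measurable_EFinP; apply: (@measurableT_comp _ _ _ _ _ _ expR setT (fun x : bmx R m 1 => - dot x x)%R); first exact: measurable_expR.
    by apply: measurable_funN; apply: measurable_dot; exact: mmx_id.
rewrite ge0_integralZl//; last 2 first.
- by apply/measurable_EFinP; exact: measurable_gauss_fun.
- by move=> a _; rewrite lee_fin gauss_fun_ge0.
by rewrite integralT_gauss -EFinM exprSr.
Qed.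

End IteratedLebesgue.

(** * The Euclidean inner product *)

Section DotProduct.
Context (R : realType).
Implicit Types (m : nat).

Lemma dotE m (x y : 'cV[R]_m) : dot x y = (x^T *m y) 0 0.
Proof. by rewrite mxE; apply: eq_bigr => i _; rewrite mxE. Qed.

Lemma dotC m (x y : 'cV[R]_m) : dot x y = dot y x.
Proof. by apply: eq_bigr => i _; rewrite mulrC. Qed.

Lemma dotDl m (x y z : 'cV[R]_m) : dot (x + y) z = dot x z + dot y z.
Proof. by rewrite !dotE linearD/= mulmxDl mxE. Qed.

Lemma dotZl m (c : R) (x z : 'cV[R]_m) : dot (c *: x) z = c * dot x z.
Proof. by rewrite !dotE linearZ/= -scalemxAl mxE. Qed.

Lemma dotDr m (x y z : 'cV[R]_m) : dot z (x + y) = dot z x + dot z y.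
Proof. by rewrite dotC dotDl !(dotC z). Qed.

Lemma dotZr m (c : R) (x z : 'cV[R]_m) : dot z (c *: x) = c * dot z x.
Proof. by rewrite dotC dotZl dotC. Qed.

Lemma dotNl m (x z : 'cV[R]_m) : dot (- x) z = - dot x z.
Proof. by rewrite -scaleN1r dotZl mulN1r. Qed.

Lemma dotNr m (x z : 'cV[R]_m) : dot z (- x) = - dot z x.
Proof. by rewrite dotC dotNl dotC. Qed.

Lemma dotBl m (x y z : 'cV[R]_m) : dot (x - y) z = dot x z - dot y z.
Proof. by rewrite dotDl dotNl. Qed.

Lemma dotBr m (x y z : 'cV[R]_m) : dot z (x - y) = dot z x - dot z y.
Proof. by rewrite dotDr dotNr. Qed.

Lemma dot0l m (x : 'cV[R]_m) : dot 0 x = 0.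
Proof. by rewrite -(scale0r 0) dotZl mul0r. Qed.

Lemma dot0r m (x : 'cV[R]_m) : dot x 0 = 0.
Proof. by rewrite dotC dot0l. Qed.

Lemma dot_ge0 m (x : 'cV[R]_m) : 0 <= dot x x.
Proof. by apply: sumr_ge0 => i _; rewrite -expr2 sqr_ge0. Qed.

Lemma dot_eq0 m (x : 'cV[R]_m) : (dot x x == 0) = (x == 0).
Proof.
apply/idP/eqP => [|->]; last by rewrite dot0l.
rewrite psumr_eq0; last by move=> i _; rewrite -expr2 sqr_ge0.
move=> /allP H; apply/matrixP => i j; rewrite ord1 mxE.
by have := H i (mem_index_enum _); rewrite /= -expr2 sqrf_eq0 => /eqP.
Qed.

Lemma dot_mulmxl m m' (A : 'M[R]_(m, m')) (x : 'cV_m') (y : 'cV_m) :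
  dot (A *m x) y = dot x (A^T *m y).
Proof. by rewrite !dotE trmx_mul mulmxA. Qed.

Lemma dot_orthogonal m m' (A : 'M[R]_(m', m)) (x y : 'cV_m) : A^T *m A = 1%:M ->
  dot (A *m x) (A *m y) = dot x y.
Proof. by move=> AA; rewrite dot_mulmxl mulmxA AA mul1mx. Qed.

Lemma sqr_enorm m (x : 'cV[R]_m) : enorm x ^+ 2 = dot x x.
Proof. by rewrite sqr_sqrtr// dot_ge0. Qed.

Lemma enorm_ge0 m (x : 'cV[R]_m) : 0 <= enorm x.
Proof. exact: sqrtr_ge0. Qed.

Lemma enorm_eq0 m (x : 'cV[R]_m) : (enorm x == 0) = (x == 0).
Proof. by rewrite -dot_eq0 -sqr_enorm sqrf_eq0. Qed.

Lemma enorm0 m : enorm (0 : 'cV[R]_m) = 0.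
Proof. by apply/eqP; rewrite enorm_eq0. Qed.

Lemma enormZ m (c : R) (x : 'cV[R]_m) : enorm (c *: x) = `|c| * enorm x.
Proof. by rewrite /enorm dotZl dotZr mulrA -expr2 sqrtrM ?sqr_ge0// sqrtr_sqr. Qed.

Lemma enorm_orthogonal m m' (A : 'M[R]_(m', m)) (x : 'cV_m) : A^T *m A = 1%:M ->
  enorm (A *m x) = enorm x.
Proof. by move=> AA; rewrite /enorm dot_orthogonal. Qed.

Lemma ortho_tr m (A : 'M[R]_m) : A^T *m A = 1%:M -> A *m A^T = 1%:M.
Proof. exact: mulmx1C. Qed.

End DotProduct.

(** * Invariance of the iterated integral under O(m) *)

Section LintInvariance.
Context (R : realType).
Local Notation mu := (@lebesgue_measure R).
Local Open Scope ereal_scope.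

Lemma measurable_gauss_dot d (T : measurableType d) m (F : T -> 'cV[R]_m) : mmx F ->
  measurable_fun setT (fun t => (expR (- dot (F t) (F t)))%:E).
Proof.
move=> mF; apply/measurable_EFinP.
apply: (@measurableT_comp _ _ _ _ _ _ expR setT (fun t => - dot (F t) (F t))%R).
  exact: measurable_expR.
by apply: measurable_funN; exact: measurable_dot.
Qed.

(* With g a Gaussian, c h(x) is the integral of h(x) g(y), and translations turn
   [lint (fun x => h (A *m x) * g y)] into [lint (fun x => h (A *m x - y) * g x)],
   whose integral over y no longer involves A. *)
Lemma lint_orthogonal m (A : 'M[R]_m) (h : bmx R m 1 -> \bar R) : (A^T *m A = 1%:M)%R ->
  measurable_fun setT h -> (forall x, 0 <= h x) ->
  lint (fun x => h (A *m x)%R) = lint h.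
Proof.
move=> AA mh h0; have AA' := ortho_tr AA.
pose g (x : 'cV[R]_m) := (expR (- dot x x))%:E.
have g0 x : 0 <= g x by rewrite lee_fin expR_ge0.
have mg d (T : measurableType d) (F : T -> 'cV[R]_m) :
  mmx F -> measurable_fun setT (fun t => g (F t)) by exact: measurable_gauss_dot.
have mhF d (T : measurableType d) (F : T -> 'cV[R]_m) :
  mmx F -> measurable_fun setT (fun t => h (F t)).
  by move=> mF; apply: (measurableT_comp mh); exact: mmx_measurable.
have mA d (T : measurableType d) (F : T -> 'cV[R]_m) : mmx F -> mmx (fun t => A *m F t)%R.
  by move=> mF; apply: mmxM => //; exact: mmx_cst.
have m1 : @mmx R _ (bmx R m 1 * bmx R m 1)%type m 1 fst.
  by apply: mmx_of_measurable; exact: measurable_fst.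
have m2 : @mmx R _ (bmx R m 1 * bmx R m 1)%type m 1 snd.
  by apply: mmx_of_measurable; exact: measurable_snd.
have mid := @mmx_id R m 1.
pose c : R := (Num.sqrt pi ^+ m)%R.
have c0 : (0 < c)%R by rewrite exprn_gt0// sqrtr_gt0 pi_gt0.
have gc : lint g = c%:E by exact: lint_gauss.
have gA x : g (A *m x)%R = g x by rewrite /g dot_orthogonal.
suff E : c%:E * lint (fun x => h (A *m x)%R) = c%:E * lint h.
  have K (z : \bar R) : c^-1%:E * (c%:E * z) = z.
    by rewrite muleA -EFinM mulVf ?mul1e// gt_eqF.
  by rewrite -[LHS]K E K.
transitivity (lint (fun x => lint (fun y => h (A *m x)%R * g y))).
  rewrite -lintZ ?lee_fin ?(ltW c0)//; last exact/mhF/mA.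
  by apply: eq_lint => x; rewrite lintZ ?gc 1?muleC//; exact: mg.
transitivity (lint (fun x => lint (fun y => h (A *m x)%R * g (y + A *m x)%R))).
  apply: eq_lint => x; rewrite -[LHS](lint_translation (A *m x)%R)//.
  - by apply: emeasurable_funM => //; exact: mg.
  - by move=> y; exact: mule_ge0.
rewrite (lint_lint (h := fun p => h (A *m p.1)%R * g (p.2 + A *m p.1)%R))//; last 2 first.
- by apply: emeasurable_funM; [exact/mhF/mA|apply/mg/mmxD => //; exact: mA].
- by move=> p; exact: mule_ge0.
transitivity (lint (fun y => lint (fun x => h (A *m x - y)%R * g x))).
  apply: eq_lint => y /=; rewrite -[LHS](lint_translation (- (A^T *m y))%R)//.
  - apply: eq_lint => x.
    by rewrite mulmxBr mulmxA AA' mul1mx addrCA subrr addr0 gA.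
  - by apply: emeasurable_funM; [exact/mhF/mA|apply/mg/mmxD; [exact: mmx_cst|exact: mA]].
  - by move=> x; exact: mule_ge0.
rewrite -(lint_lint (h := fun p => h (A *m p.1 - p.2)%R * g p.1))//; last 2 first.
- by apply: emeasurable_funM; [apply/mhF/mmxB => //; exact: mA|exact: mg].
- by move=> p; exact: mule_ge0.
transitivity (lint (fun x => lint h * g x)).
  apply: eq_lint => x /=.
  under [LHS]eq_lint do rewrite muleC.
  rewrite lintZ//; last by apply/mhF/mmxB => //; exact: mmx_cst.
  rewrite muleC; congr (_ * _).
  rewrite (lintN (h := fun y => h (A *m x + y)%R))//; last first.
    by apply/mhF/mmxD => //; exact: mmx_cst.
  by under [LHS]eq_lint do rewrite addrC; exact: lint_translation.
rewrite lintZ//; first by rewrite gc muleC.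
- exact: lint_ge0.
- exact: mg.
Qed.

Lemma col_mx_cons p q (a : R) (y : 'cV[R]_p) (z : 'cV[R]_q) :
  col_mx (cons_cV a y) z = cons_cV a (col_mx y z) :> 'cV_(p + q).+1.
Proof.
apply/matrixP => i j; rewrite !ord1 /cons_cV !mxE.
case: fintype.splitP => [l il|l il]; case: fintype.splitP => [l' il'|l' il'].
- rewrite !mxE; case: fintype.splitP => [l2 E|l2 E]; rewrite ?mxE//.
  by exfalso; move: (ltn_ord l'); rewrite -il' il E.
- rewrite !mxE; case: fintype.splitP => [l2 E|l2 E]; case: fintype.splitP => [l3 E3|l3 E3];
    rewrite ?mxE.
  + by exfalso; move: (ltn_ord l2); rewrite -E -il il'.
  + by exfalso; move: (ltn_ord l2); rewrite -E -il il'.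
  + by congr (y _ _); apply/ord_inj/eqP; rewrite -(eqn_add2l 1) -E -E3 -il' il.
  + by exfalso; move: (ltn_ord l); rewrite -il il' E3 addnA ltnNge leq_addr.
- by exfalso; move: (ltn_ord l'); rewrite -il' il.
- rewrite !mxE; case: fintype.splitP => l3 E3.
  + by exfalso; move: (ltn_ord l3); rewrite -E3 -(ltn_add2l 1) -il' il ltnNge leq_addr.
  + by congr (z _ _); apply/ord_inj/eqP; rewrite -(eqn_add2l p.+1) -il il' E3 addnA.
Qed.

Lemma lint_split p q (h : bmx R (p + q) 1 -> \bar R) :
  lint h = lint (fun y : 'cV[R]_p => lint (fun z : 'cV[R]_q => h (col_mx y z))).
Proof.
elim: p h => [|p ih] h.
  apply: eq_lint => z /=; congr h; apply/matrixP => i j; rewrite mxE.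
  by case: fintype.splitP => [[]//|l il]; congr (z _ _); apply/val_inj.
apply: eq_integral => a _.
transitivity (lint (fun y : 'cV[R]_p => lint (fun z : 'cV[R]_q => h (cons_cV a (col_mx y z))))).
  exact: (ih (fun x => h (cons_cV a x))).
by apply: (@eq_lint R p) => y; apply: eq_lint => z; rewrite -col_mx_cons.
Qed.

End LintInvariance.

(** * Radial integrals and the area of the sphere *)

Section Radial.
Context (R : realType).
Local Notation mu := (@lebesgue_measure R).

Lemma ge0_integral_pos (w : R -> R) (h : R -> \bar R) :
  (\int[mu]_(t in `]0%R, +oo[) ((w t)%:E * h t) =
   \int[mu]_t (((0 < t)%R%:R * w t)%:E * h t))%E.
Proof.
rewrite integral_mkcond; apply: eq_integral => t _; rewrite patchE.
case: ifPn; first by rewrite inE/= in_itv/= andbT => ->; rewrite mul1r.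
rewrite notin_setE/= in_itv/= andbT => /negP/negPf ->.
by rewrite mul0r mul0e.
Qed.

Lemma measurable_pos : measurable_fun setT (fun t : R => (0 < t)%R%:R : R).
Proof.
rewrite (_ : (fun _ => _) = \1_(`]0, +oo[)).
  by apply: measurable_indic.
apply/funext => t; rewrite indicE; congr (nat_of_bool _)%:R.
by apply/idP/idP; rewrite inE/= in_itv/= andbT.
Qed.

Local Open Scope ereal_scope.

Let muleAAC (a b c d : \bar R) : a * (b * (c * d)) = c * (b * (a * d)).
Proof. by rewrite !muleA; congr (_ * _); rewrite muleC (muleC a) muleA. Qed.

(** The radial factor of Lebesgue measure in dimension l + 1. *)
Definition rint l (h : R -> \bar R) := \int[mu]_(t in `]0%R, +oo[) ((t ^+ l)%:E * h t).

Let w l (t : R) : R := ((0 < t)%R%:R * t ^+ l)%R.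
Let w_ge0 l t : (0 <= w l t)%R.
Proof. by rewrite /w; case: ltP => [t0|_]; rewrite ?mul0r ?mul1r ?exprn_ge0// ltW. Qed.
Let mw l : measurable_fun setT (w l).
Proof. by apply: measurable_funM; [exact: measurable_pos|exact: exprn_measurable]. Qed.

Let mwh l h : measurable_fun setT h -> measurable_fun setT (fun t => (w l t)%:E * h t).
Proof. by move=> mh; apply: emeasurable_funM => //; exact/measurable_EFinP. Qed.

Let rintE l h : rint l h = \int[mu]_t ((w l t)%:E * h t).
Proof. exact: ge0_integral_pos. Qed.

Lemma rint_scale l (c : R) (h : R -> \bar R) : (0 < c)%R ->
  measurable_fun setT h -> (forall x, 0 <= h x) ->
  rint l h = (c ^+ l.+1)%:E * rint l (fun t => h (c * t)%R).
Proof.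
move=> c0 mh h0; rewrite !rintE (ge0_integral_affine 0 c0); last 2 first.
- by apply: emeasurable_funM => //; exact/measurable_EFinP.
- by move=> t; rewrite mule_ge0// lee_fin.
have mhc : measurable_fun setT (fun t => h (c * t)%R).
  by apply: (measurableT_comp mh); exact: mulrl_measurable.
rewrite exprS EFinM -muleA; congr (_ * _).
rewrite -ge0_integralZl//; last 3 first.
- exact: mwh.
- by move=> t _; rewrite mule_ge0// lee_fin.
- by rewrite lee_fin exprn_ge0 ?ltW.
apply: eq_integral => t _; rewrite addr0 muleA; congr (_ * _).
by rewrite -EFinM /w pmulr_rgt0// exprMn mulrCA.
Qed.

Lemma rint_inversion l (c : R) (h : R -> \bar R) : (0 < c)%R ->
  measurable_fun setT h -> (forall x, 0 <= h x) ->
  \int[mu]_(t in `]0%R, +oo[) ((c ^+ l.+1 / t ^+ l.+2)%:E * h (c / t)%R) = rint l h.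
Proof.
move=> c0 mh h0.
(* The map t -> c / t is decreasing; its opposite is increasing, as the change of variable requires.
   The sign is removed at the end by reflecting the line. *)
pose F (t : R) := (- (c / t))%R; pose f (t : R) := (c / t ^+ 2)%R.
pose H (y : R) := ((w l (- y))%:E * h (- y)%R).
have mH : measurable_fun setT H.
  apply: emeasurable_funM; last exact: (measurableT_comp mh).
  by apply/measurable_EFinP; exact: (measurableT_comp (mw l)).
have H0 x : 0 <= H x by rewrite mule_ge0// lee_fin.
have hd (t : R) : (0 < t)%R -> is_derive t 1%R F (f t).
  move=> t0; rewrite /F /f.
  have tn : t != 0%R by rewrite gt_eqF.
  have -> : (c / t ^+ 2 = - (c * (- t ^- 2 *: 1)))%R by rewrite scaler1; field.
  apply: is_deriveN; apply: is_deriveZ; exact: is_deriveV.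
have hc (t : R) : (0 < t)%R -> {for t, continuous f}.
  move=> t0; apply: cvgM; first exact: cvg_cst.
  apply: cvgV; first by rewrite expf_eq0 gt_eqF.
  exact: exprn_continuous.
have hp (t : R) : (0 < t)%R -> (0 < f t)%R by move=> t0; rewrite divr_gt0// exprn_gt0.
have := @ge0_change_of_variable R F f hd hc hp H mH H0.
rewrite (_ : \int[mu]_(r in `]0%R, +oo[) _ =
  \int[mu]_(t in `]0%R, +oo[) ((c ^+ l.+1 / t ^+ l.+2)%:E * h (c / t)%R)); last first.
  apply: eq_integral => t; rewrite inE/= in_itv/= andbT => t0.
  rewrite /H /F opprK muleA -EFinM; congr (_%:E * _).
  by rewrite /w divr_gt0// mul1r /f expr_div_n mulf_div -exprS -exprD add2n.
rewrite (_ : F @` _ = `]-oo, 0%R[%classic); last first.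
  apply/seteqP; split => x/=.
    by case=> t; rewrite !in_itv/= andbT => t0 <-; rewrite /F oppr_lt0 divr_gt0.
  rewrite in_itv/= => x0; exists (- (c / x))%R.
    by rewrite in_itv/= andbT oppr_gt0 pmulr_rlt0// invr_lt0.
  by rewrite /F; field; rewrite lt_eqF//= gt_eqF.
move=> ->.
rewrite integral_mkcond -(ge0_integralN (h := H \_ _)); last 2 first.
- by apply/(measurable_restrictT _ _).1 => //; exact: measurable_funTS.
- by move=> x; rewrite patchE; case: ifP.
rewrite /rint [RHS]integral_mkcond; apply: eq_integral => t _; rewrite !patchE.
have -> : ((- (t : R))%R \in `]-oo, 0%R[%classic) = (t \in `]0%R, +oo[%classic).
  by apply/idP/idP; rewrite !inE/= !in_itv/= andbT oppr_lt0.
case: ifPn => //; rewrite inE/= in_itv/= andbT => t0.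
by rewrite /H opprK /w t0 mul1r.
Qed.

Lemma rint_ge0 l h : (forall x, 0 <= h x) -> 0 <= rint l h.
Proof. by move=> h0; rewrite rintE; apply: integral_ge0 => t _; rewrite mule_ge0// lee_fin. Qed.

Let gs (t : R) : \bar R := (expR (- t ^+ 2))%:E.
Let mgs : measurable_fun setT gs.
Proof. apply/measurable_EFinP; exact: measurable_gauss_fun. Qed.
Let gs0 t : 0 <= gs t. Proof. by rewrite lee_fin expR_ge0. Qed.

(** Raising t / l <= exp(t / l) to the power l gives t^l <= l^l exp(t), and t - t^2 <= 1 - t because
    (t - 1)^2 >= 0. So the integrand is at most a constant times the density of the exponential
    law. *)
Lemma rint_gauss_ltoo l : rint l gs < +oo.
Proof.
have bnd (t : R) : (0 < t)%R -> (t ^+ l <= l%:R ^+ l * expR t)%R.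
  move=> t0; case: l => [|l]; first by rewrite !expr0 mul1r ltW// expR_gt1.
  have : ((t / l.+1%:R) ^+ l.+1 <= (expR (t / l.+1%:R)) ^+ l.+1)%R.
    rewrite lerXn2r ?nnegrE ?expR_ge0// ?divr_ge0 ?ltW//.
    by apply: le_lt_trans (expR_gt1Dx _); [rewrite lerDr|rewrite gt_eqF// divr_gt0].
  rewrite -expRM_natl [X in expR X]mulrCA divff// mulr1 expr_div_n ler_pdivrMr ?exprn_gt0//.
  by rewrite mulrC.
apply: (@le_lt_trans _ _ (\int[mu]_t ((l%:R ^+ l * expR 1)%:E * (exponential_pdf 1 t)%:E))).
  rewrite rintE; apply: ge0_le_integral => //.
  - by move=> t _; rewrite mule_ge0// lee_fin.
  - exact: (mwh _ mgs).
  - apply: emeasurable_funM => //; apply/measurable_EFinP.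
    exact: measurable_exponential_pdf.
  - move=> t _; rewrite -!EFinM lee_fin /w.
    case: ltP => t0; last first.
      by rewrite !mul0r !mulr_ge0 ?exprn_ge0 ?expR_ge0 ?exponential_pdf_ge0.
    rewrite mul1r exponential_pdfE ?(ltW t0)// mul1r mulN1r.
    rewrite (le_trans (ler_wpM2r (expR_ge0 _) (bnd _ t0)))// -!mulrA ler_wpM2l ?exprn_ge0//.
    rewrite -!expRD ler_expR -subr_ge0 (_ : _ - _ = (t - 1) ^+ 2)%R ?sqr_ge0//; ring.
rewrite ge0_integralZl//; last 2 first.
- by apply/measurable_EFinP; exact: measurable_exponential_pdf.
- by move=> t _; rewrite lee_fin exponential_pdf_ge0.
by rewrite integral_exponential_pdf// mule1 ltry.
Qed.

(** On [1, 2] the Gaussian is at least exp(-4). Positivity allows dividing by the Gaussian integral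
    when the constant of polar coordinates is determined. *)
Lemma rint_gauss_gt0 l : 0 < rint l gs.
Proof.
apply: (@lt_le_trans _ _ (\int[mu]_(t in `[1%R, 2%R]) (expR (- 4))%:E)).
  rewrite integral_cst// [X in _ * X](lebesgue_measure_itv `[1%R, 2%R])/= lte_fin ltr1n -EFinD -EFinM lte_fin.
  by rewrite mulr_gt0 ?expR_gt0// subr_gt0 ltr1n.
apply: (@le_trans _ _ (\int[mu]_(t in `[1%R, 2%R]) ((t ^+ l)%:E * gs t))).
  apply: ge0_le_integral => //.
  - apply: emeasurable_funM; last exact: measurable_funTS.
    by apply/measurable_EFinP; exact: exprn_measurable.
  - move=> t/=; rewrite in_itv/= => /andP[t1 t2].
    rewrite -EFinM lee_fin -[leLHS]mul1r ler_pM ?expR_ge0//.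
      by rewrite exprn_ege1.
    rewrite ler_expR lerN2; nra.
apply: ge0_subset_integral => //.
- apply: emeasurable_funM; last exact: measurable_funTS.
  by apply/measurable_EFinP; exact: exprn_measurable.
- move=> t/=; rewrite in_itv/= andbT => t0; rewrite mule_ge0// lee_fin exprn_ge0//.
  exact: ltW.
- move=> t/=; rewrite !in_itv/= andbT => /andP[t1 _]; exact: lt_le_trans t1.
Qed.

(** The substitution u = t^2 in the integral of [Gamma]. As [Gamma] is a real number, the finiteness
    of the left-hand side is used to identify the two. *)
Lemma rint_gauss_Gamma l : rint l gs = (Gamma (l.+1%:R / 2) / 2)%:E :> \bar R.
Proof.
pose s : R := (l.+1%:R / 2)%R.
pose h (u : R) : \bar R := (u `^ (s - 1) * expR (- u))%:E.
have mh : measurable_fun setT h.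
  apply/measurable_EFinP; apply: measurable_funM; first exact: measurable_powR.
  apply: (@measurableT_comp _ _ _ _ _ _ expR setT (-%R : R -> R)); first exact: measurable_expR.
  exact: oppr_measurable.
have h0 u : 0 <= h u by rewrite lee_fin mulr_ge0 ?powR_ge0 ?expR_ge0.
have := @ge0_change_of_variable R (fun t => t ^+ 2)%R (fun t => 2 * t)%R _ _ _ h mh h0.
rewrite (_ : _ @` _ = `]0%R, +oo[%classic); last first.
  apply/seteqP; split => x/=.
    by case=> t; rewrite !in_itv/= !andbT => t0 <-; exact: exprn_gt0.
  rewrite in_itv/= andbT => x0; exists (Num.sqrt x).
    by rewrite in_itv/= andbT sqrtr_gt0.
  by rewrite sqr_sqrtr// ltW.
move=> E; have {}E : \int[mu]_(r in `]0%R, +oo[) ((2 * r)%:E * h (r ^+ 2)%R) =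
    \int[mu]_(t in `]0%R, +oo[) h t.
  apply: E.
  - move=> x _; have H : is_derive x 1%R (@id R ^+ 2)%R _ := is_deriveX 2 (is_derive_id x 1%R).
    by apply: (is_derive_eq H); rewrite expr1 scaler1.
  - by move=> x _; apply: cvgM; [exact: cvg_cst|exact: cvg_id].
  - by move=> x x0; rewrite mulr_gt0.
have : \int[mu]_(t in `]0%R, +oo[) h t = 2%:E * rint l gs.
  rewrite -E /rint -ge0_integralZl//; last 2 first.
  - apply: emeasurable_funM; last exact: measurable_funTS.
    by apply/measurable_EFinP; exact: exprn_measurable.
  - move=> t/=; rewrite in_itv/= andbT => t0; rewrite mule_ge0// lee_fin exprn_ge0//.
    exact: ltW.
  apply: eq_integral => t; rewrite inE/= in_itv/= andbT => t0.
  rewrite /h /gs -!EFinM; congr EFin; rewrite !mulrA -!mulrA; congr *%R.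
  rewrite mulrA; congr *%R.
  rewrite -[X in (_ * X `^ _)%R]powR_mulrn ?ltW// -powRrM.
  rewrite -[X in (X * _)%R]powRr1 ?ltW// -powRD; last by rewrite (gt_eqF t0) implybT.
  rewrite -[RHS]powR_mulrn ?ltW//; congr (_ `^ _)%R.
  by rewrite /s -natr1; field.
move=> {}E; rewrite /Gamma /Rintegral -/s -/h E.
have := rint_gauss_ltoo l; have := rint_gauss_gt0 l.
by case: (rint l gs) => [r _ _| |]//; rewrite -EFinM/=; congr EFin; field.
Qed.

(** The origin lies in the slice where the first coordinate is 0, and a single value of that
    coordinate is negligible. This serves for scalings by |x|, which require x != 0. *)
Lemma eq_lint_neq0 m (h1 h2 : bmx R m.+1 1 -> \bar R) :
  measurable_fun setT h1 -> (forall x, 0 <= h1 x) ->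
  measurable_fun setT h2 -> (forall x, 0 <= h2 x) ->
  (forall x, x != 0%R -> h1 x = h2 x) -> lint h1 = lint h2.
Proof.
move=> mh1 h10 mh2 h20 E /=.
have mD : measurable ([set: R] `\ 0%R) by exact: measurableD.
rewrite -[LHS](integral_setD1 (r := 0%R))//; last exact: measurable_funTS (measurable_lintx mh1 h10).
rewrite -[RHS](integral_setD1 (r := 0%R))//; last exact: measurable_funTS (measurable_lintx mh2 h20).
apply: eq_integral => a; rewrite inE => -[_ /= /eqP a0].
apply: eq_lint => x; apply: E; apply: contra_neq a0 => c0.
have : dot (cons_cV a x) (cons_cV a x) = 0%R by rewrite c0 dot0l.
rewrite dot_cons => /eqP; rewrite paddr_eq0 ?dot_ge0 -?expr2 ?sqr_ge0// sqrf_eq0.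
by case/andP => /eqP.
Qed.

(* Let A f be the integral of f(|x|). Scaling x in the double integral of
   t^m |x|^(m+1) f(|x|) g(t |x|) gives A f * rint m g = A g * rint m f; taking g
   Gaussian identifies the constant with sigma m. *)
Lemma lint_radial m (h : R -> \bar R) :
  measurable_fun setT h -> (forall x, 0 <= h x) ->
  lint (fun x : 'cV[R]_m.+1 => h (enorm x)) = (sigma m)%:E * rint m h.
Proof.
pose A (f : R -> \bar R) := lint (fun x : 'cV[R]_m.+1 => f (enorm x)).
have men d (T : measurableType d) (F : T -> 'cV[R]_m.+1) : mmx F ->
  measurable_fun setT (fun t => enorm (F t)) by exact: measurable_enorm.
have K1m (f g : R -> \bar R) : measurable_fun setT f -> measurable_fun setT g ->
    measurable_fun setT (fun p : measurableTypeR R * bmx R m.+1 1 =>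
    ((w m p.1 * enorm p.2 ^+ m.+1)%:E * (f (enorm p.2) * g (enorm p.2 * p.1)%R))).
  move=> mf mg; have m2 := men _ _ _ (mmx_of_measurable (@measurable_snd _ _ (measurableTypeR R) (bmx R m.+1 1))).
  have mp1 : measurable_fun setT (fun p : measurableTypeR R * bmx R m.+1 1 => p.1 : R) by exact: measurable_fst.
  apply: emeasurable_funM.
    apply/measurable_EFinP; apply: measurable_funM; first exact: (measurableT_comp (mw m)).
    exact: measurable_funX.
  apply: emeasurable_funM; first exact: (measurableT_comp mf).
  by apply: (measurableT_comp mg); exact: measurable_funM.
have K2m (f g : R -> \bar R) : measurable_fun setT f -> measurable_fun setT g ->
    measurable_fun setT (fun p : measurableTypeR R * bmx R m.+1 1 =>
    ((w m p.1 * p.1^-1 ^+ (m.+1 + m.+1) * enorm p.2 ^+ m.+1)%:E * (f (enorm p.2 / p.1)%R * g (enorm p.2)))).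
  move=> mf mg; have m2 := men _ _ _ (mmx_of_measurable (@measurable_snd _ _ (measurableTypeR R) (bmx R m.+1 1))).
  have mpi : measurable_fun setT (fun p : measurableTypeR R * bmx R m.+1 1 => p.1^-1 : R)%R by exact: measurable_inv.
  apply: emeasurable_funM.
    apply/measurable_EFinP; apply: measurable_funM; last exact: measurable_funX.
    apply: measurable_funM; first exact: (measurableT_comp (mw m)).
    exact: measurable_funX.
  apply: emeasurable_funM; last exact: (measurableT_comp mg).
  by apply: (measurableT_comp mf); exact: measurable_funM.
have K1 (f g : R -> \bar R) : measurable_fun setT f -> (forall x, 0 <= f x) ->
    measurable_fun setT g -> (forall x, 0 <= g x) -> A f * rint m g = A g * rint m f.
  move=> mf f0 mg g0.
  pose k1 (p : measurableTypeR R * bmx R m.+1 1) :=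
    ((w m p.1 * enorm p.2 ^+ m.+1)%:E * (f (enorm p.2) * g (enorm p.2 * p.1)%R)).
  pose k2 (p : measurableTypeR R * bmx R m.+1 1) :=
    ((w m p.1 * p.1^-1 ^+ (m.+1 + m.+1) * enorm p.2 ^+ m.+1)%:E * (f (enorm p.2 / p.1)%R * g (enorm p.2))).
  have k10 p : 0 <= k1 p by rewrite !mule_ge0// lee_fin mulr_ge0// exprn_ge0// enorm_ge0.
  have k20 p : 0 <= k2 p.
    rewrite mule_ge0// ?mule_ge0//lee_fin /w; case: ltP => p0; last by rewrite !mul0r.
    by rewrite !mulr_ge0// exprn_ge0 ?enorm_ge0// ?invr_ge0 ltW.
  have mk1 : measurable_fun setT k1 by exact: K1m.
  have mk2 : measurable_fun setT k2 by exact: K2m.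
  have mid := men _ _ _ (@mmx_id R m.+1 1).
  have mfe : measurable_fun setT (fun x : bmx R m.+1 1 => f (enorm x)) by exact: (measurableT_comp mf).
  have mge : measurable_fun setT (fun x : bmx R m.+1 1 => g (enorm x)) by exact: (measurableT_comp mg).
  transitivity (lint (fun x : 'cV[R]_m.+1 => \int[mu]_t k1 (t, x))).
    rewrite /A muleC -lintZ//; last exact: rint_ge0.
    apply: eq_lint_neq0.
    - by apply: emeasurable_funM => //; exact: measurable_cst.
    - by move=> x; rewrite mule_ge0//; exact: rint_ge0.
    - exact: (measurable_fun_fubini_tonelli_G k1 mk1 k10).
    - by move=> x; apply: integral_ge0 => t _; exact: k10.
    move=> x x0; have e0 : (0 < enorm x)%R by rewrite lt_def enorm_ge0 enorm_eq0 x0.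
    rewrite (rint_scale m e0 mg g0) rintE -ge0_integralZl//; last 3 first.
    - by apply: mwh; apply: (measurableT_comp mg); exact: mulrl_measurable.
    - by move=> t _; rewrite mule_ge0// lee_fin.
    - by rewrite lee_fin exprn_ge0// ltW.
    rewrite muleC -ge0_integralZl//; last 2 first.
    - apply: emeasurable_funM => //; apply: mwh.
      by apply: (measurableT_comp mg); exact: mulrl_measurable.
    - by move=> t _; rewrite !mule_ge0// lee_fin// exprn_ge0// ltW.
    apply: eq_integral => t _; rewrite /k1/= (EFinM (w m t)) -[RHS]muleA.
    exact: muleAAC.
  rewrite (lint_integral mu mk1 k10).
  transitivity (\int[mu]_t lint (fun x : 'cV[R]_m.+1 => k2 (t, x))).
    apply: eq_integral => t _.
    have [t0|t0] := ltP 0%R t; last first.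
      apply: eq_lint => x; rewrite /k1 /k2/= /w ltNge t0/=.
      by rewrite !mul0r !mul0e.
    have mk1t : measurable_fun setT (fun x : bmx R m.+1 1 => k1 (t, x)).
      by apply: (measurableT_comp mk1); exact: measurable_fun_pair.
    rewrite -(@lint_scale _ _ t^-1%R (fun x => k1 (t, x))) ?invr_gt0//.
    rewrite -lintZ ?lee_fin ?exprn_ge0 ?invr_ge0 ?(ltW t0)//; last first.
      apply: (measurableT_comp mk1t); apply: mmx_measurable; apply: mmxZ => //; exact: mmx_id.
    apply: eq_lint => x; rewrite /k1 /k2/= enormZ gtr0_norm ?invr_gt0//.
    rewrite muleA -EFinM; congr (_%:E * (_ * _)).
    + by rewrite exprMn exprD; ring.
    + by rewrite mulrC.
    + by rewrite mulrAC mulVf ?mul1r// gt_eqF.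
  rewrite -(lint_integral mu mk2 k20).
  rewrite /A [RHS]muleC -lintZ//; last exact: rint_ge0.
  apply: eq_lint_neq0.
  - exact: (measurable_fun_fubini_tonelli_G k2 mk2 k20).
  - by move=> x; apply: integral_ge0 => t _; exact: k20.
  - by apply: emeasurable_funM => //; exact: measurable_cst.
  - by move=> x; rewrite mule_ge0//; exact: rint_ge0.
  move=> x x0; have e0 : (0 < enorm x)%R by rewrite lt_def enorm_ge0 enorm_eq0 x0.
  rewrite -(rint_inversion m e0 mf f0) ge0_integral_pos muleC -ge0_integralZl//; last 2 first.
  - apply: emeasurable_funM.
      apply/measurable_EFinP; apply: measurable_funM; first exact: measurable_pos.
      apply: measurable_funM => //; apply: measurable_inv; exact: exprn_measurable.
    apply: (measurableT_comp mf); apply: measurable_funM => //; exact: measurable_inv.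
  - move=> t _; rewrite mule_ge0// lee_fin; case: ltP => t0; last by rewrite mul0r.
    by rewrite mul1r divr_ge0 ?exprn_ge0 ?ltW.
  apply: eq_integral => t _; rewrite /k2/= [RHS]muleC -!muleA; congr (_%:E * _).
  rewrite /w; case: ltP => t0; last by rewrite !mul0r.
  rewrite !mul1r mulrC; congr *%R.
  by rewrite addSnnS exprD mulrA -exprMn mulfV ?gt_eqF// expr1n mul1r exprVn.
move=> mh h0; have := K1 h gs mh h0 mgs gs0.
have -> : A gs = (Num.sqrt pi ^+ m.+1)%:E.
  rewrite -lint_gauss; apply: eq_lint => x; by rewrite /gs sqr_enorm.
have := rint_gauss_gt0 m; rewrite rint_gauss_Gamma lte_fin => G0 E.
have G1 : (0 < Gamma (m.+1%:R / 2 : R))%R by move: G0; rewrite pmulr_lgt0.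
rewrite -[LHS](mule1) -(@divff _ (Gamma (m.+1%:R / 2 : R) / 2)%R) ?gt_eqF// EFinM muleA E.
rewrite muleAC -EFinM; congr (_%:E * _); rewrite /sigma.
have -> : (pi `^ (m.+1%:R / 2) = Num.sqrt pi ^+ m.+1 :> R)%R.
  rewrite -powR12_sqrt ?pi_ge0// -powR_mulrn ?powR_ge0// -powRrM; congr (_ `^ _)%R.
  by rewrite mulrC.
by field; rewrite gt_eqF.
Qed.

End Radial.

(** * Integrals against probabilities; Haar measure of the rotation groups *)

Section ProbabilityIntegral.
Local Open Scope ereal_scope.

(** Haar and fiber measures live on all matrices or all subspaces and are carried by a measurable
    subset; removing the subset from the integral lets Tonelli's theorem act on whole spaces. *)
Lemma prob_integral (R : realType) d (T : measurableType d) (N : probability T R) (D : set T) (h : T -> \bar R) :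
  measurable D -> N D = 1 -> measurable_fun setT h -> (forall x, 0 <= h x) ->
  \int[N]_(x in D) h x = \int[N]_x h x.
Proof.
move=> mD D1 mh h0; rewrite [RHS](ge0_negligible_integral (N := ~` D))//.
- by rewrite setTD setCK.
- exact: measurableC.
- by have := @probability_setC _ _ _ N _ mD; rewrite D1 subee.
Qed.

Lemma prob_integral_cst (R : realType) d (T : measurableType d) (N : probability T R) (D : set T) (c : \bar R) :
  measurable D -> N D = 1 -> 0 <= c -> \int[N]_(x in D) c = c.
Proof.
move=> mD D1 c0; have -> : \int[N]_(x in D) c = c * N D by exact: integral_cst.
by rewrite D1 mule1.
Qed.

End ProbabilityIntegral.

Section Haar.
Context (R : realType) (m : nat) (mu : probability (bmx R m m) R).
Hypothesis muP : is_haar (rotations m) mu.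
Local Notation rot := (rotations m : set 'M[R]_m).

Lemma rotations_tr (A : 'M[R]_m) : rot A -> rot A^T.
Proof.
move=> [oA dA]; split; last by move=> m1; rewrite det_tr dA.
by rewrite /orthogonal_group/= trmxK ortho_tr.
Qed.

Lemma rotations_conj (D A : 'M[R]_m) : D^T *m D = 1%:M -> rot A -> rot (D *m A *m D^T).
Proof.
move=> oD [oA dA]; split.
  rewrite /orthogonal_group/= !trmx_mul trmxK !mulmxA -(mulmxA _ _ D) oD mulmx1.
  by rewrite -(mulmxA _ _ A) oA mulmx1 ortho_tr.
by move=> m1; rewrite !det_mulmx dA// mulr1 -det_mulmx ortho_tr// det1.
Qed.

(** Orthogonality and the value of the determinant are polynomial equations in the entries. *)
Lemma measurable_rotations : measurable (rot : set (bmx R m m)).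
Proof.
have mid := @mmx_id R m m.
have m1 : measurable ([set A | A^T *m A = 1%:M] : set (bmx R m m)).
  rewrite (_ : [set _ | _] = \bigcap_(ij in [set: 'I_m * 'I_m])
      (fun A : 'M[R]_m => (A^T *m A) ij.1 ij.2) @^-1` [set (1%:M : 'M[R]_m) ij.1 ij.2]).
    apply: fin_bigcap_measurable => [|ij _]; first exact: finite_finset.
    rewrite -[X in measurable X]setTI.
    by apply: (mmxM (mmxT mid) mid ij.1 ij.2).
  apply/seteqP; split => A /=; first by move=> E ij _ /=; rewrite E.
  by move=> E; apply/matrixP => i j; exact: (E (i, j)).
have m2 : measurable ([set A | \det A = 1] : set (bmx R m m)).
  have md : measurable_fun setT (fun A : bmx R m m => \det A).
    apply: measurable_sum => s; apply: measurable_funM => //.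
    by apply: measurable_prod => i _; exact: mid.
  by rewrite -[X in measurable X]setTI; exact: (md measurableT [set 1]).
have [m1E|m1N] := eqVneq m 1%N.
  rewrite (_ : rotations m = [set A | A^T *m A = 1%:M])//.
  by apply/seteqP; split => A /=; [case|move=> ?; split].
rewrite (_ : rotations m = [set A | A^T *m A = 1%:M] `&` [set A | \det A = 1]).
  exact: measurableI.
apply/seteqP; split => A /=; first by move=> [oA dA]; split => //; apply: dA; exact/eqP.
by move=> [oA dA]; split.
Qed.

Local Open Scope ereal_scope.

Lemma haar_rotations (h : bmx R m m -> \bar R) :
  measurable_fun setT h -> (forall x, 0 <= h x) ->
  \int[mu]_(a in rot) h a = \int[mu]_a h a.
Proof.
move=> mh h0; exact: (prob_integral measurable_rotations muP.1).
Qed.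

Lemma eq_haar (h1 h2 : bmx R m m -> \bar R) :
  measurable_fun setT h1 -> (forall x, 0 <= h1 x) ->
  measurable_fun setT h2 -> (forall x, 0 <= h2 x) ->
  (forall a, rot a -> h1 a = h2 a) -> \int[mu]_a h1 a = \int[mu]_a h2 a.
Proof.
move=> mh1 h10 mh2 h20 E; rewrite -!haar_rotations//.
by apply: eq_integral => a; rewrite inE; exact: E.
Qed.

Let mmxm (A : 'M[R]_m) (h : bmx R m m -> \bar R) : measurable_fun setT h ->
  measurable_fun setT (fun x : bmx R m m => h (A *m x)%R).
Proof.
move=> mh; apply: (measurableT_comp mh); apply: mmx_measurable.
by apply: mmxM; [exact: mmx_cst|exact: mmx_id].
Qed.

Let mmxr (A : 'M[R]_m) (h : bmx R m m -> \bar R) : measurable_fun setT h ->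
  measurable_fun setT (fun x : bmx R m m => h (x *m A)%R).
Proof.
move=> mh; apply: (measurableT_comp mh); apply: mmx_measurable.
by apply: mmxM; [exact: mmx_id|exact: mmx_cst].
Qed.

Let mmxt (h : bmx R m m -> \bar R) : measurable_fun setT h ->
  measurable_fun setT (fun x : bmx R m m => h x^T%R).
Proof.
move=> mh; apply: (measurableT_comp mh); apply: mmx_measurable.
by apply: mmxT; exact: mmx_id.
Qed.

Lemma haar_mull (A : 'M[R]_m) (h : bmx R m m -> \bar R) : rot A ->
  measurable_fun setT h -> (forall x, 0 <= h x) ->
  \int[mu]_a h (A *m a)%R = \int[mu]_a h a.
Proof.
move=> rA mh h0.
have mA : measurable_fun setT (mulmx A : bmx R m m -> bmx R m m).
  by apply: mmx_measurable; apply: mmxM; [exact: mmx_cst|exact: mmx_id].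
pose m1' : {measure set (bmx R m m) -> \bar R} :=
  pushforward mu (mulmx A : bmx R m m -> bmx R m m).
transitivity (\int[m1' mA]_x h x).
  by rewrite ge0_integral_pushforward.
by apply: eq_measure_integral => S mS _; exact: (muP.2 A rA S mS).
Qed.

Let m1 : @mmx R _ (bmx R m m * bmx R m m)%type m m fst.
Proof. by apply: mmx_of_measurable; exact: measurable_fst. Qed.
Let m2 : @mmx R _ (bmx R m m * bmx R m m)%type m m snd.
Proof. by apply: mmx_of_measurable; exact: measurable_snd. Qed.

Let haar_cst (c : \bar R) : 0 <= c -> \int[mu]_a c = c.
Proof. exact: (prob_integral_cst measurableT (probability_setT mu)). Qed.

(* Integrate h(x^T y) over x and y in both orders. *)
Lemma haar_tr (h : bmx R m m -> \bar R) :
  measurable_fun setT h -> (forall x, 0 <= h x) ->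
  \int[mu]_a h a^T%R = \int[mu]_a h a.
Proof.
move=> mh h0.
pose H (p : bmx R m m * bmx R m m) : \bar R := h ((p.1)^T *m p.2)%R.
have mH : measurable_fun setT H.
  by apply: (measurableT_comp mh); apply: mmx_measurable; apply: mmxM => //; exact: mmxT.
have H0 p : 0 <= H p by exact: h0.
have I0 : 0 <= \int[mu]_a h a by exact: integral_ge0.
have I0' : 0 <= \int[mu]_a h a^T%R by exact: integral_ge0.
transitivity (\int[mu]_y \int[mu]_x H (x, y)).
  rewrite -[LHS](haar_cst I0'); apply: eq_haar.
  - exact: measurable_cst.
  - by move=> y; exact: I0'.
  - exact: (measurable_fun_fubini_tonelli_G H mH H0).
  - by move=> y; apply: integral_ge0 => x _; exact: H0.
  move=> y ry; rewrite -(haar_mull (rotations_tr ry) (mmxt mh)); last by move=> x; exact: h0.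
  by apply: eq_integral => x _; rewrite /H/= trmx_mul trmxK.
rewrite -(fubini_tonelli H mH H0) -[RHS](haar_cst I0); apply: eq_haar.
- exact: (measurable_fun_fubini_tonelli_F H mH H0).
- by move=> y; apply: integral_ge0 => x _; exact: H0.
- exact: measurable_cst.
- by move=> y; exact: I0.
by move=> x rx; apply: (haar_mull (rotations_tr rx) mh).
Qed.

(** Transposition exchanges left and right multiplication, and it preserves the measure by
    [haar_tr]. *)
Lemma haar_mulr (A : 'M[R]_m) (h : bmx R m m -> \bar R) : rot A ->
  measurable_fun setT h -> (forall x, 0 <= h x) ->
  \int[mu]_a h (a *m A)%R = \int[mu]_a h a.
Proof.
move=> rA mh h0; rewrite -(haar_tr (mmxr A mh))//.
rewrite -[RHS]haar_tr// -[RHS](haar_mull (rotations_tr rA) (mmxt mh))//.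
by apply: eq_integral => x _; rewrite trmx_mul trmxK.
Qed.

(** [D] may have determinant -1, so one-sided invariance does not apply to it. In the double
    integral of h(D x D^T y), the variable y is absorbed on the right of x as D^T y D, while D x
    D^T, which is a rotation, is absorbed on the left of y. *)
Lemma haar_conj (D : 'M[R]_m) (h : bmx R m m -> \bar R) : (D^T *m D = 1%:M)%R ->
  measurable_fun setT h -> (forall x, 0 <= h x) ->
  \int[mu]_a h (D *m a *m D^T)%R = \int[mu]_a h a.
Proof.
move=> oD mh h0; have oD' := ortho_tr oD.
pose H (p : bmx R m m * bmx R m m) : \bar R := h (D *m p.1 *m D^T *m p.2)%R.
have mH : measurable_fun setT H.
  apply: (measurableT_comp mh); apply: mmx_measurable; apply: mmxM => //.
  by apply: mmxM; [apply: mmxM => //; exact: mmx_cst|exact: mmx_cst].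
have H0 p : 0 <= H p by exact: h0.
pose h' (x : bmx R m m) := h (D *m x *m D^T)%R.
have mh' : measurable_fun setT h' by apply: (mmxm D (h := fun x => h (x *m D^T)%R)); exact: mmxr.
have I0 : 0 <= \int[mu]_a h a by exact: integral_ge0.
have I0' : 0 <= \int[mu]_a h' a by apply: integral_ge0 => x _; exact: h0.
transitivity (\int[mu]_y \int[mu]_x H (x, y)).
  rewrite -[LHS](haar_cst I0'); apply: eq_haar.
  - exact: measurable_cst.
  - by move=> y; exact: I0'.
  - exact: (measurable_fun_fubini_tonelli_G H mH H0).
  - by move=> y; apply: integral_ge0 => x _; exact: H0.
  move=> y ry.
  have ry' : rot (D^T *m y *m D)%R.
    have := @rotations_conj D^T%R y; rewrite trmxK; exact.
  rewrite -(haar_mulr ry' mh'); last by move=> x; exact: h0.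
  by apply: eq_integral => x _; rewrite /H /h'/= !mulmxA -(mulmxA _ D D^T) oD' mulmx1.
rewrite -(fubini_tonelli H mH H0) -[RHS](haar_cst I0); apply: eq_haar.
- exact: (measurable_fun_fubini_tonelli_F H mH H0).
- by move=> y; apply: integral_ge0 => x _; exact: H0.
- exact: measurable_cst.
- by move=> y; exact: I0.
by move=> x rx; apply: (haar_mull (rotations_conj oD rx) mh).
Qed.

End Haar.

(** * Projections, frames and their measurability *)

Section Frames.
Context (R : realType).
Implicit Types (n d : nat).

Lemma mx_eq_cV m n (A B : 'M[R]_(m, n)) : (forall x : 'cV_n, A *m x = B *m x) -> A = B.
Proof.
move=> H; apply/matrixP => i j; have := H (delta_mx j 0).
by rewrite -!colE => /matrixP/(_ i 0); rewrite !mxE.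
Qed.

(* The reflection in the hyperplane orthogonal to w; the identity if w = 0. *)
Definition hh n (w : 'cV[R]_n) : 'M[R]_n := 1%:M - (2 / dot w w) *: (w *m w^T).

Lemma mul_col_dot n (w v x : 'cV[R]_n) : w *m v^T *m x = dot v x *: w.
Proof.
apply/matrixP => i j; by rewrite -mulmxA !mxE big_ord1 dotE mulrC (ord1 j) mxE.
Qed.

Lemma tr_mul_dot n (w v : 'cV[R]_n) : w^T *m v = (dot w v)%:M.
Proof. by apply/matrixP => i j; rewrite !ord1 -dotE [RHS]mxE eqxx. Qed.

Lemma hhE n (w x : 'cV[R]_n) : hh w *m x = x - (2 * dot w x / dot w w) *: w.
Proof.
rewrite mulmxBl mul1mx -scalemxAl mul_col_dot scalerA; congr (_ - _ *: _).
by rewrite mulrAC.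
Qed.

Lemma hh_tr n (w : 'cV[R]_n) : (hh w)^T = hh w.
Proof. by rewrite /hh linearB/= linearZ/= trmx1 trmx_mul trmxK. Qed.

Lemma hh_orthogonal n (w : 'cV[R]_n) : (hh w)^T *m hh w = 1%:M.
Proof.
apply: mx_eq_cV => x; rewrite hh_tr mul1mx -mulmxA hhE hhE.
have [->|w0] := eqVneq w 0; first by rewrite !scaler0 !subr0.
have ww : dot w w != 0 by rewrite dot_eq0.
rewrite dotBr dotZr -addrA -opprD -scalerDl.
set c := dot w x; set q := dot w w.
have -> : 2 * c / q + 2 * (c - 2 * c / q * q) / q = 0 by field.
by rewrite scale0r subr0.
Qed.

Lemma hh_map n (u v : 'cV[R]_n) : dot u u = dot v v -> hh (u - v) *m v = u.
Proof.
move=> uv; rewrite hhE.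
have [E|w0] := eqVneq (u - v) 0; first by rewrite E scaler0 subr0; apply/esym/eqP; rewrite -subr_eq0 E.
have ww : dot (u - v) (u - v) != 0 by rewrite dot_eq0.
have -> : 2 * dot (u - v) v = - dot (u - v) (u - v).
  rewrite !dotBl !dotBr uv (dotC v u); ring.
by rewrite mulNr divff// scaleN1r opprK addrC subrK.
Qed.

(* The orthogonal projection onto [coord_space n d]. *)
Definition pE n d : 'M[R]_n := \matrix_(i, j) ((i == j) && (n - d <= i)%N)%:R.

Lemma pE_mul n d m (x : 'M[R]_(n, m)) i j : (pE n d *m x) i j = (n - d <= i)%N%:R * x i j.
Proof.
rewrite mxE (bigD1 i)//= big1 ?addr0; first by rewrite mxE eqxx.
by move=> l li; rewrite mxE eq_sym (negPf li)/= mul0r.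
Qed.

Lemma pE_tr n d : (pE n d)^T = pE n d.
Proof.
by apply/matrixP => i j; rewrite !mxE eq_sym; case: eqP => // ->.
Qed.

Lemma pE_pE n d d' : (d <= d')%N -> pE n d *m pE n d' = pE n d.
Proof.
move=> dd; apply/matrixP => i j; rewrite pE_mul !mxE; case: (n - d <= i)%N / idP => h.
  by rewrite mul1r andbT (leq_trans _ h) ?leq_sub2l// andbT.
by rewrite mul0r andbF.
Qed.

Lemma pE_pE' n d d' : (d <= d')%N -> pE n d' *m pE n d = pE n d.
Proof. by move=> dd; have := congr1 trmx (pE_pE n dd); rewrite trmx_mul !pE_tr. Qed.

Lemma pE_idem n d : pE n d *m pE n d = pE n d. Proof. exact: pE_pE. Qed.

Lemma pE_e n d i : pE n d *m e i = (n - d < i)%N%:R *: e i :> 'cV[R]_n.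
Proof.
apply/matrixP => l j; rewrite pE_mul !mxE; case: eqP => [<-|_]; last by rewrite !mulr0.
by rewrite ltnS.
Qed.

Lemma hh_pE n d (w : 'cV[R]_n) : pE n d *m w = 0 -> hh w *m pE n d = pE n d /\ pE n d *m hh w = pE n d.
Proof.
move=> Ew; have E : pE n d *m hh w = pE n d.
  by rewrite mulmxBr mulmx1 -scalemxAr mulmxA Ew mul0mx scaler0 subr0.
by split=> //; rewrite -[LHS]trmxK trmx_mul hh_tr pE_tr E pE_tr.
Qed.

Lemma dot_e n i : (0 < i <= n)%N -> dot (e i : 'cV[R]_n) (e i) = 1.
Proof.
case: i => // i /= ilt; rewrite /dot (bigD1 (Ordinal ilt))//= big1.
  by rewrite !mxE/= eqxx mulr1 addr0.
by move=> l; rewrite -val_eqE/= => /negPf li; rewrite !mxE eqSS li mul0r.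
Qed.

Lemma dot_e_neq n i i' : i != i' -> dot (e i : 'cV[R]_n) (e i') = 0.
Proof.
move=> ii; rewrite /dot big1// => l _; rewrite !mxE; case: eqP => [->|]; last by rewrite mul0r.
by rewrite (negPf ii) mulr0.
Qed.

Lemma pE0 n : pE n 0 = 0.
Proof.
apply/matrixP => i j; rewrite !mxE subn0 leqNgt ltn_ord andbF //.
Qed.

Lemma pES n d : (d < n)%N -> pE n d.+1 = pE n d + e (n - d) *m (e (n - d))^T.
Proof.
move=> dn; apply: mx_eq_cV => x; rewrite mulmxDl mul_col_dot; apply/matrixP => i j.
rewrite ord1 pE_mul [RHS]mxE pE_mul [X in _ = _ + X]mxE.
have -> : dot (e (n - d) : 'cV[R]_n) x = \sum_(l < n) (l.+1 == n - d)%N%:R * x l 0.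
  by apply: eq_bigr => l _; rewrite mxE.
rewrite [e _ _ _]mxE.
have [E|ne] := eqVneq i.+1 (n - d)%N.
  rewrite (bigD1 i)//= big1 ?addr0; last first.
    by move=> l li; rewrite -E eqSS; case: eqP => [/val_inj/eqP|]; rewrite ?(negPf li)// mul0r.
  rewrite E eqxx mul1r mulr1 subnS -E/= leqnn (_ : (i.+1 <= i)%N = false) ?ltnn//.
  by rewrite mul0r add0r mul1r.
rewrite mulr0 addr0; congr (_%:R * _); congr nat_of_bool.
by move/eqP: ne; lia.
Qed.

Lemma tr_pE n d : (d <= n)%N -> \tr (pE n d) = d%:R.
Proof.
elim: d => [|d ih] dn; first by rewrite pE0 mxtrace0.
rewrite pES// mxtraceD ih ?(ltnW dn)// mxtrace_mulC tr_mul_dot dot_e ?subn_gt0 ?dn ?leq_subr//.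
by rewrite mxtrace_scalar -natr1.
Qed.

(** For an orthogonal projection the trace is the rank, so the dimension of the range becomes an
    equation in the entries. *)
Definition isproj n d (P : 'M[R]_n) := [/\ P^T = P, P *m P = P & \tr P = d%:R].

(** The sum of the squares of the entries is the trace of P P = P, here 0. *)
Lemma isproj0 n (P : 'M[R]_n) : isproj 0 P -> P = 0.
Proof.
case=> PT PP tP; apply/matrixP => i j; rewrite mxE.
have : \sum_(a < n) \sum_(b < n) P a b ^+ 2 = 0.
  have tPP : \tr (P *m P) = 0 by rewrite PP.
  rewrite -[RHS]tPP; apply: eq_bigr => a _; rewrite mxE.
  by apply: eq_bigr => b _; rewrite expr2; congr (_ * _); rewrite -[in RHS]PT mxE.
move=> /eqP; rewrite psumr_eq0; last by move=> a _; apply: sumr_ge0 => b _; exact: sqr_ge0.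
move=> /allP/(_ i (mem_index_enum _))/=; rewrite psumr_eq0; last by move=> b _; exact: sqr_ge0.
by move=> /allP/(_ j (mem_index_enum _))/=; rewrite sqrf_eq0 => /eqP.
Qed.

Lemma isproj_sub n d (P : 'M[R]_n) (v : 'cV_n) : isproj d.+1 P -> P *m v = v -> dot v v = 1 ->
  isproj d (P - v *m v^T).
Proof.
move=> [PT PP tP] Pv vv; split.
- by rewrite linearB/= trmx_mul trmxK PT.
- rewrite mulmxBr !mulmxBl PP -(mulmxA v) [v^T *m P](_ : _ = v^T); last first.
    by rewrite -[in LHS]PT -trmx_mul Pv.
  rewrite mulmxA Pv mulmxA -(mulmxA v v^T v) tr_mul_dot vv mulmx1.
  by rewrite subrr subr0.
- by rewrite raddfB/= tP mxtrace_mulC tr_mul_dot vv mxtrace_scalar mulr1n -natr1 addrK.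
Qed.

Lemma isproj_add n d (P : 'M[R]_n) (v : 'cV_n) : isproj d P -> P *m v = 0 -> dot v v = 1 ->
  isproj d.+1 (P + v *m v^T).
Proof.
move=> [PT PP tP] Pv vv.
have vP : v^T *m P = 0 by rewrite -[in LHS]PT -trmx_mul Pv trmx0.
split.
- by rewrite linearD/= trmx_mul trmxK PT.
- rewrite mulmxDr !mulmxDl PP -(mulmxA v) vP mulmx0 addr0 mulmxA Pv mul0mx add0r.
  by rewrite mulmxA -(mulmxA v v^T v) tr_mul_dot vv mulmx1.
- by rewrite raddfD/= tP mxtrace_mulC tr_mul_dot vv mxtrace_scalar mulr1n -natr1.
Qed.

(** A measurable choice of a nonzero vector in the range of a projection: every column lies in the
    range, and only finitely many are tested. *)
Fixpoint first_col n (s : seq 'I_n) (P : 'M[R]_n) : 'cV[R]_n :=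
  if s is i :: s' then if dot (col i P) (col i P) == 0 then first_col s' P else col i P
  else 0.

Definition nrm n (v : 'cV[R]_n) : 'cV[R]_n := (enorm v)^-1 *: v.

Lemma dot_nrm n (v : 'cV[R]_n) : v != 0 -> dot (nrm v) (nrm v) = 1.
Proof.
move=> v0; rewrite /nrm dotZl dotZr -sqr_enorm; field.
by rewrite enorm_eq0.
Qed.

Definition ncol n (P : 'M[R]_n) := nrm (first_col (enum 'I_n) P).

Lemma ncolP n d (P : 'M[R]_n) : isproj d.+1 P ->
  P *m ncol P = ncol P /\ dot (ncol P) (ncol P) = 1.
Proof.
move=> [PT PP tP]; suff [H H0] : P *m first_col (enum 'I_n) P = first_col (enum 'I_n) P /\
    first_col (enum 'I_n) P != 0.
  by split; [rewrite -scalemxAr H|exact: dot_nrm].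
split.
  elim: (enum 'I_n) => [|i s ih] /=; first by rewrite mulmx0.
  by case: ifP => // _; rewrite colE mulmxA PP.
have : exists2 i, i \in enum 'I_n & col i P != 0.
  apply/not_exists2P => H; have P0 : P = 0.
    apply/matrixP => a b; rewrite mxE.
    have [//|/negP] := H b; first by rewrite mem_enum.
    by rewrite negbK => /eqP/matrixP/(_ a 0); rewrite !mxE.
  by move: tP; rewrite P0 mxtrace0 => /eqP; rewrite eq_sym pnatr_eq0.
elim: (enum 'I_n) => [[]//|i s ih] [l]; rewrite inE => /predU1P[->|ls] l0 /=.
  by rewrite dot_eq0 (negPf l0).
by case: ifP => [_|]; [apply: ih; exists l|rewrite dot_eq0 => ->].
Qed.

(* A measurable choice of A in O(n) with A R^d equal to the range of P. *)
Fixpoint sec n d (P : 'M[R]_n) : 'M[R]_n :=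
  if d is d'.+1 then
    let v := ncol P in
    let a := sec d' (P - v *m v^T) in a *m hh (a^T *m v - e (n - d'))
  else 1%:M.

(* [hh (a^T v - e (n - d))] sends [e (n - d)] to [a^T v] and fixes the last d unit
   vectors, which are orthogonal to both. *)
Lemma extend_frame n d (a P : 'M[R]_n) (v : 'cV_n) : (d < n)%N -> a^T *m a = 1%:M ->
  a *m pE n d *m a^T = P -> P *m v = 0 -> dot v v = 1 ->
  let b := a *m hh (a^T *m v - e (n - d)) in
  [/\ b^T *m b = 1%:M, b *m pE n d *m b^T = P & b *m e (n - d) = v].
Proof.
move=> dn aa aE Pv vv b; have aa' := ortho_tr aa.
set w := a^T *m v - e (n - d) in b *.
have Ee : pE n d *m e (n - d) = 0 :> 'cV[R]_n by rewrite pE_e ltnn scale0r.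
have Ew : pE n d *m w = 0.
  rewrite mulmxBr Ee subr0.
  have : a^T *m (P *m v) = 0 by rewrite Pv mulmx0.
  by rewrite -aE !mulmxA aa mul1mx.
have [hE Eh] := hh_pE Ew.
split.
- by rewrite trmx_mul mulmxA -(mulmxA _ a^T) aa mulmx1 hh_orthogonal.
- by rewrite trmx_mul hh_tr !mulmxA -(mulmxA a) hE -(mulmxA a) Eh.
- rewrite -mulmxA hh_map ?mulmxA ?aa' ?mul1mx//.
  by rewrite dot_e ?subn_gt0 ?dn ?leq_subr// dot_mulmxl trmxK mulmxA aa' mul1mx.
Qed.

(** Induction on d: the unit vector [ncol P] of the range is split off, and the frame of the
    remaining projection is extended by [extend_frame]. *)
Lemma secP n d (P : 'M[R]_n) : (d <= n)%N -> isproj d P ->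
  (sec d P)^T *m sec d P = 1%:M /\ sec d P *m pE n d *m (sec d P)^T = P.
Proof.
elim: d P => [|d ih] P dn hP.
  by rewrite /= pE0 mulmx0 mul0mx (isproj0 hP) trmx1 mulmx1.
have [Pv vv] := ncolP hP; have hP' := isproj_sub hP Pv vv.
have [aa aE] := ih _ (ltnW dn) hP'.
set v := ncol P in Pv vv hP' aa aE *.
have P'v : (P - v *m v^T) *m v = 0 by rewrite mulmxBl Pv -mulmxA tr_mul_dot vv mulmx1 subrr.
have [bb bE be] := extend_frame dn aa aE P'v vv.
split; first exact: bb.
rewrite /= -/v; set b := sec d _ *m hh _ in bb bE be *.
rewrite pES// mulmxDr mulmxDl bE mulmxA be.
by rewrite -(mulmxA v) -trmx_mul be subrK.
Qed.

(* As [sec], and e_(n-d) is sent to the direction of u. *)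
Definition flag n d (P : 'M[R]_n) (u : 'cV[R]_n) : 'M[R]_n :=
  let a := sec d P in a *m hh (a^T *m nrm u - e (n - d)).

Lemma flagP n d (P : 'M[R]_n) (u : 'cV[R]_n) : (d < n)%N -> isproj d P -> P *m u = 0 ->
  [/\ (flag d P u)^T *m flag d P u = 1%:M, flag d P u *m pE n d *m (flag d P u)^T = P &
   enorm u *: (flag d P u *m e (n - d)) = u].
Proof.
move=> dn hP Pu; have [aa aE] := secP (ltnW dn) hP.
(* For u = 0 the direction [nrm u] is 0 and the reflecting vector is - e_(n-d), orthogonal to the
   last d unit vectors. The first two clauses survive and the third reads 0 = 0. *)
have [->|u0] := eqVneq u 0.
  rewrite enorm0 scale0r.
  rewrite /flag /nrm scaler0 mulmx0 sub0r.
  set w := - e _.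
  have Ew : pE n d *m w = 0 by rewrite mulmxN pE_e ltnn scale0r oppr0.
  have [hE Eh] := hh_pE Ew; split => //.
  - by rewrite trmx_mul mulmxA -(mulmxA _ _ (sec d P)) aa mulmx1 hh_orthogonal.
  - by rewrite trmx_mul hh_tr !mulmxA -(mulmxA (sec d P)) hE -(mulmxA (sec d P)) Eh.
have vv := dot_nrm u0.
have Pv : P *m nrm u = 0 by rewrite -scalemxAr Pu scaler0.
have [bb bE be] := extend_frame dn aa aE Pv vv.
by split => //; rewrite [flag _ _ _ *m _]be /nrm scalerA mulfV ?scale1r// enorm_eq0.
Qed.

(** * Measurable dependence of frames on the projection *)

Section MeasurableSection.
Context dd (T : measurableType dd).

Lemma mmx_if m n (b : T -> bool) (F G : T -> 'M[R]_(m, n)) :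
  measurable_fun setT b -> mmx F -> mmx G -> mmx (fun t => if b t then F t else G t).
Proof.
move=> mb mF mG i j.
rewrite (_ : (fun _ => _) = fun t => if b t then F t i j else G t i j); last first.
  by apply/funext => t; case: ifP.
by apply: measurable_fun_ifT.
Qed.

Lemma mmx_col m n (F : T -> 'M[R]_(m, n)) l : mmx F -> mmx (fun t => col l (F t)).
Proof. by move=> mF i j; under eq_fun do rewrite mxE; exact: mF. Qed.

Lemma mmx_hh n (w : T -> 'cV[R]_n) : mmx w -> mmx (fun t => hh (w t)).
Proof.
move=> mw; apply: mmxB; first exact: mmx_cst.
apply: mmxZ; last by apply: mmxM => //; exact: mmxT.
by apply: measurable_funM => //; apply: measurable_inv; exact: measurable_dot.
Qed.

Lemma mmx_nrm n (w : T -> 'cV[R]_n) : mmx w -> mmx (fun t => nrm (w t)).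
Proof.
by move=> mw; apply: mmxZ => //; apply: measurable_inv; exact: measurable_enorm.
Qed.

Lemma mmx_ncol n (P : T -> 'M[R]_n) : mmx P -> mmx (fun t => ncol (P t)).
Proof.
move=> mP; apply: mmx_nrm; elim: (enum 'I_n) => [|i s ih] /=; first exact: mmx_cst.
apply: mmx_if => //; last exact: mmx_col.
by apply: measurable_fun_eqr => //; apply: measurable_dot; exact: mmx_col.
Qed.

Lemma mmx_sec n d (P : T -> 'M[R]_n) : mmx P -> mmx (fun t => sec d (P t)).
Proof.
elim: d P => [|d ih] P mP /=; first exact: mmx_cst.
have mv := mmx_ncol mP.
have ms : mmx (fun t => sec d (P t - ncol (P t) *m (ncol (P t))^T)).
  by apply: ih; apply: mmxB => //; apply: mmxM => //; exact: mmxT.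
apply: mmxM => //; apply: mmx_hh; apply: mmxB; last exact: mmx_cst.
by apply: mmxM => //; exact: mmxT.
Qed.

Lemma mmx_flag n d (P : T -> 'M[R]_n) (u : T -> 'cV[R]_n) : mmx P -> mmx u ->
  mmx (fun t => flag d (P t) (u t)).
Proof.
move=> mP mu; have ms := mmx_sec d mP.
apply: mmxM => //; apply: mmx_hh; apply: mmxB; last exact: mmx_cst.
by apply: mmxM; [exact: mmxT|exact: mmx_nrm].
Qed.

End MeasurableSection.
End Frames.

(** * Subspaces and their orthogonal projections *)

Section Subspaces.
Context (R : realType).
Implicit Types (n d : nat).

Definition sproj n (P : 'M[R]_n) := P^T = P /\ P *m P = P.

Definition projects_on n (P : 'M[R]_n) (V : {vspace 'cV[R]_n}) :=
  sproj P /\ forall x, (x \in V) = (P *m x == x).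

Lemma projects_on_in n (P : 'M[R]_n) V x : projects_on P V -> P *m x \in V.
Proof. by move=> [[PT PP] PV]; rewrite PV mulmxA PP. Qed.

Lemma projects_on_dot n (P : 'M[R]_n) (V : {vspace 'cV[R]_n}) x z : projects_on P V -> z \in V ->
  dot (P *m x) z = dot x z.
Proof. by move=> [[PT PP] PV]; rewrite PV => /eqP zV; rewrite dot_mulmxl PT zV. Qed.

(** Two candidates differ by a vector of S that is orthogonal to S. This replaces the choice made in
    [oproj] by a formula. *)
Lemma oproj_eq n (S : set 'cV[R]_n) (x y : 'cV_n) :
  (forall a b, S a -> S b -> S (a - b)) -> S y -> (forall z, S z -> dot (x - y) z = 0) ->
  oproj S x = y.
Proof.
move=> SB Sy yH; rewrite /oproj.
have [] := @xgetPex _ 0 [set y | S y /\ forall z, S z -> dot (x - y) z = 0]; first by exists y.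
set w := xget _ _ => Sw wH; apply/eqP; rewrite -subr_eq0 -dot_eq0.
have E : w - y = (x - y) - (x - w) by rewrite opprB [RHS]addrC addrA subrK.
by rewrite {1}E dotBl yH ?wH ?subrr//; exact: SB.
Qed.

Lemma oproj_vspace n (P : 'M[R]_n) (V : {vspace 'cV[R]_n}) x : projects_on P V ->
  oproj [set` V] x = P *m x.
Proof.
move=> PV; apply: oproj_eq.
- by move=> a b /= aV bV; rewrite rpredB.
- exact: projects_on_in PV.
- by move=> z /= zV; rewrite dotBl (projects_on_dot _ PV)// subrr.
Qed.

Lemma mulmx_e n (P : 'M[R]_n) (i : 'I_n) : P *m e i.+1 = col i P.
Proof.
by rewrite colE; congr (_ *m _); apply/matrixP => a b; rewrite !mxE ord1 eqxx andbT eqSS.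
Qed.

Lemma projmx_vspace n (P : 'M[R]_n) (V : {vspace 'cV[R]_n}) : projects_on P V ->
  projmx [set` V] = P.
Proof.
by move=> PV; apply/matrixP => a b; rewrite mxE (oproj_vspace _ PV) mulmx_e mxE.
Qed.

Lemma oproj_orth n (P : 'M[R]_n) (V : {vspace 'cV[R]_n}) x : projects_on P V ->
  oproj (orth [set` V]) x = x - P *m x.
Proof.
move=> PV; apply: oproj_eq.
- by move=> a b aV bV y yV; rewrite dotBl aV// bV// subrr.
- by move=> z /= zV; rewrite dotBl (projects_on_dot _ PV)// subrr.
- move=> z zV; rewrite opprB addrCA subrr addr0 dotC zV//=; exact: projects_on_in PV.
Qed.

Lemma orthP n (P : 'M[R]_n) (V : {vspace 'cV[R]_n}) u : projects_on P V ->
  orth [set` V] u <-> P *m u = 0.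
Proof.
move=> PV; split=> [uV|Pu z zV].
  by apply/eqP; rewrite -dot_eq0 (projects_on_dot _ PV) ?uV//=; exact: projects_on_in PV.
by rewrite -(projects_on_dot _ PV)// Pu dot0l.
Qed.

(** Induction on the dimension: for a unit vector v of V, the space V is the orthogonal sum of W and
    the line of v, and v v^T is added to the projection onto W. *)
Lemma vproj_exists n (V : {vspace 'cV[R]_n}) :
  exists2 P, isproj (\dim V) P & projects_on P V.
Proof.
move dE : (\dim V) => d; elim: d V dE => [|d ih] V dV.
  exists 0.
    by split; rewrite ?trmx0 ?mul0mx ?mxtrace0.
  split; first by split; rewrite ?trmx0 ?mul0mx.
  move=> x; have /eqP := dV; rewrite dimv_eq0 => /eqP ->.
  by rewrite memv0 mul0mx eq_sym.
pose v := nrm (vpick V).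
have v0 : vpick V != 0 by rewrite vpick0 -dimv_eq0 dV.
have vv : dot v v = 1 by exact: dot_nrm.
have vV : v \in V by rewrite memvZ// memv_pick.
pose W := (V :&: lker (linfun (mulmx v^T : 'cV[R]_n -> 'cV[R]_1)))%VS.
have WP x : (x \in W) = (x \in V) && (dot v x == 0).
  rewrite memv_cap memv_ker lfunE/= tr_mul_dot; congr (_ && _).
  by apply/eqP/eqP => [/matrixP/(_ 0 0)|->]; rewrite ?raddf0// !mxE.
have VE : (V = W + <[v]>)%VS.
  apply/eqP; rewrite eqEsubv subv_add capvSl -memvE vV !andbT.
  apply/subvP => x xV; rewrite -(subrK (dot v x *: v) x).
  apply: memv_add; last by rewrite memvZ// memv_line.
  by rewrite WP dotBr dotZr vv mulr1 subrr eqxx andbT rpredB// memvZ.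
have Wv : (W :&: <[v]> = 0)%VS.
  apply/eqP; rewrite -subv0; apply/subvP => x; rewrite memv_cap WP memv0.
  move=> /andP[/andP[_ /eqP vx] /vlineP[c xE]].
  by move: vx; rewrite xE dotZr vv mulr1 => ->; rewrite scale0r.
have dW : \dim W = d.
  have := dimv_disjoint_sum Wv; rewrite -VE dV dim_vline.
  have -> : v != 0 by rewrite -dot_eq0 vv oner_eq0.
  by rewrite addn1 => -[].
have [Q Q1 [[QT QQ] QP]] := ih _ dW.
have Qv : Q *m v = 0.
  apply/eqP; rewrite -dot_eq0.
  have QvW : Q *m v \in W by rewrite QP mulmxA QQ.
  by rewrite dot_mulmxl QT mulmxA QQ; move: QvW; rewrite WP => /andP[].
have [h1 h2 h3] := isproj_add Q1 Qv vv.
exists (Q + v *m v^T); first by [].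
split; first by [].
move=> x; rewrite mulmxDl mul_col_dot; apply/idP/eqP => [xV|<-].
  have : x - dot v x *: v \in W.
    by rewrite WP dotBr dotZr vv mulr1 subrr eqxx andbT rpredB// memvZ.
  by rewrite QP mulmxBr -scalemxAr Qv scaler0 subr0 => /eqP ->; rewrite subrK.
apply: rpredD; last exact: memvZ.
have : Q *m x \in W by rewrite QP mulmxA QQ.
by rewrite WP => /andP[].
Qed.

Lemma projmxP n (V : {vspace 'cV[R]_n}) :
  isproj (\dim V) (projmx [set` V]) /\ projects_on (projmx [set` V]) V.
Proof.
by have [P iP PV] := vproj_exists V; rewrite (projmx_vspace PV).
Qed.

Lemma projects_on_inj n (P : 'M[R]_n) V W : projects_on P V -> projects_on P W -> V = W.
Proof. by move=> [_ PV] [_ PW]; apply/vspaceP => x; rewrite PV PW. Qed.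

Lemma dim_projects_on n (P : 'M[R]_n) V d : projects_on P V -> \tr P = d%:R -> \dim V = d.
Proof.
move=> PV; have [[_ _ +] _] := projmxP V; rewrite (projmx_vspace PV) => -> /eqP.
by rewrite eqr_nat => /eqP.
Qed.

Lemma memv_limage n (A : 'M[R]_n) (V : {vspace 'cV[R]_n}) x :
  reflect (exists2 y, y \in V & x = A *m y) (x \in limage A V).
Proof.
apply: (iffP memv_imgP) => -[y yV ->]; exists y => //; by rewrite lfunE.
Qed.

Lemma memv_limage_ortho n (A : 'M[R]_n) (V : {vspace 'cV[R]_n}) x : A^T *m A = 1%:M ->
  (x \in limage A V) = (A^T *m x \in V).
Proof.
move=> AA; apply/memv_limage/idP => [[y yV ->]|xV]; first by rewrite mulmxA AA mul1mx.
by exists (A^T *m x) => //; rewrite mulmxA ortho_tr// mul1mx.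
Qed.

Lemma projects_on_limage n (A P : 'M[R]_n) (V : {vspace 'cV[R]_n}) : A^T *m A = 1%:M ->
  projects_on P V -> projects_on (A *m P *m A^T) (limage A V).
Proof.
move=> AA [[PT PP] PV]; have AA' := ortho_tr AA; split; first split.
- by rewrite !trmx_mul trmxK PT mulmxA.
- by rewrite !mulmxA -(mulmxA (A *m P)) AA mulmx1 -(mulmxA A) PP.
move=> x; rewrite memv_limage_ortho// PV.
apply/eqP/eqP => [E|E]; first by rewrite -!mulmxA E mulmxA AA' mul1mx.
by rewrite -[in RHS]E !mulmxA AA mul1mx.
Qed.

Lemma mem_coord_space n d (x : 'cV[R]_n) : (x \in coord_space n d) = (pE R n d *m x == x).
Proof.
apply/idP/eqP => [|E].
  rewrite /coord_space; move=> /coord_span ->; rewrite mulmx_sumr; apply: eq_bigr => i _.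
  rewrite -scalemxAr; congr (_ *: _).
  have id := ltn_ord i; rewrite /= (nth_map 0%N) ?size_iota// nth_iota//.
  by rewrite pE_e addSn ltnS leq_addr scale1r.
rewrite -E (_ : pE R n d *m x = \sum_(i < n) (x i 0 * (n - d <= i)%N%:R) *: e i.+1); last first.
  apply/matrixP => a b; rewrite pE_mul summxE (bigD1 a)//= big1 ?addr0.
    by rewrite !mxE eqxx mulr1 ord1 mulrC.
  by move=> l la; rewrite !mxE eqSS val_eqE eq_sym (negPf la) mulr0.
apply: rpred_sum => i _; case: (leqP (n - d) i) => h; last by rewrite mulr0 scale0r mem0v.
apply: memvZ; apply: memv_span; apply/mapP; exists i.+1 => //.
rewrite mem_iota; have := ltn_ord i; lia.
Qed.

Lemma projects_on_coord n d : projects_on (pE R n d) (coord_space n d).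
Proof. by split; [split; [exact: pE_tr|exact: pE_idem]|exact: mem_coord_space]. Qed.

Lemma projects_on_frame n d (A : 'M[R]_n) : A^T *m A = 1%:M ->
  projects_on (A *m pE R n d *m A^T) (limage A (coord_space n d)).
Proof. by move=> AA; apply: projects_on_limage => //; exact: projects_on_coord. Qed.

Lemma linspan_vspace n (S : set 'cV[R]_n) (W : {vspace 'cV[R]_n}) : S `<=` [set` W] ->
  (forall V : {vspace 'cV[R]_n}, S `<=` [set` V] -> (W <= V)%VS) -> linspan S = [set` W].
Proof.
move=> SW WS; apply/seteqP; split => x /= H; first exact: H.
by move=> V /WS /subvP; apply.
Qed.

End Subspaces.

(** * Geodesics *)

Section HyperbolicFunctions.
Context (R : realType).
Implicit Types r : R.

Definition tanh r : R := sinh r / cosh r.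

Lemma cosh_gt0 r : 0 < cosh r.
Proof. by rewrite divr_gt0// addr_gt0 ?expR_gt0. Qed.

Lemma cosh_neq0 r : cosh r != 0. Proof. by rewrite gt_eqF ?cosh_gt0. Qed.

Lemma cosh_add_sinh r : cosh r + sinh r = expR r.
Proof. by rewrite /cosh /sinh; field. Qed.

Lemma cosh2 r : cosh r ^+ 2 = 1 + sinh r ^+ 2.
Proof.
have : expR r * expR (- r) = 1 by rewrite -expRD subrr expR0.
rewrite /cosh /sinh; move: (expR r) (expR (- r)) => a b ab.
by transitivity (a * b + ((a - b) / 2) ^+ 2); [field|rewrite ab].
Qed.

Lemma sinh_ge0 r : 0 <= r -> 0 <= sinh r.
Proof. by move=> r0; rewrite divr_ge0// subr_ge0 ler_expR; lra. Qed.

Lemma sinh_gt0 r : 0 < r -> 0 < sinh r.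
Proof. by move=> r0; rewrite divr_gt0// subr_gt0 ltr_expR; lra. Qed.

Lemma tanh_ge0 r : 0 <= r -> 0 <= tanh r.
Proof. by move=> r0; rewrite divr_ge0 ?sinh_ge0// ltW// cosh_gt0. Qed.

Lemma tanh2 r : 1 - tanh r ^+ 2 = (cosh r ^+ 2)^-1.
Proof.
have := cosh2 r; have := cosh_neq0 r; rewrite /tanh; move: (cosh r) (sinh r) => c s c0 E.
rewrite expr_div_n (_ : s ^+ 2 = c ^+ 2 - 1); last by rewrite E addrC addKr.
by field.
Qed.

Lemma tanh_lt1 r : tanh r ^+ 2 < 1.
Proof. by rewrite -subr_gt0 tanh2 invr_gt0 exprn_gt0 ?cosh_gt0. Qed.

Lemma tanh_surj (a : R) : 0 <= a -> a < 1 -> exists2 r, 0 <= r & tanh r = a.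
Proof.
move=> a0 a1; have q0 : 0 < (1 + a) / (1 - a) by rewrite divr_gt0; lra.
(* The inverse hyperbolic tangent of a. *)
exists (ln ((1 + a) / (1 - a)) / 2).
  by rewrite divr_ge0// ln_ge0// ler_pdivlMr; lra.
set r := _ / 2; have E : expR r * expR r = (1 + a) / (1 - a).
  rewrite -expRD (_ : r + r = ln ((1 + a) / (1 - a))) ?lnK ?posrE// /r; by field.
have n0 : expR r != 0 by rewrite gt_eqF ?expR_gt0.
have p0 : 0 < expR r * expR r + 1 by rewrite addr_gt0// mulr_gt0 ?expR_gt0.
have e0 : expR r + (expR r)^-1 != 0.
  by rewrite gt_eqF// addr_gt0 ?invr_gt0 ?expR_gt0.
rewrite /tanh /sinh /cosh expRN.
have -> : (expR r - (expR r)^-1) / 2 / ((expR r + (expR r)^-1) / 2) =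
    (expR r * expR r - 1) / (expR r * expR r + 1).
  by field; rewrite n0 ?e0 ?(lt0r_neq0 p0).
rewrite E; field.
by apply/andP; split; rewrite gt_eqF//; lra.
Qed.

Lemma acosh_cosh r : 0 <= r -> acosh (cosh r) = r.
Proof.
move=> r0; rewrite /acosh cosh2 addrAC subrr add0r sqrtr_sqr ger0_norm ?sinh_ge0//.
by rewrite cosh_add_sinh expRK.
Qed.

Lemma le_acosh (x y : R) : 1 <= x -> x <= y -> acosh x <= acosh y.
Proof.
move=> x1 xy; rewrite /acosh ler_ln ?posrE; last 2 first.
- by rewrite ltr_wpDr ?sqrtr_ge0//; lra.
- by rewrite ltr_wpDr ?sqrtr_ge0//; lra.
by apply: lerD => //; apply: ler_wsqrtr; nra.
Qed.

End HyperbolicFunctions.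

Section Geodesics.
Context (R : realType) (n : nat).
Implicit Types (P : 'M[R]_n) (u x y : 'cV[R]_n) (a b c : R).

Definition hv x c : 'cV[R]_(n + 1) := col_mx x c%:M.

Lemma hvE (z : 'cV[R]_(n + 1)) : z = hv (usubmx z) (dsubmx z 0 0).
Proof. by rewrite -[LHS]vsubmxK /hv -mx11_scalar. Qed.

Lemma hv_ind (Q : 'cV[R]_(n + 1) -> Prop) : (forall x c, Q (hv x c)) -> forall z, Q z.
Proof. by move=> H z; rewrite (hvE z). Qed.

Lemma usub_hv x c : usubmx (hv x c) = x. Proof. exact: col_mxKu. Qed.

Lemma dsub_hv x c : dsubmx (hv x c) 0 0 = c.
Proof. by rewrite col_mxKd mxE eqxx. Qed.

Lemma hv_inj x y a b : hv x a = hv y b -> x = y /\ a = b.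
Proof.
by move=> E; split; [have := congr1 usubmx E; rewrite !usub_hv|
  rewrite -(dsub_hv x a) E dsub_hv].
Qed.

Lemma hvD x y a b : hv x a + hv y b = hv (x + y) (a + b).
Proof. by rewrite /hv add_col_mx -raddfD. Qed.

Lemma hvZ x a c : c *: hv x a = hv (c *: x) (c * a).
Proof. by rewrite /hv scale_col_mx scale_scalar_mx. Qed.

Lemma dot_hv x y a b : dot (hv x a) (hv y b) = dot x y + a * b.
Proof.
rewrite !dotE tr_col_mx mul_row_col mxE tr_scalar_mx -scalar_mxM.
by rewrite [in X in _ + X]mxE eqxx.
Qed.

Lemma e_last : e n.+1 = hv 0 1.
Proof.
apply/matrixP => i j; rewrite ord1 !mxE; case: fintype.splitP => l E; rewrite !mxE E eqSS.
  by rewrite ltn_eqF.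
by rewrite !ord1 addn0 eqxx.
Qed.

(* When P projects onto V and u is orthogonal to V, this projects onto the span
   of V and (u, 1), that is, onto the span of the geodesic pi(V + u). *)
Definition Pm P u : 'M[R]_(n + 1) :=
  block_mx P 0 0 0 + (1 + dot u u)^-1 *: (hv u 1 *m (hv u 1)^T).

Lemma dot1_neq0 u : 1 + dot u u != 0.
Proof. by rewrite gt_eqF// ltr_wpDr// dot_ge0. Qed.

Lemma Pm_mul P u x c :
  Pm P u *m hv x c = hv (P *m x) 0 + ((dot u x + c) / (1 + dot u u)) *: hv u 1.
Proof.
rewrite mulmxDl mul_block_col !mul0mx !addr0; congr (_ + _).
  by rewrite /hv raddf0.
by rewrite -scalemxAl mul_col_dot dot_hv mul1r scalerA mulrC.
Qed.

(** (x, c) = (x - c u, 0) + c (u, 1) lies in the span of V and (u, 1) exactly when P fixes x - c u;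
    as P u = 0, this is the equation on the right. *)
Lemma fix_Pm P u x c : P^T = P -> P *m u = 0 ->
  Pm P u *m hv x c = hv x c <-> P *m x = x - c *: u.
Proof.
move=> PT Pu; rewrite Pm_mul hvZ hvD mulr1 add0r; split.
  by move=> /hv_inj[Ex Ec]; rewrite -[in RHS]Ex Ec addrK.
move=> E; have ux : dot u x = c * dot u u.
  have : dot u (P *m x) = 0 by rewrite dotC dot_mulmxl PT Pu dotC dot0l.
  by rewrite E dotBr dotZr => /eqP; rewrite subr_eq0 => /eqP.
have -> : (dot u x + c) / (1 + dot u u) = c.
  by rewrite ux; field; exact: dot1_neq0.
by rewrite E subrK.
Qed.

Lemma dot_fix P u x c : P^T = P -> P *m u = 0 -> P *m x = x - c *: u ->
  dot x x = dot (P *m x) (P *m x) + c ^+ 2 * dot u u.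
Proof.
move=> PT Pu E; have Pxu : dot (P *m x) u = 0 by rewrite dot_mulmxl PT Pu dotC dot0l.
have xE : x = P *m x + c *: u by rewrite E subrK.
by rewrite [in LHS]xE !dotDl !dotDr !dotZl !dotZr (dotC u) Pxu; ring.
Qed.

Lemma isproj_Pm d P u : isproj d P -> P *m u = 0 -> isproj d.+1 (Pm P u).
Proof.
move=> [PT PP tP] Pu.
have hb : isproj d (block_mx P 0 0 0 : 'M[R]_(n + 1)).
  split.
  - by rewrite tr_block_mx !trmx0 PT.
  - by rewrite mulmx_block !mulmx0 !mul0mx !addr0 PP.
  - by rewrite mxtrace_block mxtrace0 addr0.
have h0 : hv u 1 != 0.
  by apply/eqP => /(congr1 (fun z => dsubmx z 0 0)) /eqP; rewrite dsub_hv !mxE oner_eq0.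
have := isproj_add hb _ (dot_nrm h0); rewrite /Pm.
have -> : (1 + dot u u)^-1 *: (hv u 1 *m (hv u 1)^T) = nrm (hv u 1) *m (nrm (hv u 1))^T.
  rewrite /nrm linearZ/= -scalemxAl -scalemxAr scalerA -invfM -expr2 sqr_enorm dot_hv.
  by rewrite mulr1 addrC.
apply; rewrite -scalemxAr [_ *m hv u 1](_ : _ = 0) ?scaler0//.
by rewrite mul_block_col !mul0mx !addr0 Pu col_mx0.
Qed.

Definition geod (M : 'M[R]_(n + 1)) : set 'cV[R]_(n + 1) :=
  Hyp n `&` [set z | M *m z = z].

Lemma in_Hyp x c : Hyp n (hv x c) <-> c ^+ 2 = 1 + dot x x /\ 0 < c.
Proof.
rewrite /Hyp/= /lform usub_hv dsub_hv (_ : dot (dsubmx _) _ = c ^+ 2); last first.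
  by rewrite /dot big_ord1 dsub_hv expr2.
by split=> -[E c0]; split => //; lra.
Qed.

Lemma in_geod P u x c : P^T = P -> P *m u = 0 ->
  geod (Pm P u) (hv x c) <-> [/\ c ^+ 2 = 1 + dot x x, 0 < c & P *m x = x - c *: u].
Proof.
move=> PT Pu; rewrite /geod/= in_Hyp fix_Pm//.
by split => [[[? ?] ?]|[? ? ?]].
Qed.

(** A plane of the Klein ball encoded by matrices: the projection onto its direction and its point
    nearest to the origin. *)
Definition gpair d P u := [/\ isproj d P, P *m u = 0 & dot u u < 1].

Definition vimg m (P : 'M[R]_m) : {vspace 'cV[R]_m} := limage P fullv.

Lemma projects_on_vimg m (P : 'M[R]_m) : sproj P -> projects_on P (vimg P).
Proof.
move=> [PT PP]; split => // x; apply/memv_limage/eqP => [[y _ ->]|<-].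
  by rewrite mulmxA PP.
by exists x; rewrite ?memvf.
Qed.

Lemma isproj_sproj m d (P : 'M[R]_m) : isproj d P -> sproj P. Proof. by case. Qed.

Lemma dim_vimg m d (P : 'M[R]_m) : isproj d P -> \dim (vimg P) = d.
Proof.
move=> hP; apply: (dim_projects_on (projects_on_vimg (isproj_sproj hP))).
by case: hP.
Qed.

(** A timelike vector of the range with positive last coordinate is a positive multiple of a point
    of the geodesic, hence lies in any V containing the geodesic. This applies to (u, 1), since |u|
    < 1, and to (x, c) + T (u, 1) for T large; subtracting gives an arbitrary vector (x, c) of the
    range. *)
Lemma linspan_geod d P u : gpair d P u -> linspan (geod (Pm P u)) = [set` vimg (Pm P u)].
Proof.
move=> [hP Pu u1]; have [PT PP _] := hP.
have [_ WP] := projects_on_vimg (isproj_sproj (isproj_Pm hP Pu)).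
apply: linspan_vspace => [z [_ /= zM]|V VG]; first by rewrite /= WP zM.
pose q x c := c ^+ 2 - dot x x.
have timelike x c : P *m x = x - c *: u -> 0 < c -> 0 < q x c -> hv x c \in V.
  move=> E c0 q0; have s0 : 0 < Num.sqrt (q x c) by rewrite sqrtr_gt0.
  rewrite -[hv x c]scale1r -(divff (lt0r_neq0 s0)) -scalerA memvZ//.
  apply: VG; rewrite hvZ; apply/(in_geod _ _ PT Pu); split.
  - rewrite exprMn exprVn sqr_sqrtr ?(ltW q0)// dotZl dotZr mulrA -expr2 exprVn.
    by rewrite sqr_sqrtr ?(ltW q0)// /q; field; rewrite gt_eqF.
  - by rewrite mulr_gt0 ?invr_gt0.
  - by rewrite -scalemxAr E scalerBr scalerA.
have uV : hv u 1 \in V.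
  apply: timelike; rewrite ?Pu ?scale1r ?subrr//.
  by rewrite /q expr1n subr_gt0.
apply/subvP => z; rewrite WP; elim/hv_ind: z => x c /eqP/(fix_Pm _ _ PT Pu) E.
pose s := 1 - dot u u; have s0 : 0 < s by rewrite subr_gt0.
pose A : R := `|q x c|; pose B : R := `|c - dot x u|.
(* With s = 1 - |u|^2 the form at (x, c) + T (u, 1) is q + 2 T (c - x.u) + T^2 s. It is positive
   because T >= 1 and T s >= |q| + 2 |c - x.u| + s, and T > |c| keeps the last coordinate
   positive. *)
pose T : R := 2 + `|c| + (A + 2 * B) / s.
have AB : 0 <= (A + 2 * B) / s by apply: divr_ge0; [rewrite addr_ge0 ?mulr_ge0 ?normr_ge0|exact: ltW].
have T2 : 2 + `|c| <= T by rewrite /T lerDl.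
have T1 : 1 <= T by apply: le_trans T2; have := normr_ge0 c; lra.
have Ts : A + 2 * B + s <= T * s.
  rewrite /T [X in _ <= X]mulrDl divfK ?lt0r_neq0//; have := normr_ge0 c; nra.
suff : hv (x + T *: u) (c + T) \in V.
  move=> h; have -> : hv x c = hv (x + T *: u) (c + T) - T *: hv u 1.
    by rewrite -scaleN1r !hvZ hvD scaleN1r mulN1r mulr1 !addrK.
  by rewrite rpredB// memvZ.
apply: timelike.
- by rewrite mulmxDr -scalemxAr Pu scaler0 addr0 E (scalerDl u c T) opprD addrACA subrr addr0.
- by have := ler_norm (- c); rewrite normrN; lra.
- have -> : q (x + T *: u) (c + T) = q x c + 2 * T * (c - dot x u) + T ^+ 2 * s.
    by rewrite /q /s !dotDl !dotDr !dotZl !dotZr (dotC u x); ring.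
  have hA : - A <= q x c by rewrite lerNl /A -normrN ler_norm.
  have hB : - B <= c - dot x u by rewrite lerNl /B -normrN ler_norm.
  have A0 : 0 <= A by exact: normr_ge0.
  have h1 : T * (A + 2 * B + s) <= T * (T * s) by rewrite ler_wpM2l//; lra.
  have h2 : A + s <= T * (A + s) by rewrite ler_peMl// addr_ge0// ltW.
  have h3 : T * - B <= T * (c - dot x u) by rewrite ler_wpM2l//; lra.
  by move: h1 h2 h3; rewrite expr2 -mulrA; lra.
Qed.

Lemma projmx_geod d P u : gpair d P u -> projmx (linspan (geod (Pm P u))) = Pm P u.
Proof.
move=> H; rewrite (linspan_geod H); apply/projmx_vspace/projects_on_vimg.
by have [hP Pu _] := H; exact: isproj_sproj (isproj_Pm hP Pu).
Qed.

(* [uM] and [PM] recover u and P from [Pm P u]. *)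
Definition uM (M : 'M[R]_(n + 1)) : 'cV[R]_n :=
  (dsubmx (M *m hv 0 1) 0 0)^-1 *: usubmx (M *m hv 0 1).

Definition PM (M : 'M[R]_(n + 1)) : 'M[R]_n :=
  ulsubmx M - (1 + dot (uM M) (uM M))^-1 *: (uM M *m (uM M)^T).

Lemma uM_Pm P u : uM (Pm P u) = u.
Proof.
rewrite /uM Pm_mul mulmx0 dotC dot0l add0r hvZ hvD !add0r usub_hv dsub_hv mulr1 mul1r scalerA.
by rewrite mulVf ?scale1r// invr_eq0 dot1_neq0.
Qed.

Lemma PM_Pm P u : PM (Pm P u) = P.
Proof.
rewrite /PM uM_Pm /Pm tr_col_mx mul_col_row scale_block_mx add_block_mx block_mxKul.
by rewrite addrK.
Qed.

Lemma Pm_inj P u P' u' : Pm P u = Pm P' u' -> P = P' /\ u = u'.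
Proof. by move=> E; split; [rewrite -(PM_Pm P u) E PM_Pm|rewrite -(uM_Pm P u) E uM_Pm]. Qed.

Lemma GammaB_gpair d (tau : plane R n) : GammaB n d tau ->
  gpair d (projmx [set` tau.1]) tau.2 /\ vimg (projmx [set` tau.1]) = tau.1.
Proof.
move=> [[dV uV] u1]; have [hP PV] := projmxP tau.1; split; last first.
  exact: (projects_on_inj (projects_on_vimg (isproj_sproj hP)) PV).
split; [by rewrite -dV|exact/(orthP _ PV)|].
by rewrite -sqr_enorm expr_lt1// enorm_ge0.
Qed.

Lemma gpair_GammaB d P u : gpair d P u -> GammaB n d (vimg P, u).
Proof.
move=> [hP Pu u1]; have PV := projects_on_vimg (isproj_sproj hP).
split; first by split => /=; [exact: dim_vimg hP|exact/(orthP _ PV)].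
by move: u1; rewrite -sqr_enorm expr_lt1// enorm_ge0.
Qed.

Lemma pi_geodE d P u : gpair d P u -> pi_geod (vimg P, u) = geod (Pm P u).
Proof.
move=> [hP Pu _]; have [PT PP _] := hP.
have [_ PV] := projects_on_vimg (isproj_sproj hP).
have [_ WP] := projects_on_vimg (isproj_sproj (isproj_Pm hP Pu)).
rewrite /pi_geod /geod; congr (_ `&` _).
rewrite (_ : [set z | _] = [set` vimg (Pm P u)]); last first.
  by apply/seteqP; split => z /=; rewrite WP => /eqP.
have E x : col_mx (x + u) 0 + e n.+1 = hv (x + u) 1.
  rewrite e_last -[in LHS](_ : hv (x + u) 0 = col_mx (x + u) 0); last by rewrite /hv raddf0.
  by rewrite hvD addr0 add0r.
apply: linspan_vspace => [_ /= [_ [x /= xV <-] <-]|V VS].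
  rewrite WP E; apply/eqP/fix_Pm => //; rewrite scale1r addrK mulmxDr Pu addr0.
  by apply/eqP; rewrite -PV.
have h x : x \in vimg P -> hv (x + u) 1 \in V.
  by move=> xV; apply: VS => /=; exists (x + u); [exists x|rewrite -E].
apply/subvP => z; rewrite WP; elim/hv_ind: z => x c /eqP/(fix_Pm _ _ PT Pu) Ex.
(* The points P x + u and u of the plane generate (x, c), because P x = x - c u. *)
have -> : hv x c = (hv (P *m x + u) 1 - hv (0 + u) 1) + c *: hv (0 + u) 1.
  rewrite -scaleN1r !hvZ !hvD Ex; congr hv; last by ring.
  by rewrite scaleN1r add0r -(addrA (x - _)) subrr addr0 subrK.
rewrite rpredD ?memvZ ?rpredB//; first [exact: h (mem0v _)|idtac].
by apply: h; rewrite PV mulmxA PP.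
Qed.

(** The choice in [pi_inv] is forced: the span of the geodesic determines its projection [Pm P u],
    hence P and u. *)
Lemma pi_inv_geod d P u : gpair d P u -> Defs.pi_inv d (geod (Pm P u)) = (vimg P, u).
Proof.
move=> H; rewrite /Defs.pi_inv; set S := [set tau | _].
have [] := @xgetPex _ (0%VS, 0) S.
  by exists (vimg P, u); split; [exact: gpair_GammaB|exact: pi_geodE H].
set tau := xget _ _ => tB; have [tG tV] := GammaB_gpair tB.
rewrite [tau]surjective_pairing -tV (pi_geodE tG) => /(congr1 (fun t => projmx (linspan t))).
by rewrite (projmx_geod tG) (projmx_geod H) => /Pm_inj[-> ->].
Qed.

Lemma geod_GammaH d P u : gpair d P u -> GammaH n d (geod (Pm P u)).
Proof.
move=> [hP Pu u1]; have [PT PP _] := hP.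
have [_ WP] := projects_on_vimg (isproj_sproj (isproj_Pm hP Pu)).
split; last first.
  exists (vimg (Pm P u)); first exact: dim_vimg (isproj_Pm hP Pu).
  by congr (_ `&` _); apply/seteqP; split => z /=; rewrite WP => /eqP.
have s0 : 0 < Num.sqrt (1 - dot u u) by rewrite sqrtr_gt0 subr_gt0.
(* The point of the geodesic on the ray through (u, 1). *)
exists ((Num.sqrt (1 - dot u u))^-1 *: hv u 1); rewrite hvZ; apply/(in_geod _ _ PT Pu); split.
- rewrite mulr1 dotZl dotZr mulrA -expr2 exprVn sqr_sqrtr ?subr_ge0 ?(ltW u1)//.
  by field; rewrite subr_eq0 gt_eqF.
- by rewrite mulr1 invr_gt0.
- by rewrite -scalemxAr Pu scaler0 mulr1 subrr.
Qed.

(** Let M project onto the span W, and let q be the projection of e_(n+1). Then q is a multiple of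
    some (u, 1), and M minus the projection onto the line of q kills e_(n+1), so it comes from a
    projection P of R^n, with P u = 0. *)
Lemma GammaH_geod d t : GammaH n d t -> exists P u, gpair d P u /\ t = geod (Pm P u).
Proof.
move=> [[w wt] [W dW tW]]; have [hM MW] := projmxP W; rewrite dW in hM.
set M := projmx _ in hM MW; have [MT MM _] := hM; have [_ WP] := MW.
have := wt; rewrite tW => -[wH wW].
pose q := M *m hv 0 1; have Mq : M *m q = q by rewrite mulmxA MM.
(* Pairing with q reads off the last coordinate on W; in particular |q|^2 is the last coordinate of
   q itself. *)
have qdot z : M *m z = z -> dot q z = dsubmx z 0 0.
  by move=> Mz; rewrite dot_mulmxl MT Mz (hvE z) dot_hv dot0l add0r mul1r !dsub_hv.
have Mw : M *m w = w by apply/eqP; rewrite -WP.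
have w0 : 0 < dsubmx w 0 0 by case: wH.
have q_neq0 : q != 0 by apply/eqP => q0; move: w0; rewrite -(qdot _ Mw) q0 dot0l ltxx.
pose l := dsubmx q 0 0; have ql : dot q q = l by exact: qdot.
have l0 : 0 < l by rewrite -ql lt0r dot_eq0 q_neq0 dot_ge0.
pose u := l^-1 *: usubmx q.
have qu : q = l *: hv u 1 by rewrite hvZ scalerA mulr1 mulfV ?scale1r ?gt_eqF// -hvE.
have luu : l * (1 + dot u u) = 1.
  have := ql; rewrite qu dotZl dotZr dot_hv mulr1 => /eqP.
  rewrite -subr_eq0 -{3}(mulr1 l) -mulrBr mulf_eq0 gt_eqF//= subr_eq0 => /eqP.
  by rewrite addrC.
have Mv : M *m nrm q = nrm q by rewrite -scalemxAr Mq.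
have hN := isproj_sub hM Mv (dot_nrm q_neq0).
have vE : nrm q *m (nrm q)^T = (1 + dot u u)^-1 *: (hv u 1 *m (hv u 1)^T).
  rewrite /nrm linearZ/= -scalemxAl -scalemxAr scalerA -invfM -expr2 sqr_enorm ql qu.
  rewrite linearZ/= -scalemxAl -scalemxAr !scalerA; congr (_ *: _).
  rewrite mulKf ?gt_eqF//; apply: (mulIf (dot1_neq0 u)).
  by rewrite luu mulVf ?dot1_neq0.
move: hN; rewrite vE; set N := M - _ => hN; have [NT NN tN] := hN.
have Ne : N *m hv 0 1 = 0.
  rewrite mulmxBl -/q -scalemxAl mul_col_dot dot_hv (dotC u) dot0l add0r mulr1 scale1r.
  rewrite {1}qu -scalerBl; apply/eqP; rewrite scaler_eq0 subr_eq0; apply/orP; left.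
  by apply/eqP/(mulIf (dot1_neq0 u)); rewrite luu mulVf ?dot1_neq0.
pose P := ulsubmx N.
have NE : N = block_mx P 0 0 0.
  have E1 : ursubmx N = 0 /\ drsubmx N = 0.
    have := Ne; rewrite -{1}(submxK N) mul_block_col !mulmx0 !add0r !mulmx1.
    by move=> /eqP; rewrite col_mx_eq0 => /andP[/eqP -> /eqP ->].
  have E2 : dlsubmx N = 0 by rewrite -[LHS]trmxK trmx_dlsub NT E1.1 trmx0.
  by rewrite -{1}(submxK N) E1.1 E1.2 E2.
have hP : isproj d P.
  split.
  - by rewrite /P trmx_ulsub NT.
  - by have := NN; rewrite {1 2}NE mulmx_block !mulmx0 !addr0 => E; rewrite {3}/P -E block_mxKul.
  - by rewrite -tN NE mxtrace_block mxtrace0 addr0.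
have ME : M = Pm P u by rewrite /Pm -NE subrK.
have Nq : N *m q = 0.
  rewrite /N mulmxBl Mq -scalemxAl mul_col_dot {2}qu dotZr dot_hv mulr1 scalerA.
  by rewrite mulrCA (addrC (dot u u)) mulVf ?dot1_neq0// mulr1 -qu subrr.
have Pu : P *m u = 0.
  have := Nq; rewrite NE qu -scalemxAr mul_block_col !mul0mx !addr0 => /eqP.
  rewrite scaler_eq0 gt_eqF//= => /eqP/(congr1 usubmx).
  by rewrite col_mxKu linear0.
(* W contains a point (x, c) of the hyperboloid, where c^2 = 1 + |x|^2 and |x|^2 = |P x|^2 + c^2
   |u|^2. *)
have u1 : dot u u < 1.
  have [PT PP _] := hP; move: Mw wH; rewrite ME; elim/hv_ind: w {wt wW w0 qdot} => x c.
  move=> /(fix_Pm _ _ PT Pu) E /in_Hyp[Ec c0].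
  by have := dot_ge0 (P *m x); move: Ec; rewrite (dot_fix PT Pu E); nra.
exists P, u; split; first by split.
by rewrite -ME; congr (_ `&` _); apply/seteqP; split => z /=; rewrite WP => /eqP.
Qed.

(** On the geodesic c^2 (1 - |u|^2) = 1 + |P x|^2, so the last coordinate c is at least cosh r, with
    equality at cosh r (u, 1); the distance to e_(n+1) is [acosh c]. *)
Lemma gnorm_geod d P u (r : R) : gpair d P u -> 0 <= r -> dot u u = tanh r ^+ 2 ->
  Defs.gnorm (geod (Pm P u)) = r.
Proof.
move=> [hP Pu u1] r0 ur; have [PT PP _] := hP; rewrite /Defs.gnorm.
set S := [set _ | _ in _].
have hd x c : hdist (e n.+1) (hv x c) = acosh c.
  rewrite /hdist /lform e_last !usub_hv dot0l oppr0 add0r.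
  by rewrite /dot big_ord1 !dsub_hv mul1r.
have C1 : 1 <= cosh r.
  by rewrite -(@ler_pXn2r _ 2) ?nnegrE ?(ltW (cosh_gt0 _))// expr1n cosh2 lerDl sqr_ge0.
have Sr : S r.
  exists (cosh r *: hv u 1); last by rewrite hvZ hd mulr1 acosh_cosh.
  rewrite hvZ; apply/(in_geod _ _ PT Pu); rewrite mulr1 -scalemxAr Pu scaler0 subrr cosh_gt0.
  split => //; rewrite dotZl dotZr ur /tanh cosh2; congr (_ + _).
  by field; rewrite cosh_neq0.
have Sl : lbound S r.
  move=> _ [z zG <-]; elim/hv_ind: z zG => x c /(in_geod _ _ PT Pu)[Ec c0 E].
  rewrite hd -[leLHS](acosh_cosh r0); apply: le_acosh => //.
  rewrite -(@ler_pXn2r _ 2) ?nnegrE ?(ltW (cosh_gt0 _)) ?(ltW c0)//.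
  have : 1 <= c ^+ 2 * (1 - tanh r ^+ 2).
    by have := dot_ge0 (P *m x); move: Ec; rewrite (dot_fix PT Pu E) ur; nra.
  by rewrite tanh2 ler_pdivlMr ?exprn_gt0 ?cosh_gt0// mul1r.
apply/eqP; rewrite eq_le; apply/andP; split.
  by apply: ge_inf => //; exists r.
by apply: lb_le_inf => //; exists r.
Qed.

End Geodesics.

(** * Rotations and hyperbolic rotations acting on geodesics *)

Section Actions.
Context (R : realType) (n : nat).
Implicit Types (P A B : 'M[R]_n) (u x y : 'cV[R]_n) (c : R).

Lemma lift_rot_hv A x c : lift_rot A *m hv x c = hv (A *m x) c.
Proof. by rewrite /lift_rot mul_block_col !mul0mx addr0 add0r mul1mx. Qed.

Lemma lift_rot_geod A P u : A^T *m A = 1%:M -> P^T = P -> P *m u = 0 ->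
  mulmx (lift_rot A) @` geod (Pm P u) = geod (Pm (A *m P *m A^T) (A *m u)).
Proof.
move=> AA PT Pu; have AA' := ortho_tr AA.
have PT' : (A *m P *m A^T)^T = A *m P *m A^T by rewrite !trmx_mul trmxK PT mulmxA.
have Pu' : A *m P *m A^T *m (A *m u) = 0.
  by rewrite mulmxA -(mulmxA _ _ A) AA mulmx1 -mulmxA Pu mulmx0.
apply/seteqP; split => [_ [z zG <-]|z].
  elim/hv_ind: z zG => x c /(in_geod _ _ PT Pu)[E c0 Px]; rewrite lift_rot_hv.
  apply/(in_geod _ _ PT' Pu'); split; rewrite ?dot_orthogonal//.
  by rewrite mulmxA -(mulmxA _ _ A) AA mulmx1 -mulmxA Px mulmxBr -scalemxAr.
elim/hv_ind: z => x c /(in_geod _ _ PT' Pu')[E c0 Px].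
exists (hv (A^T *m x) c); last by rewrite lift_rot_hv mulmxA AA' mul1mx.
apply/(in_geod _ _ PT Pu); split; rewrite ?dot_orthogonal ?trmxK//.
rewrite -[LHS]mul1mx -AA -!mulmxA.
have -> : A *m (P *m (A^T *m x)) = x - c *: (A *m u) by rewrite -Px !mulmxA.
by rewrite mulmxBr -scalemxAr mulmxA AA mul1mx.
Qed.

Lemma hrot_hv i (r : R) x c : (0 < i <= n)%N ->
  hrot n i r *m hv x c = hv (x + (dot (e i) x * (cosh r - 1) + c * sinh r) *: e i)
                        (dot (e i) x * sinh r + c * cosh r).
Proof.
move=> /andP[i0 iN]; have ine : (i == n.+1) = false by apply/negbTE; lia.
(* The identity plus terms supported on the plane of e_i and e_(n+1). *)
have E : hrot n i r = 1%:M + ((cosh r - 1) *: (e i *m (e i)^T)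
    + (cosh r - 1) *: (e n.+1 *m (e n.+1)^T) + sinh r *: (e i *m (e n.+1)^T)
    + sinh r *: (e n.+1 *m (e i)^T)).
  apply/matrixP => a b; rewrite !mxE !big_ord1 !mxE.
  have [bi|bi] := eqVneq b.+1 i.
    rewrite -{1}val_eqE/= -eqSS bi ine !mxE.
    by rewrite /=; ring.
  have [bn|bn] := eqVneq b.+1 n.+1.
    rewrite -{1}val_eqE/= -eqSS bn !mxE /=; ring.
  by rewrite -{1}val_eqE/= -eqSS !mxE /=; ring.
have ei : (e i : 'cV[R]_(n + 1)) = hv (e i : 'cV[R]_n) 0.
  apply/matrixP => l j; rewrite ord1 !mxE; case: fintype.splitP => l' E'; rewrite !mxE E' ?mulr0n//.
  by rewrite !ord1 addn0 [in LHS]eq_sym ine.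
rewrite E !mulmxDl mul1mx -!scalemxAl !mul_col_dot e_last ei !dot_hv !hvZ !hvD dot0l.
congr hv; last by ring.
by rewrite !scaler0 !mul0r !add0r !addr0 mul1r scalerDl !scalerA
  (mulrC _ (cosh r - 1)) (mulrC c).
Qed.

(** For y orthogonal to e_i the map sends (y, 1) to (y + sinh r e_i, cosh r), and division by the
    last coordinate gives the new foot point; the direction, orthogonal to e_i, does not change. *)
Lemma hrot_geod i (r : R) P y : (0 < i <= n)%N -> P^T = P -> P *m y = 0 ->
  P *m e i = 0 -> dot (e i) y = 0 ->
  mulmx (hrot n i r) @` geod (Pm P y) =
  geod (Pm P ((cosh r)^-1 *: y + tanh r *: e i)).
Proof.
move=> hi PT Py Pe ey; have C0 := cosh_neq0 r.
set u := (X in _ = geod (Pm P X)).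
have Pu : P *m u = 0 by rewrite mulmxDr -!scalemxAr Py Pe !scaler0 addr0.
have Pdot x : dot (e i) (P *m x) = 0 by rewrite dotC dot_mulmxl PT Pe dotC dot0l.
have ee := dot_e R hi.
apply/seteqP; split => [_ [z zG <-]|z].
  elim/hv_ind: z zG => x c /(in_geod _ _ PT Py)[E c0 Px]; rewrite hrot_hv//.
  have xe : dot (e i) x = 0.
    by have := Pdot x; rewrite Px dotBr dotZr ey mulr0 subr0.
  rewrite xe !mul0r !add0r.
  apply/(in_geod _ _ PT Pu); split.
  - rewrite dotDl !dotDr !dotZl !dotZr (dotC x) xe ee exprMn E cosh2.
    by move: E; move: (dot x x) => d E; rewrite !mulr0 !mulr1 !addr0 add0r; nra.
  - by rewrite mulr_gt0 ?cosh_gt0.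
  - rewrite mulmxDr -scalemxAr Pe scaler0 addr0 Px /u scalerDr !scalerA mulfK//.
    rewrite /tanh mulrA mulrAC mulfK// opprD addrACA -[LHS]addr0; congr (_ + _).
    by rewrite subrr.
elim/hv_ind: z => x c /(in_geod _ _ PT Pu)[E c0 Px].
have xe : dot (e i) x = c * tanh r.
  have := Pdot x; rewrite Px dotBr dotZr /u dotDr !dotZr ey ee mulr0 add0r mulr1 => /eqP.
  by rewrite subr_eq0 => /eqP.
exists (hv (x - (c * tanh r) *: e i) (c / cosh r)); last first.
  rewrite hrot_hv// dotBr dotZr xe ee mulr1 subrr !mul0r !add0r divfK//; congr hv.
  by rewrite -mulrA (mulrC _^-1) -/(tanh r) subrK.
apply/(in_geod _ _ PT Py); split.
- rewrite dotBl !dotBr !dotZl !dotZr (dotC x) xe ee.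
  have <- : c ^+ 2 * (1 - tanh r ^+ 2) = (c / cosh r) ^+ 2 by rewrite tanh2; field.
  have -> : dot x x = c ^+ 2 - 1 by rewrite E addrC addKr.
  by ring.
- by rewrite divr_gt0 ?cosh_gt0.
- rewrite mulmxBr -scalemxAr Pe scaler0 subr0 Px /u scalerDr !scalerA opprD addrA.
  by rewrite addrAC.
Qed.

Lemma Hsub_geod d : (d <= n)%N -> Hsub n d = geod (Pm (pE R n d) 0).
Proof.
move=> dn; rewrite /Hsub /geod; congr (_ `&` _).
have E : <<[seq e i | i <- iota (n - d).+1 d.+1]>>%VS = coord_space (n + 1) d.+1 :> {vspace 'cV[R]__}.
  by rewrite /coord_space addn1 subSS.
have En : (n + 1 - d.+1 = n - d)%N by rewrite addn1 subSS.
have PT : (pE R n d)^T = pE R n d by exact: pE_tr.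
have P0 : pE R n d *m 0 = 0 :> 'cV_n by rewrite mulmx0.
apply/seteqP; split => z /=; rewrite E mem_coord_space; elim/hv_ind: z => x c.
- move=> /eqP Ez; apply/fix_Pm => //; rewrite scaler0 subr0.
  apply/matrixP => i j; rewrite ord1 pE_mul.
  have := congr1 (fun z : 'cV_(n + 1) => z (lshift 1 i) 0) Ez.
  by rewrite /= pE_mul !col_mxEu En.
- move=> /(fix_Pm _ _ PT P0); rewrite scaler0 subr0 => Ex; apply/eqP/matrixP => i j.
  rewrite ord1 pE_mul En -(splitK i); case: (fintype.split i) => l /=.
    by rewrite col_mxEu -[in RHS]Ex pE_mul.
  by rewrite !col_mxEd !ord1 /= addn0 leq_subr mul1r.
Qed.

(* The geodesic pi(A(R^d + x)). *)
Definition Ge d A x := geod (Pm (A *m pE R n d *m A^T) (A *m x)).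

Lemma gpair_frame d A x : (d <= n)%N -> A^T *m A = 1%:M -> pE R n d *m x = 0 -> dot x x < 1 ->
  gpair d (A *m pE R n d *m A^T) (A *m x).
Proof.
move=> dn AA Ex x1; split; last by rewrite dot_orthogonal.
  split.
  - by rewrite !trmx_mul trmxK pE_tr mulmxA.
  - by rewrite !mulmxA -(mulmxA (A *m _)) AA mulmx1 -(mulmxA A) pE_idem.
  - by rewrite -mulmxA mxtrace_mulC -mulmxA AA mulmx1 tr_pE.
by rewrite mulmxA -(mulmxA _ _ A) AA mulmx1 -mulmxA Ex mulmx0.
Qed.

Lemma image_mulmx (A B : 'M[R]_(n + 1)) (t : set 'cV[R]_(n + 1)) :
  mulmx (A *m B) @` t = mulmx A @` (mulmx B @` t).
Proof.
by rewrite image_comp; congr (_ @` _); apply/funext => z /=; rewrite mulmxA.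
Qed.

Lemma pE_e0 d i : (i <= n - d)%N -> pE R n d *m e i = 0.
Proof. by move=> h; rewrite pE_e ltnNge h scale0r. Qed.

Lemma hrot_Hsub d A (r : R) : (d < n)%N -> A^T *m A = 1%:M ->
  mulmx (lift_rot A *m hrot n (n - d) r) @` Hsub n d = Ge d A (tanh r *: e (n - d)).
Proof.
move=> dn AA; have hi : (0 < n - d <= n)%N by rewrite subn_gt0 dn leq_subr.
have h0 : pE R n d *m e (n - d) = 0 by rewrite pE_e0.
rewrite image_mulmx Hsub_geod ?(ltnW dn)// hrot_geod ?pE_tr ?mulmx0 ?dot0r//.
rewrite scaler0 add0r lift_rot_geod ?pE_tr//.
by rewrite -scalemxAr h0 scaler0.
Qed.

(** [hrot_geod] is applied twice. The rotation by s creates the component tanh s along e_(n-j); B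
    moves it but fixes e_(n-k); the rotation by r then divides it by cosh r and adds tanh r
    e_(n-k). *)
Lemma RH_plane j k A B (r s : R) : (j < k)%N -> (k < n)%N -> A^T *m A = 1%:M ->
  B^T *m B = 1%:M -> B *m e (n - k) = e (n - k) ->
  mulmx (lift_rot A *m hrot n (n - k) r *m lift_rot B *m hrot n (n - j) s) @` Hsub n j =
  Ge j (A *m B) (tanh r *: e (n - k) + (tanh s / cosh r) *: e (n - j)).
Proof.
move=> jk kn AA BB Be; have jn := ltn_trans jk kn.
have hk : (0 < n - k <= n)%N by rewrite subn_gt0 kn leq_subr.
have Bte : B^T *m e (n - k) = e (n - k) by rewrite -[in LHS]Be mulmxA BB mul1mx.
have Ek : pE R n j *m e (n - k) = 0 by rewrite pE_e0// leq_sub2l// ltnW.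
have Ej : pE R n j *m e (n - j) = 0 by rewrite pE_e0.
have kj : dot (e (n - k) : 'cV[R]_n) (e (n - j)) = 0 by apply: dot_e_neq; apply/eqP; lia.
rewrite -mulmxA image_mulmx hrot_Hsub// image_mulmx.
have PT : (B *m pE R n j *m B^T)^T = B *m pE R n j *m B^T.
  by rewrite !trmx_mul trmxK pE_tr mulmxA.
have Py : B *m pE R n j *m B^T *m (B *m (tanh s *: e (n - j))) = 0.
  by rewrite mulmxA -(mulmxA _ _ B) BB mulmx1 -mulmxA -scalemxAr Ej scaler0 mulmx0.
have Pe : B *m pE R n j *m B^T *m e (n - k) = 0 by rewrite -!mulmxA Bte Ek mulmx0.
have ey : dot (e (n - k)) (B *m (tanh s *: e (n - j))) = 0.
  by rewrite dotC dot_mulmxl Bte dotZl dotC kj mulr0.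
have Pu Y : B *m pE R n j *m B^T *m Y = 0 ->
    B *m pE R n j *m B^T *m ((cosh r)^-1 *: Y + tanh r *: e (n - k)) = 0.
  by move=> PY; rewrite mulmxDr -!scalemxAr PY Pe !scaler0 addr0.
rewrite {1}/Ge (hrot_geod r hk PT Py Pe ey) (lift_rot_geod AA PT (Pu _ Py)).
rewrite /Ge trmx_mul !mulmxA; congr (geod (Pm _ _)).
rewrite !mulmxDr -!scalemxAr -!mulmxA Be addrC; congr (_ + _).
by rewrite scalerA mulrC.
Qed.

End Actions.

(** * Rotations of a block of coordinates *)

Section Embedding.
Context (R : realType) (n k : nat) (s : nat).
Hypothesis skn : (s + k <= n)%N.
Implicit Types (A B : 'M[R]_k) (x : 'cV[R]_k).

Definition sel : 'M[R]_(n, k) := \matrix_(i, j) (i == s + j :> nat)%:R.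

(* A acting on coordinates s + 1, ..., s + k. *)
Definition emb A : 'M[R]_n := 1%:M + sel *m (A - 1%:M) *m sel^T.

Lemma sel_mul m (X : 'M[R]_(k, m)) (i : 'I_n) (j : 'I_k) l : i = s + j :> nat ->
  (sel *m X) i l = X j l.
Proof.
move=> ij; rewrite mxE (bigD1 j)//= big1 ?addr0; first by rewrite mxE ij eqxx mul1r.
move=> a aj; rewrite mxE ij eqn_add2l; case: eqP => [/val_inj E|]; last by rewrite mul0r.
by rewrite E eqxx in aj.
Qed.

Lemma sel_mul0 m (X : 'M[R]_(k, m)) (i : 'I_n) l : ~~ (s <= i < s + k)%N -> (sel *m X) i l = 0.
Proof.
move=> h; rewrite mxE big1// => a _; rewrite mxE; case: eqP => E; last by rewrite mul0r.
clear skn; by have := ltn_ord a; lia.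
Qed.

Lemma mul_sel m (X : 'M[R]_(m, k)) l (i : 'I_n) (j : 'I_k) : i = s + j :> nat ->
  (X *m sel^T) l i = X l j.
Proof.
move=> ij; have -> : X *m sel^T = (sel *m X^T)^T by rewrite trmx_mul trmxK.
by rewrite mxE (sel_mul _ _ ij) mxE.
Qed.

Lemma mul_sel0 m (X : 'M[R]_(m, k)) l (i : 'I_n) : ~~ (s <= i < s + k)%N -> (X *m sel^T) l i = 0.
Proof. by move=> h; rewrite -[X]trmxK -trmx_mul mxE sel_mul0. Qed.

Lemma tr_sel_sel : sel^T *m sel = 1%:M.
Proof.
apply/matrixP => i j; have hi : (s + i < n)%N by have := ltn_ord i; lia.
rewrite !mxE (bigD1 (Ordinal hi))//= big1 ?addr0.
  by rewrite !mxE /= eqxx mul1r eqn_add2l.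
by move=> a; rewrite -val_eqE/= => /negPf ai; rewrite !mxE ai mul0r.
Qed.

Lemma sel_e i : (0 < i <= k)%N -> sel *m e i = e (s + i).
Proof.
move=> hi; apply/matrixP => a b.
have [h|h] := boolP (s <= a < s + k)%N; last first.
  by rewrite sel_mul0// mxE; case: eqP => // E; lia.
have hj : (a - s < k)%N by lia.
rewrite (@sel_mul _ _ _ (Ordinal hj)) /=; last by lia.
by rewrite !mxE/=; congr (nat_of_bool _)%:R; apply/eqP/eqP; lia.
Qed.

Lemma sel_tr : sel *m sel^T = \matrix_(i, j) ((i == j) && (s <= i < s + k)%N)%:R.
Proof.
apply/matrixP => a b; rewrite [RHS]mxE.
have [h|h] := boolP (s <= a < s + k)%N; last by rewrite sel_mul0// andbF.
have hj : (a - s < k)%N by lia.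
rewrite (@sel_mul _ _ _ (Ordinal hj)) /=; last by lia.
rewrite !mxE/= andbT -val_eqE/=; congr (nat_of_bool _)%:R; apply/eqP/eqP; lia.
Qed.

Lemma emb_sel A : emb A *m sel = sel *m A.
Proof.
by rewrite mulmxDl mul1mx -!mulmxA tr_sel_sel mulmx1 mulmxBr mulmx1 addrC subrK.
Qed.

Lemma emb_mul A B : emb A *m emb B = emb (A *m B).
Proof.
rewrite [emb B]/emb mulmxDr mulmx1 !mulmxA emb_sel -addrA; congr (_ + _).
rewrite -mulmxDl -(mulmxA sel) -mulmxDr; congr (_ *m _ *m _).
by rewrite mulmxBr mulmx1 addrC addrA subrK.
Qed.

Lemma emb_tr A : (emb A)^T = emb A^T.
Proof. by rewrite /emb linearD/= trmx1 !trmx_mul trmxK linearB/= trmx1 mulmxA. Qed.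

Lemma emb1 : emb 1%:M = 1%:M.
Proof. by rewrite /emb subrr mulmx0 mul0mx addr0. Qed.

Lemma emb_orthogonal A : A^T *m A = 1%:M -> (emb A)^T *m emb A = 1%:M.
Proof. by move=> AA; rewrite emb_tr emb_mul AA emb1. Qed.

Lemma emb_fix m A (X : 'M[R]_(n, m)) : sel^T *m X = 0 -> emb A *m X = X.
Proof. by move=> h; rewrite mulmxDl mul1mx -mulmxA h mulmx0 addr0. Qed.

(** Sylvester's identity: L M and M L are block triangular and have the two sides as determinants.
    It yields the determinants of [emb A] and of reflections. *)
Lemma det_sylvester p q (U : 'M[R]_(p, q)) (V : 'M[R]_(q, p)) :
  \det (1%:M + U *m V) = \det (1%:M + V *m U).
Proof.
pose M : 'M[R]_(q + p) := block_mx 1%:M (- V) U 1%:M.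
pose L : 'M[R]_(q + p) := block_mx 1%:M 0 (- U) 1%:M.
have E1 : \det (L *m M) = \det (1%:M + U *m V).
  rewrite mulmx_block !mul1mx !mul0mx !addr0 !mulmx1 mulNmx mulmxN opprK addNr.
  by rewrite det_ublock det1 mul1r addrC.
have E2 : \det (M *m L) = \det (1%:M + V *m U).
  rewrite mulmx_block !mulmx1 !mulmx0 !add0r mulmxN mulNmx opprK mul1mx subrr.
  by rewrite det_ublock det1 mulr1.
by rewrite -E1 -E2 !det_mulmx mulrC.
Qed.

Lemma det_emb A : \det (emb A) = \det A.
Proof.
rewrite /emb -mulmxA det_sylvester -mulmxA tr_sel_sel mulmx1.
by rewrite addrC subrK.
Qed.

Lemma emb_rotations A : n <> 1%N -> rotations k A -> k <> 1%N -> rotations n (emb A).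
Proof.
move=> n1 [oA dA] k1; split; first exact: emb_orthogonal.
by move=> _; rewrite det_emb dA.
Qed.

Lemma emb_hh i : (0 < i <= k)%N -> emb (hh (e i)) = hh (e (s + i)).
Proof.
move=> hi; have hi' : (0 < s + i <= n)%N by lia.
rewrite /emb /hh !dot_e// addrAC subrr add0r mulmxN mulNmx -scalemxAr -scalemxAl.
by rewrite mulmxA sel_e// -mulmxA -trmx_mul sel_e.
Qed.

End Embedding.

Lemma det_hh (R : realType) n (w : 'cV[R]_n) : w != 0 -> \det (hh w) = -1.
Proof.
move=> w0; have ww : dot w w != 0 by rewrite dot_eq0.
rewrite /hh scalemxAl -mulNmx det_sylvester mulmxN -scalemxAr tr_mul_dot.
by rewrite scale_scalar_mx divfK// -raddfN -raddfD/= det_scalar1; ring.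
Qed.

Lemma det_orthogonal (R : realType) n (A : 'M[R]_n) : A^T *m A = 1%:M ->
  \det A = 1 \/ \det A = -1.
Proof.
move=> /(congr1 determinant); rewrite det_mulmx det_tr det1 => /eqP.
rewrite -expr2 sqrf_eq1 => /orP[] /eqP ->; by [left|right].
Qed.

Lemma hh_e (R : realType) n i l : (0 < i <= n)%N -> i != l -> hh (e i) *m e l = e l :> 'cV[R]_n.
Proof.
by move=> hi il; rewrite hhE dot_e_neq// mulr0 mul0r scale0r subr0.
Qed.

Lemma hh_e_pE (R : realType) n i d : (0 < i <= n)%N ->
  hh (e i) *m pE R n d = pE R n d *m hh (e i).
Proof.
move=> hi; rewrite /hh mulmxBl mulmxBr mul1mx mulmx1 -scalemxAl -scalemxAr; congr (_ - _ *: _).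
rewrite -mulmxA -(pE_tr R n d) -trmx_mul mulmxA pE_tr pE_e linearZ/=.
by rewrite -scalemxAl -scalemxAr.
Qed.

Lemma e_neq0 (R : realType) n i : (0 < i <= n)%N -> e i != 0 :> 'cV[R]_n.
Proof. by move=> hi; rewrite -dot_eq0 dot_e// oner_eq0. Qed.

(** Replaces the cast in [sub_rot] by [emb], which acts on a block of coordinates without changing
    the type of matrices. *)
Lemma sub_rot_emb (R : realType) n k (A : 'M[R]_k) : (k <= n)%N ->
  sub_rot n A = emb n (n - k) A.
Proof.
move=> kn; have En : (n - k + k = n)%N by rewrite subnK.
have H m (E : m = n) (B : 'M[R]_m) i j :
    conform_mx (1%:M : 'M[R]_n) B i j = B (cast_ord (esym E) i) (cast_ord (esym E) j).
  by subst m; rewrite conform_mx_id !cast_ord_id.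
apply/matrixP => a b; rewrite /sub_rot (H _ En) [RHS]mxE.
rewrite -(splitK (cast_ord (esym En) a)) -(splitK (cast_ord (esym En) b)).
case: fintype.splitP => a' /= Ea; case: fintype.splitP => b' /= Eb.
- rewrite block_mxEul -mulmxA sel_mul0; last by have := ltn_ord a'; lia.
  by rewrite addr0 !mxE -!val_eqE/= Ea Eb.
- rewrite block_mxEur -mulmxA sel_mul0; last by have := ltn_ord a'; lia.
  rewrite addr0 !mxE -!val_eqE/= Ea Eb; case: eqP => // E; by have := ltn_ord a'; lia.
- rewrite block_mxEdl mul_sel0; last by have := ltn_ord b'; lia.
  rewrite addr0 !mxE -!val_eqE/= Ea Eb; case: eqP => // E; by have := ltn_ord b'; lia.
- rewrite block_mxEdr -mulmxA (sel_mul _ _ Ea) (mul_sel _ _ Eb) !mxE -!val_eqE/= Ea Eb.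
  by rewrite eqn_add2l addrC subrK.
Qed.

(** * Weighted integrals over the half-line *)

Section WeightedIntegral.
Context (R : realType).
Local Notation mu := (@lebesgue_measure R).
Local Open Scope ereal_scope.

Definition wint (w : R -> R) (h : R -> \bar R) :=
  \int[mu]_(s in `]0%R, +oo[) ((w s)%:E * h s).

Lemma eq_wint w w' (h h' : R -> \bar R) :
  (forall s, (0 < s)%R -> (w s)%:E * h s = (w' s)%:E * h' s) -> wint w h = wint w' h'.
Proof.
by move=> E; apply: eq_integral => s; rewrite inE/= in_itv/= andbT => /E.
Qed.

Variable w : R -> R.
Hypothesis mw : measurable_fun setT w.
Hypothesis w0 : forall s, (0 < s)%R -> (0 <= w s)%R.

(** The sign of [w] is known only on ]0, +oo[; with the indicator it becomes a nonnegative weight on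
    the whole line, where Tonelli's theorem applies. *)
Let wp s : R := ((0 < s)%R%:R * w s)%R.

Let wp0 s : (0 <= wp s)%R.
Proof. by rewrite /wp; case: ltP => [/w0|_]; rewrite ?mul0r ?mul1r. Qed.

Let mwp : measurable_fun setT wp.
Proof. by apply: measurable_funM => //; exact: measurable_pos. Qed.

Let wintE h : wint w h = \int[mu]_s ((wp s)%:E * h s).
Proof. exact: ge0_integral_pos. Qed.

Lemma wint_ge0 h : (forall s, 0 <= h s) -> 0 <= wint w h.
Proof. by move=> h0; rewrite wintE; apply: integral_ge0 => s _; rewrite mule_ge0// lee_fin. Qed.

Lemma wintZ (c : \bar R) h : 0 <= c -> measurable_fun setT h -> (forall s, 0 <= h s) ->
  wint w (fun s => c * h s) = c * wint w h.
Proof.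
move=> c0 mh h0; rewrite !wintE -ge0_integralZl//.
- by apply: eq_integral => s _; rewrite muleCA.
- by apply: emeasurable_funM => //; exact/measurable_EFinP.
- by move=> s _; rewrite mule_ge0// lee_fin.
Qed.

Section WithParameter.
Context d (Z : measurableType d) (h : Z * measurableTypeR R -> \bar R).
Hypothesis mh : measurable_fun setT h.
Hypothesis h0 : forall x, 0 <= h x.

Let H (p : Z * measurableTypeR R) := (wp p.2)%:E * h p.
Let mH : measurable_fun setT H.
Proof.
apply: emeasurable_funM => //; apply/measurable_EFinP.
exact: (@measurableT_comp _ _ _ _ (measurableTypeR R) _ wp _ _ mwp measurable_snd).
Qed.
Let H0 p : 0 <= H p. Proof. by rewrite mule_ge0// lee_fin. Qed.

Lemma measurable_wint : measurable_fun setT (fun z => wint w (fun s => h (z, s))).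
Proof.
have := @measurable_fun_fubini_tonelli_F _ _ _ (measurableTypeR R) R mu H mH H0.
by congr measurable_fun; apply/funext => z; rewrite wintE.
Qed.

Lemma wint_integral (nu : {sigma_finite_measure set Z -> \bar R}) :
  \int[nu]_z wint w (fun s => h (z, s)) = wint w (fun s => \int[nu]_z h (z, s)).
Proof.
transitivity (\int[nu]_z \int[mu]_s H (z, s)).
  by apply: eq_integral => z _; rewrite wintE.
rewrite (@fubini_tonelli _ _ _ (measurableTypeR R) R nu mu H mH H0) wintE.
apply: eq_integral => s _; transitivity (\int[nu]_z ((wp s)%:E * h (z, s))) => //.
rewrite ge0_integralZl ?lee_fin//.
by apply: (measurableT_comp mh); exact: measurable_fun_pair.
Qed.

End WithParameter.
End WeightedIntegral.

(** * Functions of geodesics as functions of projections *)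

Section DoobDynkin.
Context (R : realType) (n d : nat).
Local Notation Gm := (GammaH n d : set (borel_geod R n d)).
Local Notation M1 := (bmx R (n + 1) (n + 1)).

Definition gmx (t : set 'cV[R]_(n + 1)) : 'M[R]_(n + 1) := projmx (linspan t).

Lemma measurable_GammaH : measurable Gm.
Proof.
apply: sub_sigma_algebra; exists setT; first exact: openT.
by apply/seteqP; split => t //= [].
Qed.

Lemma measurable_gmx : measurable_fun Gm (gmx : borel_geod R n d -> M1).
Proof.
apply: (@measurability _ _ _ M1 _ _ (@open 'M[R]_(n + 1)) erefl) => _ [U oU <-].
by apply: sub_sigma_algebra; exists U.
Qed.

(** The sets with this property form a sigma-algebra containing the generators. *)
Lemma measurable_geodP (S : set (borel_geod R n d)) : measurable S ->
  exists2 B : set M1, measurable B & Gm `&` S = Gm `&` gmx @^-1` B.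
Proof.
move=> mS; pose C := [set S : set (borel_geod R n d) |
  exists2 B : set M1, measurable B & Gm `&` S = Gm `&` gmx @^-1` B].
suff : C S by [].
apply: mS; split; first split.
- by exists set0 => //; rewrite preimage_set0.
- move=> A [B mB AB]; exists (~` B); first exact: measurableC.
  rewrite setTD preimage_setC; apply/seteqP; split => t [tG /= h]; split => // tB.
    by apply: h; have [] : (Gm `&` A) t by rewrite AB.
  by apply: h; have [] : (Gm `&` gmx @^-1` B) t by rewrite -AB.
- move=> A AC; have {}AC i : {B : set M1 | measurable B & Gm `&` A i = Gm `&` gmx @^-1` B}.
    by apply/cid2; exact: AC.
  exists (\bigcup_i s2val (AC i)).
    by apply: bigcup_measurable => i _; exact: s2valP.
  rewrite preimage_bigcup !setI_bigcupr; apply: eq_bigcupr => i _; exact: (s2valP' (AC i)).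
- move=> _ [U oU <-]; exists U; first exact: sub_sigma_algebra.
  by rewrite setIA setIid.
Qed.

Local Open Scope ereal_scope.

(** Enumerates the nonnegative rationals; an index that codes no rational gives 0. *)
Let qn (i : nat) : R := ratr (if (unpickle i : option rat) is Some q then `|q|%R else 0%R).

Let qn_ge0 i : (0 <= qn i)%R.
Proof. by rewrite /qn; case: unpickle => [q|]; rewrite ?ler0q ?normr_ge0. Qed.

Let qn_surj (q : rat) : (0 <= q)%R -> exists i, qn i = ratr q.
Proof. by move=> q0; exists (pickle q); rewrite /qn pickleK ger0_norm. Qed.

(** On GammaH a nonnegative f is the supremum over rationals q >= 0 of q times the indicator of {f
    >= q}, and each of these sets is there the preimage under [gmx] of a measurable set of matrices.
    The same supremum, taken on matrices, is the required function. *)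
Lemma doob_dynkin (f : borel_geod R n d -> \bar R) : measurable_fun Gm f ->
  (forall t, 0 <= f t) ->
  exists f0 : M1 -> \bar R, [/\ measurable_fun setT f0, forall M, 0 <= f0 M &
    forall t, Gm t -> f t = f0 (gmx t)].
Proof.
move=> mf f0.
have hB i : {B : set M1 | measurable B & Gm `&` [set t | (qn i)%:E <= f t] = Gm `&` gmx @^-1` B}.
  apply/cid2; have := mf measurable_GammaH _ (emeasurable_itv `[(qn i)%:E, +oo[).
  move=> /measurable_geodP[B mB E]; exists B => //; rewrite -E setIA setIid.
  by apply/seteqP; split => t [tG /=]; rewrite in_itv/= andbT.
pose B i := s2val (hB i); have mB i : measurable (B i) by exact: s2valP.
have BE i t : Gm t -> B i (gmx t) <-> (qn i)%:E <= f t.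
  move=> tG; have E : Gm `&` [set t | (qn i)%:E <= f t] = Gm `&` gmx @^-1` B i by exact: (s2valP' (hB i)).
  split => [h|h]; first by have [] : (Gm `&` [set t | (qn i)%:E <= f t]) t by rewrite E.
  by have [] : (Gm `&` gmx @^-1` B i) t by rewrite -E.
pose u i (M : M1) : \bar R := (qn i * \1_(B i) M)%:E.
have u0 i M : 0 <= u i M by rewrite lee_fin mulr_ge0.
exists (fun M => esups (u ^~ M) 0%N); split.
- apply: measurable_fun_esups => i; apply/measurable_EFinP.
  by apply: measurable_funM => //; exact: measurable_indic.
- by move=> M; apply: ereal_sup_ge; exists (u 0%N M) => //; exists 0%N.
move=> t tG; apply/eqP; rewrite eq_le; apply/andP; split; last first.
  apply: ge_ereal_sup => _ [i _ <-]; rewrite /u indicE; case: (boolP (gmx t \in B i)).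
    by rewrite inE mulr1 => /(BE i t tG).
  by rewrite mulr0.
rewrite leNgt; apply/negP => lt.
have s0 : 0 <= esups (u ^~ (gmx t)) 0%N.
  by apply: ereal_sup_ge; exists (u 0%N (gmx t)) => //; exists 0%N.
move: lt s0; case E : (esups _ _) => [s| |]; [move=> lt s0|by rewrite ltNge leey|by []].
(* A rational strictly above the supremum s and still at most f t, which may be +oo, contradicts the
   definition of s. *)
have [q sq qf] : exists2 q : rat, (s < ratr q)%R & (ratr q)%:E <= f t.
  move: lt; case: (f t) => [y| |]; [|move=> _|by []].
    rewrite lte_fin => /rat_in_itvoo[q]; rewrite in_itv/= => /andP[sq qy].
    by exists q => //; rewrite lee_fin ltW.
  have s1 : (s < s + 1)%R by rewrite ltrDl.
  have [q] := rat_in_itvoo s1; rewrite in_itv/= => /andP[sq _].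
  by exists q; rewrite ?leey.
have q0 : (0 <= q)%R.
  by rewrite -(ler0q R) (le_trans _ (ltW sq))// -lee_fin.
have [i qi] := qn_surj q0.
suff : (ratr q)%:E <= esups (u ^~ (gmx t)) 0%N by rewrite E lee_fin leNgt sq.
apply: ereal_sup_ge; exists (u i (gmx t)); first by exists i.
have Bi : B i (gmx t) by apply/(BE _ _ tG); rewrite qi.
by rewrite /u indicE mem_set// mulr1 qi.
Qed.

Lemma measurable_comp_gmx (f0 : M1 -> \bar R) (f : borel_geod R n d -> \bar R) :
  measurable_fun setT f0 -> (forall t, Gm t -> f t = f0 (gmx t)) -> measurable_fun Gm f.
Proof.
move=> mf0 E; have h : measurable_fun Gm (f0 \o gmx : borel_geod R n d -> \bar R).
  exact: (measurable_comp measurableT (@subsetT _ _) mf0 measurable_gmx).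
by apply: eq_measurable_fun h => t; rewrite inE => /E.
Qed.

End DoobDynkin.

Lemma sigma_gt0 (R : realType) l : 0 < sigma l :> R.
Proof.
have := rint_gauss_gt0 R l; rewrite rint_gauss_Gamma lte_fin => G0.
have G1 : 0 < Gamma (l.+1%:R / 2 : R) by move: G0; rewrite pmulr_lgt0.
by rewrite divr_gt0// mulr_gt0// powR_gt0// pi_gt0.
Qed.

Lemma sigma_ge0 (R : realType) l : 0 <= sigma l :> R.
Proof. exact/ltW/sigma_gt0. Qed.

(** * Absorbing orthogonal matrices of determinant -1 *)

Section HaarOrthogonal.
Context (R : realType) (m : nat) (mu : probability (bmx R m m) R).
Hypothesis muP : is_haar (rotations m) mu.
Local Open Scope ereal_scope.

(** If det B = -1 then B = C D with C a rotation, and h(B b) = h(C (D b D^T)) by the symmetry under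
    D; conjugation by D and multiplication by C preserve the measure. For m = 1 the group is O(1),
    which contains B. *)
Lemma haar_mull_orthogonal (B : 'M[R]_m) (h : bmx R m m -> \bar R) : (B^T *m B = 1%:M)%R ->
  measurable_fun setT h -> (forall x, 0 <= h x) ->
  (m <> 1%N -> exists D : 'M[R]_m,
    [/\ D^T *m D = 1%:M, \det D = -1 & forall b, h (b *m D) = h b]%R) ->
  \int[mu]_b h (B *m b)%R = \int[mu]_b h b.
Proof.
move=> oB mh h0 hD; have [m1|/eqP m1] := eqVneq m 1%N.
  by apply: (haar_mull muP) => //; split => // /(_ m1).
have [dB|dB] := det_orthogonal oB; first by apply: (haar_mull muP) => //; split.
have [D [oD dD hDE]] := hD m1.
pose C := (B *m D^T)%R.
have oC : rotations m C.
  split; last by move=> _; rewrite /C det_mulmx det_tr dB dD; ring.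
  by rewrite /orthogonal_group/= trmx_mul trmxK mulmxA -(mulmxA _ B^T) oB mulmx1 ortho_tr.
have mhC : measurable_fun setT (fun b : bmx R m m => h (C *m b)%R).
  apply: (measurableT_comp mh); apply: mmx_measurable.
  by apply: mmxM; [exact: mmx_cst|exact: mmx_id].
rewrite -(haar_mull muP oC mh h0) -(haar_conj muP oD mhC); last by move=> x; exact: h0.
apply: eq_integral => b _; rewrite -[RHS]hDE; congr h.
by rewrite /C !mulmxA -(mulmxA _ D^T D)%R oD mulmx1 -(mulmxA _ D^T D)%R oD mulmx1.
Qed.

End HaarOrthogonal.

(** * Independence of the choice of frames *)

Section Frames2.
Context (R : realType).
Implicit Types n d k : nat.

Lemma to_rotation n (A D : 'M[R]_n) : A^T *m A = 1%:M -> D^T *m D = 1%:M -> \det D = -1 ->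
  exists2 C, rotations n C & C = A \/ C = A *m D.
Proof.
move=> oA oD dD; have [dA|dA] := det_orthogonal oA; first by exists A; [split|left].
exists (A *m D); [split|by right]; last by move=> _; rewrite det_mulmx dA dD; ring.
by rewrite /orthogonal_group/= trmx_mul mulmxA -(mulmxA _ A^T) oA mulmx1.
Qed.

Lemma hh_e_conj n i d : (0 < i <= n)%N ->
  hh (e i) *m pE R n d *m (hh (e i))^T = pE R n d.
Proof. by move=> hi; rewrite hh_e_pE// -mulmxA hh_tr -{1}hh_tr hh_orthogonal mulmx1. Qed.

(** The matrix A, corrected by the reflection in e_n if det A = -1, meets the conditions defining
    [frame]: this reflection preserves R^k and fixes e_(n-k), since k > 0. The factor a in the last
    equality covers a = 0, where [frame] does not constrain the image of e_(n-k). *)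
Lemma frameP n k (A : 'M[R]_n) (a : R) : (1 < n)%N -> (0 < k < n)%N -> A^T *m A = 1%:M ->
  0 <= a ->
  let c := frame k (vimg (A *m pE R n k *m A^T), A *m (a *: e (n - k))) in
  [/\ rotations n c, c *m pE R n k *m c^T = A *m pE R n k *m A^T &
    a *: (c *m e (n - k)) = a *: (A *m e (n - k))].
Proof.
move=> n1 hk oA a0 c; set P := A *m pE R n k *m A^T in c *.
have hn : (0 < n <= n)%N by rewrite leqnn andbT; lia.
have sP : sproj P.
  split; first by rewrite !trmx_mul trmxK pE_tr mulmxA.
  by rewrite /P !mulmxA -(mulmxA (A *m _)) oA mulmx1 -(mulmxA A) pE_idem.
have hi : (0 < n - k <= n)%N by lia.
have eu : enorm (A *m (a *: e (n - k))) = a.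
  by rewrite enorm_orthogonal// /enorm dotZl dotZr dot_e// mulr1 -expr2 sqrtr_sqr ger0_norm.
have dD : \det (hh (e n : 'cV[R]_n)) = -1 by rewrite det_hh// e_neq0.
have [C rC CA] := to_rotation oA (hh_orthogonal (e n)) dD.
have [CP Ce] : C *m pE R n k *m C^T = P /\ C *m e (n - k) = A *m e (n - k).
  case: CA => ->; split => //.
    by rewrite trmx_mul /P -[in RHS](hh_e_conj k hn) !mulmxA.
  by rewrite -mulmxA hh_e//; apply/eqP; lia.
have [] := @xgetPex _ 1%:M [set c | rotations n c /\
    limage c (coord_space n k) = vimg P /\
    (A *m (a *: e (n - k)) <> 0 -> c *m e (n - k) =
      (enorm (A *m (a *: e (n - k))))^-1 *: (A *m (a *: e (n - k))))].
  exists C; split => //; split.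
    apply: (projects_on_inj (projects_on_frame k rC.1)); rewrite CP.
    exact: projects_on_vimg.
  rewrite eu -scalemxAr scalerA => u0; rewrite mulVf ?scale1r//.
  by apply/eqP => aE; apply: u0; rewrite aE scale0r.
rewrite -/(frame k (vimg P, A *m (a *: e (n - k)))) -/c => rc [cV ce]; split => //.
  have := projects_on_frame k rc.1; rewrite cV => /projmx_vspace <-.
  exact: projmx_vspace (projects_on_vimg sP).
have [->|an] := eqVneq a 0; first by rewrite !scale0r.
have u0 : A *m (a *: e (n - k)) <> 0.
  by move=> u0; move: eu; rewrite u0 enorm0 => /esym/eqP; rewrite (negPf an).
by rewrite (ce u0) eu -scalemxAr !scalerA mulfV ?mul1r.
Qed.

Lemma sel_last n k : (k <= n)%N -> sel R n k (n - k) *m (sel R n k (n - k))^T = pE R n k.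
Proof.
move=> kn; rewrite sel_tr ?subnK//; apply/matrixP => a b; rewrite !mxE.
by rewrite ltn_ord andbT.
Qed.

Lemma sel_first n j : (j <= n)%N ->
  sel R n (n - j) 0 *m (sel R n (n - j) 0)^T = 1%:M - pE R n j.
Proof.
move=> jn; rewrite sel_tr ?add0n ?leq_subr//; apply/matrixP => a b; rewrite !mxE/= ltnNge.
by case: (a == b); case: leqP => _; rewrite /= ?mulr1n ?mulr0n ?subr0 ?subrr.
Qed.

Lemma tr_sel_e n k s i : ~~ (s < i <= s + k)%N -> (sel R n k s)^T *m e i = 0.
Proof.
move=> h; apply/matrixP => a b; rewrite !mxE big1// => l _; rewrite !mxE.
case: eqP => [la|]; last by rewrite mul0r.
case: eqP => [li|]; last by rewrite mulr0.
by have := ltn_ord a; lia.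
Qed.

(* The value at the geodesic pi(A(R^d + x)) of the function f0 of projections. *)
Definition Fe n d (f0 : 'M[R]_(n + 1) -> \bar R) (A : 'M[R]_n) (x : 'cV[R]_n) : \bar R :=
  f0 (Pm (A *m pE R n d *m A^T) (A *m x)).

Lemma Fe_mulr n d f0 (A B : 'M[R]_n) x : B *m pE R n d *m B^T = pE R n d ->
  Fe d f0 (A *m B) x = Fe d f0 A (B *m x).
Proof. by move=> BE; rewrite /Fe trmx_mul -!mulmxA (mulmxA B) (mulmxA _ B^T) BE !mulmxA. Qed.

(** If p is the projection onto R^d, then A p A^T = (A p)(A p)^T, so A enters only through A p and A
    x. *)
Lemma Fe_ext n d f0 (A B : 'M[R]_n) x : A *m pE R n d = B *m pE R n d -> A *m x = B *m x ->
  Fe d f0 A x = Fe d f0 B x.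
Proof.
move=> E Ex; rewrite /Fe Ex; congr (f0 (Pm _ _)).
have E3 C : C *m pE R n d *m C^T = C *m pE R n d *m (C *m pE R n d)^T.
  by rewrite trmx_mul pE_tr -!mulmxA (mulmxA (pE R n d)) pE_idem.
by rewrite E3 E -E3.
Qed.

(** Two orthogonal matrices with the same image of R^k differ there by B = S^T A^T c S. *)
Lemma commutant_block n k (A c : 'M[R]_n) : (k <= n)%N -> A^T *m A = 1%:M -> c^T *m c = 1%:M ->
  c *m pE R n k *m c^T = A *m pE R n k *m A^T ->
  exists2 B : 'M[R]_k, B^T *m B = 1%:M &
    c *m sel R n k (n - k) = A *m sel R n k (n - k) *m B.
Proof.
move=> kn oA oc cE; set S := sel _ _ _ _.
have SS : S *m S^T = pE R n k by exact: sel_last.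
have StS : S^T *m S = 1%:M by apply: tr_sel_sel; rewrite subnK.
have pS : pE R n k *m S = S by rewrite -SS -mulmxA StS mulmx1.
have E : c *m S = A *m S *m (S^T *m A^T *m c *m S).
  by rewrite !mulmxA -(mulmxA A) SS -cE -(mulmxA _ _ c) oc mulmx1 -mulmxA pS.
move: (S^T *m A^T *m c *m S) E => B E; exists B => //.
have E1 (C : 'M[R]_n) : C^T *m C = 1%:M -> (C *m S)^T *m (C *m S) = 1%:M.
  by move=> oC; rewrite trmx_mul mulmxA -(mulmxA _ C^T) oC mulmx1.
by rewrite -[RHS](E1 c oc) E (trmx_mul _ B) !mulmxA -(mulmxA _ A S) -(mulmxA B^T) E1// mulmx1.
Qed.

Section Mmx.
Context dd (T : measurableType dd).

Lemma mmx_Pm n (P : T -> 'M[R]_n) (u : T -> 'cV[R]_n) : mmx P -> mmx u ->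
  mmx (fun t => Pm (P t) (u t)).
Proof.
move=> mP mu; have mh : mmx (fun t => hv (u t) 1).
  by apply: mmx_col_mx => //; exact: mmx_cst.
apply: mmxD.
  by apply: mmx_col_mx; apply: mmx_row_mx => //; exact: mmx_cst.
apply: mmxZ; last by apply: mmxM => //; exact: mmxT.
by apply: measurable_inv; apply: measurable_funD => //; exact: measurable_dot.
Qed.

Lemma mmx_emb n k s (F : T -> 'M[R]_k) : mmx F -> mmx (fun t => emb n s (F t)).
Proof.
move=> mF; apply: mmxD; first exact: mmx_cst.
apply: mmxM; last exact: mmx_cst.
by apply: mmxM; [exact: mmx_cst|apply: mmxB => //; exact: mmx_cst].
Qed.

Lemma measurable_Fe n d (f0 : bmx R (n + 1) (n + 1) -> \bar R) (A : T -> 'M[R]_n)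
    (x : T -> 'cV[R]_n) : measurable_fun setT f0 -> mmx A -> mmx x ->
  measurable_fun setT (fun t => Fe d f0 (A t) (x t)).
Proof.
move=> mf mA mx; apply: (measurableT_comp mf); apply: mmx_measurable; apply: mmx_Pm.
  by apply: mmxM; [apply: mmxM => //; exact: mmx_cst|exact: mmxT].
exact: mmxM.
Qed.

Lemma mmx_uM n (M : T -> 'M[R]_(n + 1)) : mmx M -> mmx (fun t => uM (M t)).
Proof.
move=> mM; have mq : mmx (fun t => M t *m hv 0 1) by apply: mmxM => //; exact: mmx_cst.
apply: mmxZ; last exact: mmx_usubmx.
by apply: measurable_inv; under eq_fun do rewrite mxE; exact: mq.
Qed.

Lemma mmx_PM n (M : T -> 'M[R]_(n + 1)) : mmx M -> mmx (fun t => PM (M t)).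
Proof.
move=> mM; have mu := mmx_uM mM; apply: mmxB; first exact: mmx_ulsubmx.
apply: mmxZ; last by apply: mmxM => //; exact: mmxT.
by apply: measurable_inv; apply: measurable_funD => //; exact: measurable_dot.
Qed.

End Mmx.

Lemma gmx_Ge n d (A : 'M[R]_n) x : (d <= n)%N -> A^T *m A = 1%:M -> pE R n d *m x = 0 ->
  dot x x < 1 -> gmx (Ge d A x) = Pm (A *m pE R n d *m A^T) (A *m x) /\ GammaH n d (Ge d A x).
Proof.
move=> dn oA Ex x1; have G := gpair_frame dn oA Ex x1.
by split; [exact: projmx_geod G|exact: geod_GammaH G].
Qed.

(** A normal form with the measurable frame [flag], where tanh r is the length of the foot point. *)
Lemma GammaH_Ge n d t : (d < n)%N -> GammaH n d t -> exists P u (r : R),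
  let A := flag d P u in [/\ A^T *m A = 1%:M, 0 <= r, t = Ge d A (tanh r *: e (n - d)),
    gmx t = Pm P u & enorm u = tanh r].
Proof.
move=> dn /GammaH_geod[P [u [G ->]]]; have [hP Pu u1] := G.
have [oA AP Au] := flagP dn hP Pu.
have u1' : enorm u < 1 by rewrite -(expr_lt1 (n := 2))// ?enorm_ge0// sqr_enorm.
have [r r0 ru] := tanh_surj (enorm_ge0 u) u1'.
exists P, u, r; split => //; last exact: projmx_geod G.
by rewrite /Ge AP ru -scalemxAr Au.
Qed.

End Frames2.

(** * The two transforms *)

Section DualTransform.
Context (R : realType) (n j k : nat).
Hypotheses (hn : (1 < n)%N) (hjk : (j < k)%N) (hkn : (k < n)%N).
Variable haar : forall m, probability (@borel_mx R m) R.
Hypothesis haarP : forall m, is_haar (rotations m) (haar m).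
Local Notation M1 := (bmx R (n + 1) (n + 1)).
Local Notation S := (sel R n k (n - k)).

Definition x0 (a b : R) : 'cV[R]_n := a *: e (n - k) + b *: e (n - j).

Lemma dot_x0 a b : dot (x0 a b) (x0 a b) = a ^+ 2 + b ^+ 2.
Proof.
have hk : (0 < n - k <= n)%N by lia.
have hj : (0 < n - j <= n)%N by lia.
have ne : (n - k != n - j)%N by lia.
rewrite /x0 !dotDl !dotDr !dotZl !dotZr !dot_e// (dot_e_neq _ _ ne).
by rewrite [dot (e (n - j)) _]dotC (dot_e_neq _ _ ne); ring.
Qed.

Lemma pE_x0 a b : pE R n j *m x0 a b = 0.
Proof. by rewrite mulmxDr -!scalemxAr !pE_e0 ?scaler0 ?addr0//; lia. Qed.

Lemma x0_lt1 (r s : R) : dot (x0 (tanh r) (tanh s / cosh r)) (x0 (tanh r) (tanh s / cosh r)) < 1.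
Proof.
rewrite dot_x0; have -> : (tanh s / cosh r) ^+ 2 = tanh s ^+ 2 * (1 - tanh r ^+ 2).
  by rewrite tanh2; field; exact: cosh_neq0.
by have := tanh_lt1 r; have := tanh_lt1 s; nra.
Qed.

Lemma reflect_x0 : k <> 1%N -> exists D : 'M[R]_k, [/\ D^T *m D = 1%:M, \det D = -1,
  emb n (n - k) D *m pE R n j *m (emb n (n - k) D)^T = pE R n j &
  forall a b, emb n (n - k) D *m x0 a b = x0 a b].
Proof.
(* The reflected direction must avoid e_(n-j) and the reflection must preserve R^j. It is e_n,
   inside R^j, if j > 0; for j = 0, where e_(n-j) = e_n, it is the first unit vector of R^k,
   different from e_n as k != 1. *)
move=> k1; pose i := if (j == 0)%N then 1%N else k.
have hi : (0 < i <= k)%N by rewrite /i; case: (j =P 0%N); lia.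
have hi' : (0 < n - k + i <= n)%N by lia.
have skn : (n - k + k <= n)%N by lia.
exists (hh (e i)); split.
- exact: hh_orthogonal.
- by rewrite det_hh// e_neq0.
- by rewrite emb_hh// hh_e_conj.
- move=> a b; rewrite emb_hh// mulmxDr -!scalemxAr !hh_e//; rewrite /i; case: (j =P 0%N); lia.
Qed.

Lemma measurable_Fe_emb (f0 : M1 -> \bar R) (A : 'M[R]_n) x : measurable_fun setT f0 ->
  measurable_fun setT (fun b : bmx R k k => Fe j f0 (A *m emb n (n - k) b) x).
Proof.
move=> mf; apply: measurable_Fe; [exact: mf| |exact: mmx_cst].
by apply: mmxM; [exact: mmx_cst|apply: mmx_emb; exact: mmx_id].
Qed.

Let wI (s : R) : R := sinh s ^+ (k - j - 1) * cosh s ^+ j.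

Definition RHin (f : set 'cV[R]_(n + 1) -> \bar R) (z : set 'cV[R]_(n + 1)) (s : R) : \bar R :=
  (\int[haar k]_(a in rotations k)
    f (mulmx (lift_rot (frame k (Defs.pi_inv k z)) *m hrot n (n - k) (Defs.gnorm z)
      *m lift_rot (sub_rot n a) *m hrot n (n - j) s) @` Hsub n j))%E.

Lemma RH_RHin (f : set 'cV[R]_(n + 1) -> \bar R) z :
  RH haar j k f z = ((sigma (k - j - 1))%:E * wint wI (RHin f z))%E.
Proof. by []. Qed.

(** The frame chosen in [RH] can be replaced by any A describing the same geodesic: on R^k the two
    differ by some [B2] in O(k), which the Haar integral absorbs because for k != 1 the integrand
    has the symmetry of [reflect_x0]. *)
Lemma RHin_Ge (f : set 'cV[R]_(n + 1) -> \bar R) (f0 : M1 -> \bar R) (A : 'M[R]_n) (r s : R) :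
  measurable_fun setT f0 -> (forall M, 0 <= f0 M)%E ->
  (forall t, GammaH n j t -> f t = f0 (gmx t)) -> A^T *m A = 1%:M -> 0 <= r ->
  RHin f (Ge k A (tanh r *: e (n - k))) s =
  (\int[haar k]_b Fe j f0 (A *m emb n (n - k) b)%R (x0 (tanh r) (tanh s / cosh r)))%E.
Proof.
move=> mf0 f00 hf oA r0.
have hi : (0 < n - k <= n)%N by lia.
have x1 : dot (tanh r *: e (n - k) : 'cV[R]_n) (tanh r *: e (n - k)) = tanh r ^+ 2.
  by rewrite dotZl dotZr dot_e// mulr1 expr2.
have Ex : pE R n k *m (tanh r *: e (n - k)) = 0 by rewrite -scalemxAr pE_e0 ?scaler0.
have G := @gpair_frame R n k A (tanh r *: e (n - k)) (ltnW hkn) oA Ex.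
have {}G := G (eq_ind_r (fun z => z < 1) (tanh_lt1 r) x1).
have gr : Defs.gnorm (Ge k A (tanh r *: e (n - k))) = r.
  by apply: (gnorm_geod G r0); rewrite dot_orthogonal.
have piE : Defs.pi_inv k (Ge k A (tanh r *: e (n - k))) =
    (vimg (A *m pE R n k *m A^T), A *m (tanh r *: e (n - k))) by exact: (pi_inv_geod G).
rewrite /RHin gr piE; set c := frame _ _.
have hk : (0 < k < n)%N by lia.
have [rc cP ce] := frameP hn hk oA (tanh_ge0 r0).
rewrite -/c in rc cP ce; have oc := rc.1.
have skn : (n - k + k <= n)%N by lia.
have embo (b : 'M[R]_k) : rotations k b -> (emb n (n - k) b)^T *m emb n (n - k) b = 1%:M.
  by move=> [ob _]; apply: emb_orthogonal.
have embe (b : 'M[R]_k) : emb n (n - k) b *m e (n - k) = e (n - k).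
  by apply: emb_fix; rewrite tr_sel_e//; lia.
set z := x0 _ _.
transitivity (\int[haar k]_(b in rotations k) Fe j f0 (c *m emb n (n - k) b)%R z)%E.
  apply: eq_integral => b; rewrite inE => rb.
  rewrite sub_rot_emb ?(ltnW hkn)// RH_plane//; last exact: embo.
  have occ : (c *m emb n (n - k) b)^T *m (c *m emb n (n - k) b) = 1%:M.
    by rewrite trmx_mul mulmxA -(mulmxA _ c^T) oc mulmx1 embo.
  have jn : (j <= n)%N by lia.
  have [g1 g2] := gmx_Ge jn occ (pE_x0 _ _) (x0_lt1 r s).
  by rewrite hf//; rewrite g1.
have mg B := measurable_Fe_emb B z mf0.
rewrite (haar_rotations (haarP k) (mg c)); last by move=> b; exact: f00.
have [B2 oB2 cS] := commutant_block (ltnW hkn) oA oc cP; rewrite -/S in cS.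
have SX : pE R n j = S *m (S^T *m pE R n j).
  by rewrite mulmxA sel_last ?(ltnW hkn)// pE_pE'// ltnW.
have Sej : e (n - j) = S *m e (k - j) :> 'cV[R]_n.
  by rewrite sel_e//; [congr e; lia|lia].
have E0 (b : 'M[R]_k) m (X : 'M[R]_(k, m)) :
    c *m emb n (n - k) b *m (S *m X) = A *m emb n (n - k) (B2 *m b) *m (S *m X).
  by rewrite !mulmxA -!(mulmxA _ _ S) !emb_sel// !mulmxA cS.
transitivity (\int[haar k]_b Fe j f0 (A *m emb n (n - k) (B2 *m b))%R z)%E.
  apply: eq_integral => b _; apply: Fe_ext; first by rewrite SX E0.
  have zE (C : 'M[R]_n) : C *m z =
      tanh r *: (C *m e (n - k)) + (tanh s / cosh r) *: (C *m (S *m e (k - j))).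
    by rewrite /z /x0 Sej mulmxDr -!scalemxAr.
  by rewrite !zE -!(mulmxA _ _ (e (n - k))) !embe E0 ce.
have g0 (b : bmx R k k) : (0 <= Fe j f0 (A *m emb n (n - k) b)%R z)%E by exact: f00.
refine (haar_mull_orthogonal (haarP k) oB2 (mg A) g0 _).
move=> k1; have [D [oD dD DE Dx]] := reflect_x0 k1.
exists D; split; [exact: oD|exact: dD|move=> b].
by rewrite -(emb_mul skn) mulmxA (Fe_mulr _ _ _ DE) Dx.
Qed.

Lemma RH_Ge (f : set 'cV[R]_(n + 1) -> \bar R) (f0 : M1 -> \bar R) (A : 'M[R]_n) (r : R) :
  measurable_fun setT f0 -> (forall M, 0 <= f0 M)%E ->
  (forall t, GammaH n j t -> f t = f0 (gmx t)) -> A^T *m A = 1%:M -> 0 <= r ->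
  RH haar j k f (Ge k A (tanh r *: e (n - k))) =
  ((sigma (k - j - 1))%:E * wint wI (fun s => \int[haar k]_b
    Fe j f0 (A *m emb n (n - k) b)%R (x0 (tanh r) (tanh s / cosh r))))%E.
Proof.
move=> mf0 f00 hf oA r0; rewrite RH_RHin; congr (_ * _)%E; congr (wint wI _).
by apply/funext => s; exact: RHin_Ge.
Qed.

(** The inner integral of [RH] as a function of the projection matrix, through [flag]. With |u| =
    tanh r the square root is 1 / cosh r. *)
Definition RHinm (f0 : M1 -> \bar R) (p : M1 * measurableTypeR R) : \bar R :=
  (\int[haar k]_b
    Fe j f0 (flag k (PM p.1) (uM p.1) *m emb n (n - k) b)%R
      (x0 (enorm (uM p.1)) (tanh (p.2 : R) * Num.sqrt (1 - enorm (uM p.1) ^+ 2))))%E.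

Definition RHm (f0 : M1 -> \bar R) (M : M1) : \bar R :=
  ((sigma (k - j - 1))%:E * wint wI (fun s => RHinm f0 (M, s)))%E.

Lemma RHin_gmx (f : set 'cV[R]_(n + 1) -> \bar R) (f0 : M1 -> \bar R) t s :
  measurable_fun setT f0 -> (forall M, 0 <= f0 M)%E ->
  (forall t, GammaH n j t -> f t = f0 (gmx t)) -> GammaH n k t ->
  RHin f t s = RHinm f0 (gmx t, s).
Proof.
move=> mf0 f00 hf /(GammaH_Ge hkn)[P [u [r /= [oA r0 tE gE ur]]]].
have sq : Num.sqrt (1 - tanh r ^+ 2) = (cosh r)^-1.
  by rewrite tanh2 sqrtrV ?sqr_ge0// sqrtr_sqr ger0_norm// ltW// cosh_gt0.
rewrite gE tE (RHin_Ge s mf0 f00 hf oA r0) /RHinm/=.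
by rewrite uM_Pm PM_Pm ur sq.
Qed.

Lemma RH_gmx (f : set 'cV[R]_(n + 1) -> \bar R) (f0 : M1 -> \bar R) t :
  measurable_fun setT f0 -> (forall M, 0 <= f0 M)%E ->
  (forall t, GammaH n j t -> f t = f0 (gmx t)) -> GammaH n k t ->
  RH haar j k f t = RHm f0 (gmx t).
Proof.
move=> mf0 f00 hf tG; rewrite RH_RHin /RHm; congr (_ * wint wI _)%E.
by apply/funext => s; exact: RHin_gmx.
Qed.

Lemma measurable_sinh : measurable_fun setT (@sinh R).
Proof.
apply: measurable_funM => //; apply: measurable_funB; first exact: measurable_expR.
by apply: (measurableT_comp (@measurable_expR R)); exact: measurable_funN.
Qed.

Lemma measurable_cosh : measurable_fun setT (@cosh R).
Proof.
apply: measurable_funM => //; apply: measurable_funD; first exact: measurable_expR.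
by apply: (measurableT_comp (@measurable_expR R)); exact: measurable_funN.
Qed.

Lemma measurable_tanh : measurable_fun setT (@tanh R).
Proof.
by apply: measurable_funM; [exact: measurable_sinh|apply: measurable_inv; exact: measurable_cosh].
Qed.

Lemma measurable_wI : measurable_fun setT wI.
Proof.
by apply: measurable_funM; apply: measurable_funX; [exact: measurable_sinh|exact: measurable_cosh].
Qed.

Lemma wI_ge0 (s : R) : 0 < s -> 0 <= wI s.
Proof. by move=> s0; rewrite mulr_ge0 ?exprn_ge0 ?sinh_ge0 ?(ltW (cosh_gt0 _))// ltW. Qed.

Lemma mmx_x0 d (T : measurableType d) (a b : T -> R) : measurable_fun setT a ->
  measurable_fun setT b -> mmx (fun t => x0 (a t) (b t)).
Proof. by move=> ma mb; apply: mmxD; apply: mmxZ => //; exact: mmx_cst. Qed.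

Lemma measurable_RHinm (f0 : M1 -> \bar R) :
  measurable_fun setT f0 -> (forall M, 0 <= f0 M)%E -> measurable_fun setT (RHinm f0).
Proof.
move=> mf0 f00.
pose H (p : (M1 * measurableTypeR R) * bmx R k k) : \bar R :=
    Fe j f0 (flag k (PM p.1.1) (uM p.1.1) *m emb n (n - k) p.2)%R
      (x0 (enorm (uM p.1.1)) (tanh (p.1.2 : R) * Num.sqrt (1 - enorm (uM p.1.1) ^+ 2))).
apply: (@measurable_fun_fubini_tonelli_F _ _ _ _ R (haar k) H); last by move=> p; exact: f00.
have mM : @mmx R _ (M1 * measurableTypeR R * bmx R k k)%type _ _ (fun p => p.1.1).
  by apply: mmx_of_measurable; apply: measurableT_comp measurable_fst; exact: measurable_fst.
have ms : measurable_fun setT (fun p : M1 * measurableTypeR R * bmx R k k => p.1.2 : R).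
  by apply: (measurableT_comp measurable_snd); exact: measurable_fst.
have mb : @mmx R _ (M1 * measurableTypeR R * bmx R k k)%type _ _ snd.
  by apply: mmx_of_measurable; exact: measurable_snd.
have mu := mmx_uM mM; have mP := mmx_PM mM; have me := measurable_enorm mu.
apply: measurable_Fe => //.
  by apply: mmxM; [exact: mmx_flag|exact: mmx_emb].
apply: mmx_x0 => //; apply: measurable_funM.
  exact: (measurableT_comp measurable_tanh ms).
by apply: measurable_sqrt; apply: measurable_funB => //; exact: measurable_funX.
Qed.

Lemma RHinm_ge0 (f0 : M1 -> \bar R) p : (forall M, 0 <= f0 M)%E -> (0 <= RHinm f0 p)%E.
Proof. by move=> f00; apply: integral_ge0 => b _; exact: f00. Qed.

Lemma measurable_RHm (f0 : M1 -> \bar R) :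
  measurable_fun setT f0 -> (forall M, 0 <= f0 M)%E -> measurable_fun setT (RHm f0).
Proof.
move=> mf0 f00; apply: measurable_funeM.
apply: (measurable_wint measurable_wI wI_ge0 (measurable_RHinm mf0 f00)).
by move=> p; exact: RHinm_ge0.
Qed.

Lemma RH_ge0 (f : set 'cV[R]_(n + 1) -> \bar R) t : (forall t, 0 <= f t)%E ->
  (0 <= RH haar j k f t)%E.
Proof.
move=> f0; apply: mule_ge0; last first.
  apply: integral_ge0 => s; rewrite /= in_itv/= andbT => s0; apply: mule_ge0.
    by rewrite lee_fin; exact: wI_ge0.
  by apply: integral_ge0 => b _; exact: f0.
by rewrite lee_fin sigma_ge0.
Qed.

End DualTransform.

(** * The measure on the subspaces over a given one *)

Section FiberMeasure.
Context (R : realType) (n j k : nat).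
Hypotheses (hn : (1 < n)%N) (hjk : (j < k)%N) (hkn : (k < n)%N).
Variable haar : forall m, probability (@borel_mx R m) R.
Hypothesis haarP : forall m, is_haar (rotations m) (haar m).
Variable nu : {vspace 'cV[R]_n} -> probability (borel_vspace R n) R.
Hypothesis nuP : forall xi, \dim xi = j -> is_fiber_measure k xi (nu xi).
Local Notation M1 := (bmx R (n + 1) (n + 1)).
Local Notation m := (n - j)%N.
Local Notation I := (sel R n m 0).
Local Notation emb0 := (@emb R n m 0).

Let hm : (0 + m <= n)%N. Proof. lia. Qed.
Let hj : (j <= n)%N. Proof. lia. Qed.

Lemma selT_pE : I^T *m pE R n j = 0.
Proof.
have := tr_sel_sel R hm; have := sel_first R hj => E1 E2.
by rewrite -[I^T]mul1mx -E2 -!mulmxA (mulmxA I) E1 mulmxBl mul1mx pE_idem subrr mulmx0.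
Qed.

Lemma emb0_pE (g : 'M[R]_m) : emb0 g *m pE R n j = pE R n j.
Proof. by rewrite emb_fix// selT_pE. Qed.

Lemma pE_emb0 (g : 'M[R]_m) : pE R n j *m emb0 g = pE R n j.
Proof. by rewrite -[LHS]trmxK trmx_mul emb_tr pE_tr emb0_pE pE_tr. Qed.

Lemma emb0_pE_conj (g : 'M[R]_m) : emb0 g *m pE R n j *m (emb0 g)^T = pE R n j.
Proof. by rewrite emb0_pE emb_tr pE_emb0. Qed.

Lemma sel_pE_sel : I *m pE R m (k - j) *m I^T = pE R n k - pE R n j.
Proof.
apply/matrixP => a b.
have -> : (pE R n k - pE R n j) a b =
    ((a == b) && (n - k <= a)%N)%:R - ((a == b) && (n - j <= a)%N)%:R by rewrite !mxE.
have [h|h] := boolP (0 <= a < 0 + m)%N; last first.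
  rewrite -mulmxA sel_mul0//; have -> : (n - j <= a)%N by lia.
  have -> : (n - k <= a)%N by lia.
  by rewrite subrr.
have ha : (a < m)%N by lia.
rewrite -mulmxA (@sel_mul _ _ _ _ _ _ _ (Ordinal ha))//.
have -> : (n - j <= a)%N = false by lia.
rewrite andbF subr0.
have [hb|hb] := boolP (0 <= b < 0 + m)%N; last first.
  rewrite mul_sel0//; case: eqP => // ab; by move: hb; rewrite -ab h.
have hb' : (b < m)%N by lia.
rewrite (@mul_sel _ _ _ _ _ _ _ _ (Ordinal hb'))// !mxE -!val_eqE/=.
by congr (nat_of_bool (_ && _))%:R; lia.
Qed.

Lemma emb0_pEk (g : 'M[R]_m) : emb0 g *m pE R n k *m (emb0 g)^T =
  I *m (g *m pE R m (k - j) *m g^T) *m I^T + pE R n j.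
Proof.
have -> : pE R n k = I *m pE R m (k - j) *m I^T + pE R n j by rewrite sel_pE_sel subrK.
rewrite mulmxDr mulmxDl emb0_pE_conj !mulmxA (emb_sel hm) -(mulmxA _ I^T) -trmx_mul (emb_sel hm).
by rewrite trmx_mul !mulmxA.
Qed.

(** Compressed to the complement of R^j, P is a projection of rank k - j, for which [secP] gives a
    frame. If its determinant is -1 it is corrected by the reflection in e_1, which commutes with
    the projection onto the last k - j coordinates. *)
Lemma fiber_element (P : 'M[R]_n) : isproj k P -> P *m pE R n j = pE R n j ->
  exists2 d : 'M[R]_m, rotations m d & emb0 d *m pE R n k *m (emb0 d)^T = P.
Proof.
move=> [PT PP tP] Pj; have jP : pE R n j *m P = pE R n j.
  by rewrite -[LHS]trmxK trmx_mul PT pE_tr Pj pE_tr.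
have SS := sel_first R hj; have StS := tr_sel_sel R hm.
pose Q := I^T *m P *m I.
have hQ : isproj (k - j) Q.
  split.
  - by rewrite !trmx_mul trmxK PT mulmxA.
  - have IPj : I^T *m P *m pE R n j = 0 by rewrite -mulmxA Pj selT_pE.
    rewrite /Q !mulmxA -(mulmxA (I^T *m P)) SS mulmxBr mulmx1 IPj subr0.
    by rewrite -(mulmxA I^T) PP.
  - rewrite /Q -mulmxA mxtrace_mulC -mulmxA SS mulmxBr mulmx1 Pj raddfB/= tP tr_pE//.
    by rewrite natrB// ltnW.
have km : (k - j <= m)%N by lia.
have [od dQ] := secP km hQ; set d := sec _ _ in od dQ.
have h1 : (0 < 1 <= m)%N by lia.
have dD : \det (hh (e 1 : 'cV[R]_m)) = -1 by rewrite det_hh// e_neq0.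
have [C rC CE] := to_rotation od (hh_orthogonal (e 1)) dD; exists C => //.
rewrite emb0_pEk; have -> : C *m pE R m (k - j) *m C^T = Q.
  case: CE => -> //.
  by rewrite trmx_mul -[RHS]dQ -[in RHS](hh_e_conj R (k - j) h1) !mulmxA.
rewrite /Q !mulmxA SS -(mulmxA _ I) SS mulmxBl mul1mx jP mulmxBr mulmx1 mulmxBl Pj pE_idem.
by rewrite subrr subr0 subrK.
Qed.

Lemma measurable_projmx : measurable_fun setT
  (fun V : borel_vspace R n => projmx [set` (V : {vspace 'cV[R]_n})] : bmx R n n).
Proof.
apply: (@measurability _ _ _ (bmx R n n) _ _ (@open 'M[R]_n) erefl) => _ [U oU <-].
by rewrite setTI; apply: sub_sigma_algebra; exists U.
Qed.

Local Notation pr V := (projmx [set` (V : {vspace 'cV[R]_n})]).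

(** Dimension and inclusion become equations in the entries of the projections, from which
    measurability follows. *)
Lemma subspaces_overE xi (V : {vspace 'cV[R]_n}) :
  subspaces_over k xi V <-> \tr (pr V) = k%:R /\ pr V *m pr xi = pr xi.
Proof.
have [[_ _ tV] [_ PV]] := projmxP V; have [_ Pxi] := projmxP xi.
rewrite /subspaces_over/= tV; split => -[dV xV].
  rewrite dV; split => //; apply: mx_eq_cV => x; rewrite -mulmxA; apply/eqP.
  by rewrite -PV; apply: (subvP xV); exact: projects_on_in Pxi.
split; first by apply/eqP; rewrite -(eqr_nat R) dV.
apply/subvP => x; rewrite Pxi.2 => /eqP <-; rewrite PV mulmxA xV//.
Qed.

Lemma measurable_subspaces_over xi :
  measurable (subspaces_over k xi : set (borel_vspace R n)).
Proof.
have mp := mmx_of_measurable measurable_projmx.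
rewrite (_ : subspaces_over k xi = [set V : borel_vspace R n | \tr (pr V) = k%:R] `&`
    \bigcap_(ij in [set: 'I_n * 'I_n])
      [set V : borel_vspace R n | (pr V *m pr xi) ij.1 ij.2 = (pr xi) ij.1 ij.2]); last first.
  apply/seteqP; split => V.
    by move=> /subspaces_overE[tV VE]; split => // ij _ /=; rewrite VE.
  move=> [tV VE]; apply/subspaces_overE; split => //; apply/matrixP => a b.
  exact: (VE (a, b) Logic.I).
apply: measurableI.
  have mt : measurable_fun setT (fun V : borel_vspace R n => \tr (pr V)).
    by apply: measurable_sum => i; exact: mp.
  by rewrite -[X in measurable X]setTI; exact: (mt measurableT [set k%:R]).
apply: fin_bigcap_measurable => [|ij _]; first exact: finite_finset.
have mc : measurable_fun setT (fun V : borel_vspace R n => (pr V *m pr xi) ij.1 ij.2).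
  by apply: mmxM => //; exact: mmx_cst.
by rewrite -[X in measurable X]setTI; exact: (mc measurableT [set _]).
Qed.

Local Open Scope ereal_scope.

(** The invariance of the fiber measure read on matrices: if P projects onto V, then B P B^T
    projects onto the image of V. *)
Lemma fiber_invariance xi (B : 'M[R]_n) (Psi : bmx R n n -> \bar R) : \dim xi = j ->
  rotations n B -> limage B xi = xi -> measurable_fun setT Psi -> (forall M, 0 <= Psi M) ->
  \int[nu xi]_V Psi (B *m pr V *m B^T)%R = \int[nu xi]_V Psi (pr V).
Proof.
move=> dxi rB Bxi mPsi Psi0; have oB := rB.1.
have mp := measurable_projmx.
have mB : measurable_fun setT (fun M : bmx R n n => (B *m M *m B^T)%R : bmx R n n).
  by apply: mmx_measurable; apply: mmxM; [apply: mmxM; [exact: mmx_cst|exact: mmx_id]|exact: mmx_cst].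
pose p : borel_vspace R n -> bmx R n n := fun V => pr V.
pose p' : borel_vspace R n -> bmx R n n := fun V => (B *m pr V *m B^T)%R.
have mp' : measurable_fun setT p' by exact: (measurableT_comp mB mp).
pose m1 : {measure set (bmx R n n) -> \bar R} := pushforward (nu xi) p.
pose m2 : {measure set (bmx R n n) -> \bar R} := pushforward (nu xi) p'.
transitivity (\int[m2 mp']_M Psi M); first by rewrite ge0_integral_pushforward.
transitivity (\int[m1 mp]_M Psi M); last by rewrite ge0_integral_pushforward.
apply: eq_measure_integral => S mS _.
have [_ /(_ _ rB Bxi (p @^-1` S))] := nuP dxi.
rewrite /= /pushforward => <-; last first.
  by rewrite -[X in measurable X]setTI; exact: (mp measurableT S mS).
congr (nu xi _); apply/seteqP; split => V; rewrite /p' /p /=.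
  by rewrite (projmx_vspace (projects_on_limage oB (projmxP V).2)).
by rewrite (projmx_vspace (projects_on_limage oB (projmxP V).2)).
Qed.

(* Average over g in SO(n - j) the invariance of nu under [emb0 g], exchange the
   integrals, and use that SO(n - j) acts transitively on the fiber. *)
Lemma fiber_integral (A : 'M[R]_n) xi (Psi : bmx R n n -> \bar R) : (A^T *m A = 1%:M)%R ->
  projects_on (A *m pE R n j *m A^T)%R xi -> measurable_fun setT Psi -> (forall M, 0 <= Psi M) ->
  \int[nu xi]_(V in subspaces_over k xi) Psi (pr V) =
  \int[haar m]_g Psi (A *m (emb0 g *m pE R n k *m (emb0 g)^T) *m A^T)%R.
Proof.
move=> oA pxi mPsi Psi0; have oA' := ortho_tr oA.
have dxi : \dim xi = j.
  by apply: (dim_projects_on pxi); rewrite -mulmxA mxtrace_mulC -mulmxA oA mulmx1 tr_pE.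
have [nu1 _] := nuP dxi; have mo := measurable_subspaces_over xi.
have prxi : (pr xi = A *m pE R n j *m A^T)%R by exact: projmx_vspace.
have mPp : measurable_fun setT (fun V : borel_vspace R n => Psi (pr V)).
  exact: (measurableT_comp mPsi measurable_projmx).
rewrite (prob_integral mo nu1 mPp); last by move=> V; exact: Psi0.
pose W (P : 'M[R]_n) (g : 'M[R]_m) : bmx R n n :=
  (A *m emb0 g *m A^T *m P *m (A *m emb0 g *m A^T)^T)%R.
pose H (p : borel_vspace R n * bmx R m m) : \bar R := Psi (W (pr p.1) p.2).
have m1 : @mmx R _ (borel_vspace R n * bmx R m m)%type n n (fun p => pr p.1).
  by apply: mmx_of_measurable; exact: (measurableT_comp measurable_projmx measurable_fst).
have m2 : @mmx R _ (borel_vspace R n * bmx R m m)%type m m snd.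
  by apply: mmx_of_measurable; exact: measurable_snd.
have mH : measurable_fun setT H.
  apply: (measurableT_comp mPsi); apply: mmx_measurable.
  have mE : @mmx R _ (borel_vspace R n * bmx R m m)%type n n
      (fun p => (A *m emb0 p.2 *m A^T)%R).
    by apply: mmxM; [apply: mmxM; [exact: mmx_cst|exact: mmx_emb]|exact: mmx_cst].
  by apply: mmxM; [exact: mmxM|exact: mmxT].
have H0 p : 0 <= H p by exact: Psi0.
pose g1 (g : bmx R m m) : \bar R := Psi (A *m (emb0 g *m pE R n k *m (emb0 g)^T) *m A^T)%R.
have mg1 : measurable_fun setT g1.
  apply: (measurableT_comp mPsi); apply: mmx_measurable.
  have mE : @mmx R _ (bmx R m m) n n (fun g => emb0 g) by apply: mmx_emb; exact: mmx_id.
  apply: mmxM; last exact: mmx_cst.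
  apply: mmxM; first exact: mmx_cst.
  by apply: mmxM; [apply: mmxM => //; exact: mmx_cst|exact: mmxT].
have g10 g : 0 <= g1 g by exact: Psi0.
have IV0 : 0 <= \int[nu xi]_V Psi (pr V) by apply: integral_ge0 => V _; exact: Psi0.
have rotm := @measurable_rotations R m.
have hm1 : haar m (rotations m) = 1 by have [] := haarP m.
have n1 : n <> 1%N by lia.
have m1' : m <> 1%N by lia.
transitivity (\int[haar m]_(g in rotations m) \int[nu xi]_V H (V, g)).
  rewrite -[LHS](prob_integral_cst rotm hm1 IV0); apply: eq_integral => g; rewrite inE => rg.
  have rE := emb_rotations hm n1 rg m1'.
  have rB : rotations n (A *m emb0 g *m A^T)%R by exact: rotations_conj.
  rewrite -(fiber_invariance dxi rB _ mPsi Psi0)//.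
  apply: (projects_on_inj (projects_on_limage rB.1 pxi)).
  rewrite (_ : (_ *m _ *m _)%R = (A *m pE R n j *m A^T)%R)//.
  rewrite !trmx_mul trmxK !mulmxA -(mulmxA _ A^T A) oA mulmx1 -(mulmxA _ A^T A) oA mulmx1.
  by rewrite -(mulmxA _ _ (pE R n j)) emb0_pE -(mulmxA A) emb_tr pE_emb0.
have mG : measurable_fun setT (fun g => \int[nu xi]_V H (V, g)).
  exact: (measurable_fun_fubini_tonelli_G H mH H0).
rewrite (prob_integral rotm hm1 mG); last by move=> g; exact: integral_ge0.
rewrite -(fubini_tonelli H mH H0).
have mF : measurable_fun setT (fun V => \int[haar m]_g H (V, g)).
  exact: (measurable_fun_fubini_tonelli_F H mH H0).
rewrite -[LHS](prob_integral mo nu1 mF); last by move=> V; exact: integral_ge0.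
have C0 : 0 <= \int[haar m]_g g1 g by exact: integral_ge0.
rewrite -[RHS](prob_integral_cst mo nu1 C0); apply: eq_integral => V; rewrite inE.
move=> /subspaces_overE[tV VE]; have [[PT PP _] _] := projmxP V.
have [d rd dE] : exists2 d : 'M[R]_m, rotations m d &
    (emb0 d *m pE R n k *m (emb0 d)^T = A^T *m pr V *m A)%R.
  apply: fiber_element.
    split.
    - by rewrite !trmx_mul trmxK PT mulmxA.
    - by rewrite !mulmxA -(mulmxA _ A A^T) oA' mulmx1 -(mulmxA A^T) PP.
    - by rewrite -mulmxA mxtrace_mulC -mulmxA oA' mulmx1.
  have : (A^T *m (pr V *m pr xi) *m A = A^T *m pr xi *m A)%R by rewrite VE.
  rewrite prxi !mulmxA oA mul1mx -(mulmxA (pE R n j)) oA mulmx1.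
  by rewrite -(mulmxA _ A^T A) oA mulmx1.
rewrite -[RHS](haar_mulr (haarP m) rd mg1 g10); apply: eq_integral => g _.
rewrite /H /g1 /W/=; congr Psi.
rewrite -(emb_mul hm) (trmx_mul (emb0 g)).
have -> : (A *m (emb0 g *m emb0 d *m pE R n k *m ((emb0 d)^T *m (emb0 g)^T)) *m A^T =
    A *m emb0 g *m (emb0 d *m pE R n k *m (emb0 d)^T) *m (emb0 g)^T *m A^T)%R.
  by rewrite !mulmxA.
by rewrite dE !trmx_mul trmxK !mulmxA.
Qed.

(** The weight of [opP] as a function of the foot point. *)
Definition Vw (x : 'cV[R]_n) : R := ((1 - dot x x) `^ ((j%:R - n%:R) / 2))%R.

Lemma measurable_Vw d (T : measurableType d) (F : T -> 'cV[R]_n) : mmx F ->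
  measurable_fun setT (fun t => Vw (F t)).
Proof.
move=> mF; apply: (@measurableT_comp _ _ _ _ _ _ (fun y : R => (y `^ ((j%:R - n%:R) / 2))%R)).
  exact: measurable_powR.
by apply: measurable_funB => //; exact: measurable_dot.
Qed.

(** The k-dimensional subspaces over A R^j are the images of R^k under A (emb g). In this frame the
    projected foot point has coordinates (1 - p) (emb g)^T x, where p projects onto R^k. *)
Lemma RHstar_Ge (phi : set 'cV[R]_(n + 1) -> \bar R) (phi0 : M1 -> \bar R) (A : 'M[R]_n) (s : R) :
  measurable_fun setT phi0 -> (forall M, 0 <= phi0 M) ->
  (forall t, GammaH n k t -> phi t = phi0 (gmx t)) -> (A^T *m A = 1%:M)%R -> (0 <= s)%R ->
  RHstar nu j k phi (Ge j A (tanh s *: e (n - j))%R) =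
  (cosh s ^ (k%:Z - n%:Z)%R)%:E * \int[haar m]_g
    (let x := ((1%:M - pE R n k) *m (emb0 g)^T *m (tanh s *: e (n - j)))%R in
     (Vw x)%:E * Fe k phi0 (A *m emb0 g)%R x).
Proof.
move=> mphi phi00 hphi oA s0; set x := (tanh s *: e (n - j))%R.
have hi : (0 < n - j <= n)%N by lia.
have xx : dot x x = (tanh s ^+ 2)%R by rewrite dotZl dotZr dot_e// mulr1 expr2.
have Ex : (pE R n j *m x = 0)%R by rewrite -scalemxAr pE_e0 ?scaler0.
have x1 : (dot x x < 1)%R by rewrite xx tanh_lt1.
have G := gpair_frame hj oA Ex x1.
have gr : Defs.gnorm (Ge j A x) = s.
  by apply: (gnorm_geod G s0); rewrite dot_orthogonal.
rewrite /RHstar /opQ gr [Defs.pi_inv _ _](pi_inv_geod G); congr (_ * _).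
set xi := vimg _; set u := (A *m x)%R in G *.
have pxi : projects_on (A *m pE R n j *m A^T)%R xi.
  by apply: projects_on_vimg; have [hP _ _] := G; exact: isproj_sproj hP.
pose Psi (P : bmx R n n) : \bar R := (Vw (u - P *m u)%R)%:E * phi0 (Pm P (u - P *m u)%R).
have u1 : (dot u u < 1)%R by case: G.
transitivity (\int[nu xi]_(V in subspaces_over k xi) Psi (pr V)).
  apply: eq_integral => V; rewrite inE => -[dV xiV].
  have [hP PV] := projmxP V; rewrite dV in hP; have [PT PP _] := hP.
  rewrite /= (oproj_orth _ PV).
  have Pu0 : (pr V *m (u - pr V *m u) = 0)%R by rewrite mulmxBr (mulmxA (pr V) (pr V)) PP subrr.
  (* Projecting does not lengthen the foot point, so every plane of the fiber stays in the ball and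
     the value is never taken from the extension by 0. *)
  have du : (dot (u - pr V *m u) (u - pr V *m u) < 1)%R.
    apply: le_lt_trans u1; rewrite dotBl dotBr.
    have -> : dot (pr V *m u) (u - pr V *m u) = 0%R.
      by rewrite dot_mulmxl PT Pu0 dotC dot0l.
    rewrite subr0 lerBlDr lerDl; have := dot_ge0 (pr V *m u).
    by rewrite {1}dot_mulmxl PT (mulmxA (pr V) (pr V)) PP.
  have GV : gpair k (pr V) (u - pr V *m u)%R by split.
  have VV : vimg (pr V) = V.
    exact: (projects_on_inj (projects_on_vimg (isproj_sproj hP)) PV).
  have := gpair_GammaB GV; rewrite VV => VB; rewrite patchE mem_set//.
  rewrite /opP/= sqr_enorm -/(Vw _); congr (_ * _).
  have := pi_geodE GV; rewrite VV => ->; rewrite hphi; last exact: geod_GammaH GV.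
  by congr phi0; exact: projmx_geod GV.
have mu_ d (T : measurableType d) (P : T -> 'M[R]_n) : mmx P -> mmx (fun t => u - P t *m u)%R.
  by move=> mP; apply: mmxB; [exact: mmx_cst|apply: mmxM => //; exact: mmx_cst].
have mPsi : measurable_fun setT Psi.
  have mid : @mmx R _ (bmx R n n) n n id by exact: mmx_id.
  apply: emeasurable_funM; first by apply/measurable_EFinP; apply: measurable_Vw; exact: mu_.
  apply: (measurableT_comp mphi); apply: mmx_measurable; apply: mmx_Pm => //; exact: mu_.
have Psi0 M : 0 <= Psi M by rewrite mule_ge0// lee_fin powR_ge0.
rewrite (fiber_integral oA pxi mPsi Psi0).
have mE : @mmx R _ (bmx R m m) n n (fun g => emb0 g) by apply: mmx_emb; exact: mmx_id.
have mx' : @mmx R _ (bmx R m m) n 1 (fun g => (1%:M - pE R n k) *m (emb0 g)^T *m x)%R.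
  by apply: mmxM; [apply: mmxM; [exact: mmx_cst|exact: mmxT]|exact: mmx_cst].
apply: (eq_haar (haarP m)).
- apply: (measurableT_comp mPsi); apply: mmx_measurable.
  apply: mmxM; last exact: mmx_cst.
  apply: mmxM; first exact: mmx_cst.
  by apply: mmxM; [apply: mmxM => //; exact: mmx_cst|exact: mmxT].
- by move=> g; exact: Psi0.
- apply: emeasurable_funM; first by apply/measurable_EFinP; exact: measurable_Vw.
  by apply: measurable_Fe => //; apply: mmxM => //; exact: mmx_cst.
- by move=> g; apply: mule_ge0; [rewrite lee_fin powR_ge0|exact: phi00].
move=> g [og _]; have oE := emb_orthogonal hm og; have oE' := ortho_tr oE.
set E := emb0 g in oE oE' *; rewrite /Psi /Fe.
have -> : (A *m E *m pE R n k *m (A *m E)^T = A *m (E *m pE R n k *m E^T) *m A^T)%R.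
  by rewrite trmx_mul !mulmxA.
set P := (A *m (_) *m A^T)%R.
have -> : (u - P *m u = A *m E *m ((1%:M - pE R n k) *m E^T *m x))%R.
  rewrite -(mulmxA (1%:M - _)%R) mulmxBl mul1mx (mulmxBr (A *m E)%R); congr (_ - _)%R.
    by rewrite /u !mulmxA -(mulmxA A E) oE' mulmx1.
  by rewrite /P /u !mulmxA -(mulmxA _ A^T A) oA mulmx1.
have oAE : ((A *m E)^T *m (A *m E) = 1%:M)%R.
  by rewrite trmx_mul mulmxA -(mulmxA _ A^T) oA mulmx1.
by rewrite /Vw (dot_orthogonal _ _ oAE).
Qed.

End FiberMeasure.

Lemma mule_congr (R : realType) (c x y : \bar R) : x = y -> (c * x = c * y)%E.
Proof. by move=> ->. Qed.

(** * The Haar measure of O(n) *)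

Section OrthogonalAverage.
Context (R : realType) (n : nat) (mu : probability (bmx R n n) R).
Hypotheses (n0 : (0 < n)%N) (muP : is_haar (rotations n) mu).
Local Open Scope ereal_scope.

Definition twist (p : bmx R n n * bool) : bmx R n n :=
  if p.2 then (p.1 *m hh (e 1))%R else p.1.

Lemma measurable_twist : measurable_fun setT twist.
Proof.
apply: mmx_measurable; apply: mmx_if; first exact: measurable_snd.
  apply: mmxM; last exact: mmx_cst.
  by apply: mmx_of_measurable; exact: measurable_fst.
by apply: mmx_of_measurable; exact: measurable_fst.
Qed.

HB.instance Definition _ := isMeasurableFun.Build _ _ _ _ twist measurable_twist.

(* The Haar measure of O(n). *)
Definition haarO : probability (bmx R n n) R :=
  distribution (mu \x bernoulli_prob (2^-1 : R)) twist.

Lemma haarOE (h : bmx R n n -> \bar R) : measurable_fun setT h -> (forall x, 0 <= h x) ->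
  \int[haarO]_a h a = (2^-1 : R)%:E * \int[mu]_a h (a *m hh (e 1))%R +
                      (2^-1 : R)%:E * \int[mu]_a h a.
Proof.
move=> mh h0; rewrite ge0_integral_distribution//.
have mht : measurable_fun setT (h \o twist) by exact: (measurableT_comp mh measurable_twist).
rewrite (fubini_tonelli1 _ mht) //; last by move=> p; exact: h0.
have mr : measurable_fun setT (fun a : bmx R n n => h (a *m hh (e 1))%R).
  apply: (measurableT_comp mh); apply: mmx_measurable.
  by apply: mmxM; [exact: mmx_id|exact: mmx_cst].
rewrite -!ge0_integralZl//.
rewrite -ge0_integralD//; last 4 first.
- by move=> x _; rewrite mule_ge0.
- exact: measurable_funeM.
- by move=> x _; rewrite mule_ge0.
- exact: measurable_funeM.
apply: eq_integral => a _; rewrite /fubini_F integral_bernoulli_prob//=.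
- by congr (_ + _%:E * _); rewrite /unstable.onem; field.
- by apply/andP; split; lra.
Qed.

(** By right invariance of [mu], a matrix of determinant 1 preserves each of the two halves of
    [haarO], and one of determinant -1 exchanges them. *)
Lemma haarO_mulr (A : 'M[R]_n) (h : bmx R n n -> \bar R) : (A^T *m A = 1%:M)%R ->
  measurable_fun setT h -> (forall x, 0 <= h x) ->
  \int[haarO]_a h (a *m A)%R = \int[haarO]_a h a.
Proof.
move=> oA mh h0; pose D : 'M[R]_n := hh (e 1).
have oD : (D^T *m D = 1%:M)%R by exact: hh_orthogonal.
have dD : \det D = (-1)%R by rewrite det_hh// e_neq0.
have mr (B : 'M[R]_n) : measurable_fun setT (fun a : bmx R n n => h (a *m B)%R).
  apply: (measurableT_comp mh); apply: mmx_measurable.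
  by apply: mmxM; [exact: mmx_id|exact: mmx_cst].
have hr (B C : 'M[R]_n) : rotations n B ->
    \int[mu]_a h (a *m B *m C)%R = \int[mu]_a h (a *m C)%R.
  by move=> rB; apply: (haar_mulr muP rB (mr C)) => x; exact: h0.
rewrite (haarOE mh h0) (haarOE (mr A)); last by move=> x; exact: h0.
rewrite -/D.
have oDA : ((D *m A)^T *m (D *m A) = 1%:M)%R.
  by rewrite trmx_mul mulmxA -(mulmxA _ D^T) oD mulmx1.
have oAD : ((A *m D^T)^T *m (A *m D^T) = 1%:M)%R.
  by rewrite trmx_mul trmxK mulmxA -(mulmxA _ A^T) oA mulmx1 ortho_tr.
have E1 : \int[mu]_a h (a *m 1%:M)%R = \int[mu]_a h a.
  by apply: eq_integral => a _; rewrite mulmx1.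
have [dA|dA] := det_orthogonal oA; [congr (_ * _ + _ * _)|rewrite addeC; congr (_ * _ + _ * _)].
- have rB : rotations n (D *m A *m D^T)%R by apply: rotations_conj.
  rewrite -[RHS](hr _ _ rB); apply: eq_integral => a _; congr h.
  by rewrite -!mulmxA oD mulmx1.
- have rA : rotations n A by [].
  exact: (haar_mulr muP rA mh h0).
- have rB : rotations n (A *m D^T)%R.
    by split => // _; rewrite det_mulmx det_tr dA dD; ring.
  rewrite -[RHS](hr _ _ rB); apply: eq_integral => a _; congr h.
  by rewrite -!mulmxA oD mulmx1.
- have rB : rotations n (D *m A)%R by split => // _; rewrite det_mulmx dA dD; ring.
  rewrite -[RHS]E1 -[RHS](hr _ _ rB); apply: eq_integral => a _; congr h.
  by rewrite mulmx1 mulmxA.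
Qed.

(** With the rotation B = hh(e_1) D^T one has h(a hh(e_1)) = h(a B D) = h(a B), so the two halves of
    [haarO] give the same integral. *)
Lemma haarO_haar (D : 'M[R]_n) (h : bmx R n n -> \bar R) :
  (D^T *m D = 1%:M)%R -> \det D = (-1)%R ->
  measurable_fun setT h -> (forall x, 0 <= h x) -> (forall a, h (a *m D)%R = h a) ->
  \int[mu]_a h a = \int[haarO]_a h a.
Proof.
move=> oD dD mh h0 hD; rewrite haarOE//.
pose B : 'M[R]_n := (hh (e 1) *m D^T)%R.
have rB : rotations n B.
  split; last by move=> _; rewrite det_mulmx det_tr dD det_hh ?e_neq0//; ring.
  rewrite /orthogonal_group/= trmx_mul trmxK mulmxA -(mulmxA _ (hh (e 1))^T).
  by rewrite hh_orthogonal mulmx1 ortho_tr.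
have -> : \int[mu]_a h (a *m hh (e 1))%R = \int[mu]_a h a.
  rewrite -[RHS](haar_mulr muP rB mh h0); apply: eq_integral => a _.
  by rewrite -[RHS]hD /B -!mulmxA oD mulmx1.
rewrite -ge0_muleDl// -EFinD (_ : 2^-1 + 2^-1 = 1)%R ?mul1e//; by field.
Qed.

End OrthogonalAverage.

(** * Both integrands averaged over O(n) *)

Section Duality.
Context (R : realType) (n j k : nat).
Hypotheses (hn : (1 < n)%N) (hjk : (j < k)%N) (hkn : (k < n)%N).
Variable haar : forall m, probability (@borel_mx R m) R.
Hypothesis haarP : forall m, is_haar (rotations m) (haar m).
Variable nu : {vspace 'cV[R]_n} -> probability (borel_vspace R n) R.
Hypothesis nuP : forall xi, \dim xi = j -> is_fiber_measure k xi (nu xi).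
Local Notation M1 := (bmx R (n + 1) (n + 1)).
Local Notation m := (n - j)%N.
Local Notation I := (sel R n m 0).
Local Notation emb0 := (@emb R n m 0).
Local Notation hO := (haarO (haar n)).
Variables f0 phi0 : M1 -> \bar R.
Hypotheses (mf0 : measurable_fun setT f0) (mphi0 : measurable_fun setT phi0).
Hypotheses (f00 : forall M, (0 <= f0 M)%E) (phi00 : forall M, (0 <= phi0 M)%E).
Local Open Scope ereal_scope.

Definition qE : 'M[R]_n := (1%:M - pE R n k)%R.

Definition J (x : 'cV[R]_n) : \bar R :=
  \int[hO]_a (Fe j f0 a x * Fe k phi0 a (qE *m x)%R).

Let n0 : (0 < n)%N. Proof. lia. Qed.

Let mJ d (T : measurableType d) (A : T -> 'M[R]_n) (x y : T -> 'cV[R]_n) : mmx A -> mmx x -> mmx y ->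
  measurable_fun setT (fun t => Fe j f0 (A t) (x t) * Fe k phi0 (A t) (y t)).
Proof. by move=> mA mx my; apply: emeasurable_funM; exact: measurable_Fe. Qed.

Let J0' a x y : 0 <= Fe j f0 a x * Fe k phi0 a y.
Proof. by apply: mule_ge0; [exact: f00|exact: phi00]. Qed.

Lemma J_ge0 x : 0 <= J x.
Proof. by apply: integral_ge0 => a _; exact: J0'. Qed.

Lemma measurable_J d (T : measurableType d) (x : T -> 'cV[R]_n) : mmx x ->
  measurable_fun setT (fun t => J (x t)).
Proof.
move=> mx; pose H (p : T * bmx R n n) := Fe j f0 p.2 (x p.1) * Fe k phi0 p.2 (qE *m x p.1)%R.
have mx1 : @mmx R _ (T * bmx R n n)%type n 1 (fun p => x p.1).
  by move=> a b; exact: (measurableT_comp (mx a b) measurable_fst).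
apply: (@measurable_fun_fubini_tonelli_F _ _ _ _ R hO H); last by move=> p; exact: J0'.
apply: mJ => //; first by apply: mmx_of_measurable; exact: measurable_snd.
by apply: mmxM => //; exact: mmx_cst.
Qed.

Lemma pE_comm (A : 'M[R]_n) d : (A^T *m A = 1%:M -> A *m pE R n d *m A^T = pE R n d ->
  A *m pE R n d = pE R n d *m A)%R.
Proof. by move=> oA E; rewrite -[in RHS]E -mulmxA oA mulmx1. Qed.

Lemma qE_comm (A : 'M[R]_n) : (A^T *m A = 1%:M -> A *m pE R n k *m A^T = pE R n k ->
  A *m qE = qE *m A)%R.
Proof.
by move=> oA Ak; rewrite /qE mulmxBr mulmxBl mulmx1 mul1mx (pE_comm oA Ak).
Qed.

(** A commutes with [qE] and is absorbed on the right of the averaging variable. *)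
Lemma J_invariant (A : 'M[R]_n) x : (A^T *m A = 1%:M)%R -> (A *m pE R n j *m A^T = pE R n j)%R ->
  (A *m pE R n k *m A^T = pE R n k)%R -> J (A *m x)%R = J x.
Proof.
move=> oA Aj Ak; pose h (a : bmx R n n) := Fe j f0 a x * Fe k phi0 a (qE *m x)%R.
have mh : measurable_fun setT h by apply: mJ; [exact: mmx_id|exact: mmx_cst|exact: mmx_cst].
rewrite /J -/(h _) -[RHS](haarO_mulr n0 (haarP n) oA mh) => [|a]; last exact: J0'.
apply: eq_integral => a _; rewrite /h (Fe_mulr _ _ _ Aj) (Fe_mulr _ _ _ Ak).
by rewrite !mulmxA (qE_comm oA Ak).
Qed.

Let wL (r : R) : R := (sinh r ^+ (n - k - 1) * cosh r ^+ k)%R.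
Let wI (s : R) : R := (sinh s ^+ (k - j - 1) * cosh s ^+ j)%R.
Let wR (s : R) : R := (sinh s ^+ (n - j - 1) * cosh s ^+ j)%R.

Lemma reflect_emb : exists D : 'M[R]_k, [/\ (D^T *m D = 1%:M)%R, \det D = (-1)%R &
  forall d, (emb n (n - k) D *m pE R n d *m (emb n (n - k) D)^T = pE R n d)%R].
Proof.
have hk : (0 < k <= k)%N by lia.
exists (hh (e k)); split; first exact: hh_orthogonal.
  by rewrite det_hh// e_neq0.
by move=> d; rewrite emb_hh ?hh_e_conj//; lia.
Qed.

(** The product of the transform of f and of phi at the k-dimensional geodesic with frame a and foot
    point tanh r along e_(n-k). *)
Definition X (r : R) (a : 'M[R]_n) : \bar R :=
  ((sigma (k - j - 1))%:E * wint wI (fun s => \int[haar k]_b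
    Fe j f0 (a *m emb n (n - k) b)%R (x0 n j k (tanh r) (tanh s / cosh r)%R))) *
  Fe k phi0 a (tanh r *: e (n - k))%R.

Let skn : (n - k + k <= n)%N. Proof. lia. Qed.

Let emb_e (b : 'M[R]_k) : (emb n (n - k) b *m e (n - k) = e (n - k))%R.
Proof. by apply: emb_fix; rewrite tr_sel_e//; lia. Qed.

Let emb_pEk (b : 'M[R]_k) : (b^T *m b = 1%:M)%R ->
  (emb n (n - k) b *m pE R n k *m (emb n (n - k) b)^T = pE R n k)%R.
Proof.
move=> ob; rewrite -(sel_last R (ltnW hkn)) !mulmxA (emb_sel skn) -mulmxA -trmx_mul (emb_sel skn).
by rewrite trmx_mul !mulmxA -(mulmxA _ b) ortho_tr// mulmx1.
Qed.

Lemma qE_x0 a b : (qE *m x0 n j k a b = a *: e (n - k))%R.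
Proof.
rewrite /qE mulmxBl mul1mx /x0 mulmxDr -!scalemxAr !pE_e ltnn.
have -> : (n - k < n - j)%N by lia.
by rewrite scale0r scaler0 add0r scale1r addrK.
Qed.

(** After Tonelli's theorem, b in SO(k) is fixed and a is replaced by a times the inverse of emb b.
    The factor phi does not change, since emb b preserves R^k and fixes e_(n-k), and the factor f
    becomes independent of b. *)
Lemma integral_X (r : R) : (0 <= r)%R ->
  \int[haar n]_(a in rotations n) X r a =
  (sigma (k - j - 1))%:E * wint wI (fun s => J (x0 n j k (tanh r) (tanh s / cosh r)%R)).
Proof.
move=> r0; pose xx s := x0 n j k (tanh r) (tanh s / cosh r)%R.
have mxx d (T : measurableType d) (s : T -> R) : measurable_fun setT s -> mmx (fun t => xx (s t)).
  move=> ms; apply: mmx_x0; first exact: measurable_cst.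
  by apply: measurable_funM => //; exact: (measurableT_comp (@measurable_tanh R) ms).
have mwI := @measurable_wI R j k; have wI0 := @wI_ge0 R j k.
pose G (a : 'M[R]_n) (b : 'M[R]_k) s :=
  Fe j f0 (a *m emb n (n - k) b)%R (xx s) * Fe k phi0 a (tanh r *: e (n - k))%R.
have G0 a b s : 0 <= G a b s by apply: mule_ge0; [exact: f00|exact: phi00].
have mG d (T : measurableType d) (a : T -> 'M[R]_n) (b : T -> 'M[R]_k) (s : T -> R) :
    mmx a -> mmx b -> measurable_fun setT s ->
    measurable_fun setT (fun t => G (a t) (b t) (s t)).
  move=> ma mb ms; apply: emeasurable_funM.
    by apply: measurable_Fe => //; [apply: mmxM => //; exact: mmx_emb|exact: mxx].
  by apply: measurable_Fe => //; exact: mmx_cst.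
have XE a : X r a = (sigma (k - j - 1))%:E * wint wI (fun s => \int[haar k]_b G a b s).
  rewrite /X -muleA; congr (_ * _); rewrite muleC -wintZ//; last 3 first.
  - exact: phi00.
  - pose H (p : measurableTypeR R * bmx R k k) := Fe j f0 (a *m emb n (n - k) p.2)%R (xx p.1).
    apply: (@measurable_fun_fubini_tonelli_F _ _ _ _ R (haar k) H); last by move=> p; exact: f00.
    apply: measurable_Fe => //; last by apply: mxx; exact: measurable_fst.
    apply: mmxM; [exact: mmx_cst|apply: mmx_emb].
    by apply: mmx_of_measurable; exact: measurable_snd.
  - by move=> s; apply: integral_ge0 => b _; exact: f00.
  apply: eq_wint => s s0; congr (_ * _); rewrite -ge0_integralZl//.
  - by apply: eq_integral => b _; rewrite muleC.
  - exact: measurable_Fe_emb.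
  - by move=> b _; exact: f00.
  - exact: phi00.
pose H (p : bmx R n n * measurableTypeR R) := \int[haar k]_b G p.1 b p.2.
have mH : measurable_fun setT H.
  pose H' (p : (bmx R n n * measurableTypeR R) * bmx R k k) := G p.1.1 p.2 p.1.2.
  apply: (@measurable_fun_fubini_tonelli_F _ _ _ _ R (haar k) H'); last by move=> p; exact: G0.
  apply: mG.
  - by apply: mmx_of_measurable; exact: (measurableT_comp measurable_fst measurable_fst).
  - by apply: mmx_of_measurable; exact: measurable_snd.
  - exact: (measurableT_comp measurable_snd measurable_fst).
have H0 p : 0 <= H p by exact: integral_ge0.
have mX : measurable_fun setT (X r : bmx R n n -> \bar R).
  rewrite (funext XE); apply: measurable_funeM.
  exact: (measurable_wint mwI wI0 (h := H) mH H0).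
have X0 a : 0 <= X r a.
  rewrite XE; apply: mule_ge0; first by rewrite lee_fin sigma_ge0.
  by apply: (wint_ge0 wI0) => s; exact: integral_ge0.
rewrite (haar_rotations (haarP n) mX X0).
have [D [oD dD DE]] := reflect_emb.
have oDE := emb_orthogonal skn oD.
(* The integrand is unchanged when a is multiplied by emb D: the factor phi because emb D preserves
   R^k and fixes e_(n-k), the factor f because D is absorbed by the integral over b. *)
rewrite (haarO_haar n0 (haarP n) oDE _ mX X0); last 2 first.
- by rewrite (det_emb skn).
- move=> a; rewrite (XE (a *m _)%R) (XE a); apply: mule_congr; apply: eq_wint => s s0; apply: mule_congr.
  rewrite -(haar_mull_orthogonal (haarP k) oD (h := fun b => G a b s)).
  + apply: eq_integral => b _; rewrite /G -(emb_mul skn) mulmxA; congr (_ * _).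
    by rewrite (Fe_mulr _ _ _ (DE k)) -scalemxAr emb_e.
  + by apply: mG; [exact: mmx_cst|exact: mmx_id|exact: measurable_cst].
  + by move=> b; exact: G0.
  + move=> k1; have [C [oC dC CE Cx]] := reflect_x0 R hn hjk hkn k1.
    exists C; split; [exact: oC|exact: dC|move=> b].
    by rewrite /G -(emb_mul skn) mulmxA (Fe_mulr _ _ _ CE) Cx.
transitivity (\int[hO]_a ((sigma (k - j - 1))%:E * wint wI (fun s => \int[haar k]_b G a b s))).
  by apply: eq_integral => a _; rewrite XE.
rewrite ge0_integralZl//; last 3 first.
- exact: (measurable_wint mwI wI0 (h := H) mH H0).
- by move=> a _; apply: (wint_ge0 wI0) => s; exact: (H0 (a, s)).
- by rewrite lee_fin sigma_ge0.
congr (_ * _).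
transitivity (wint wI (fun s => \int[hO]_a H (a, s))).
  exact: (wint_integral mwI wI0 mH H0 hO).
apply: eq_wint => s s0; congr (_ * _).
pose H2 (p : bmx R n n * bmx R k k) := G p.1 p.2 s.
have mH2 : measurable_fun setT H2.
  apply: mG; last exact: measurable_cst.
    by apply: mmx_of_measurable; exact: measurable_fst.
  by apply: mmx_of_measurable; exact: measurable_snd.
have H20 p : 0 <= H2 p by exact: G0.
transitivity (\int[haar k]_b \int[hO]_a H2 (a, b)).
  exact: (fubini_tonelli H2 mH2 H20).
have mG2 : measurable_fun setT (fun b => \int[hO]_a H2 (a, b)).
  exact: (measurable_fun_fubini_tonelli_G H2 mH2 H20).
rewrite -(haar_rotations (haarP k) mG2) => [|b]; last exact: integral_ge0.
have mrk := @measurable_rotations R k.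
rewrite -[RHS](prob_integral_cst mrk (haarP k).1 (J_ge0 _)).
apply: eq_integral => b; rewrite inE => -[ob _].
pose h (a : bmx R n n) := Fe j f0 a (xx s) * Fe k phi0 a (qE *m xx s)%R.
have mh : measurable_fun setT h by apply: mJ; [exact: mmx_id|exact: mmx_cst|exact: mmx_cst].
rewrite /J -[RHS](haarO_mulr n0 (haarP n) (emb_orthogonal skn ob) mh) => [|a]; last exact: J0'.
apply: eq_integral => a _; rewrite /H2 /G /h/=; congr (_ * _).
by rewrite (Fe_mulr _ _ _ (emb_pEk ob)) /xx qE_x0 -scalemxAr emb_e.
Qed.

(** What remains of the right-hand integrand once a is averaged out: the weight of [opP] at the
    projected point, times [J]. *)
Definition K (z : 'cV[R]_n) : \bar R := (Vw j (qE *m z)%R)%:E * J z.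

Lemma K_ge0 z : 0 <= K z.
Proof. by rewrite mule_ge0 ?J_ge0// lee_fin powR_ge0. Qed.

Lemma measurable_K d (T : measurableType d) (x : T -> 'cV[R]_n) : mmx x ->
  measurable_fun setT (fun t => K (x t)).
Proof.
move=> mx; apply: emeasurable_funM; last exact: measurable_J.
by apply/measurable_EFinP; apply: measurable_Vw; apply: mmxM => //; exact: mmx_cst.
Qed.

(** The product of f and of the dual transform of phi at the j-dimensional geodesic with frame a, as
    computed by [RHstar_Ge]. *)
Definition Y (s : R) (a : 'M[R]_n) : \bar R :=
  Fe j f0 a (tanh s *: e m)%R * ((cosh s ^ (k%:Z - n%:Z)%R)%:E * \int[haar m]_g
    (let x := (qE *m (emb0 g)^T *m (tanh s *: e m))%R in
     (Vw j x)%:E * Fe k phi0 (a *m emb0 g)%R x)).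

Lemma cosh_exprz (s : R) : (cosh s ^ (k%:Z - n%:Z) = (cosh s)^-1 ^+ (n - k))%R.
Proof. by rewrite -opprB subzn ?(ltnW hkn)// -exprz_inv. Qed.

Let hm : (0 + m <= n)%N. Proof. lia. Qed.

(** For fixed g, replacing a by a times the inverse of emb g removes g from the frame in phi and
    moves it to the foot point in f; both factors then share the frame a, as in [J]. *)
Lemma integral_Y (s : R) :
  \int[haar n]_(a in rotations n) Y s a =
  (cosh s ^ (k%:Z - n%:Z)%R)%:E * \int[haar m]_g K (I *m (g *m (tanh s *: e m)))%R.
Proof.
set c := (cosh s ^ (k%:Z - n%:Z)%R)%:E; pose y : 'cV[R]_n := (tanh s *: e m)%R; set ym := (tanh s *: e m)%R.
have c0 : 0 <= c by rewrite lee_fin cosh_exprz exprn_ge0// invr_ge0 ltW// cosh_gt0.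
pose x' (g : 'M[R]_m) := (qE *m (emb0 g)^T *m y)%R.
pose G (a : 'M[R]_n) (g : 'M[R]_m) :=
  Fe j f0 a y * ((Vw j (x' g))%:E * Fe k phi0 (a *m emb0 g)%R (x' g)).
have G0 a g : 0 <= G a g.
  apply: mule_ge0; first exact: f00.
  by apply: mule_ge0; [rewrite lee_fin powR_ge0|exact: phi00].
have mx' d (T : measurableType d) (g : T -> 'M[R]_m) : mmx g -> mmx (fun t => x' (g t)).
  move=> mg; apply: mmxM; last exact: mmx_cst.
  by apply: mmxM; [exact: mmx_cst|apply: mmxT; exact: mmx_emb].
have mG2 d (T : measurableType d) (a : T -> 'M[R]_n) (g : T -> 'M[R]_m) : mmx a -> mmx g ->
    measurable_fun setT (fun t => (Vw j (x' (g t)))%:E * Fe k phi0 (a t *m emb0 (g t))%R (x' (g t))).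
  move=> ma mg; apply: emeasurable_funM.
    by apply/measurable_EFinP; apply: measurable_Vw; exact: mx'.
  by apply: measurable_Fe => //; [apply: mmxM => //; exact: mmx_emb|exact: mx'].
have mG d (T : measurableType d) (a : T -> 'M[R]_n) (g : T -> 'M[R]_m) : mmx a -> mmx g ->
    measurable_fun setT (fun t => G (a t) (g t)).
  move=> ma mg; apply: emeasurable_funM; last exact: mG2.
  by apply: measurable_Fe => //; exact: mmx_cst.
have YE a : Y s a = c * \int[haar m]_g G a g.
  rewrite /Y muleCA; apply: mule_congr; rewrite -ge0_integralZl//.
  - by apply: mG2; [exact: mmx_cst|exact: mmx_id].
  - by move=> g _; apply: mule_ge0; [rewrite lee_fin powR_ge0|exact: phi00].
  - exact: f00.
have mp1 : @mmx R _ (bmx R n n * bmx R m m)%type _ _ fst.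
  by apply: mmx_of_measurable; exact: measurable_fst.
have mp2 : @mmx R _ (bmx R n n * bmx R m m)%type _ _ snd.
  by apply: mmx_of_measurable; exact: measurable_snd.
pose H (p : bmx R n n * bmx R m m) := G p.1 p.2.
have mH : measurable_fun setT H by exact: mG.
have H0 p : 0 <= H p by exact: G0.
have mI : measurable_fun setT (fun a : bmx R n n => \int[haar m]_g G a g).
  exact: (measurable_fun_fubini_tonelli_F H mH H0).
have I0 a : 0 <= \int[haar m]_g G a g by exact: integral_ge0.
have mY : measurable_fun setT (Y s : bmx R n n -> \bar R).
  by rewrite (funext YE); exact: measurable_funeM.
have Y0 a : 0 <= Y s a by rewrite YE mule_ge0.
rewrite (haar_rotations (haarP n) mY Y0).
(* The reflection in e_1 preserves R^j and R^k, and it fixes e_m because m >= 2. *)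
pose D : 'M[R]_n := hh (e 1); pose D' : 'M[R]_m := hh (e 1).
have h1' : (0 < 1 <= m)%N by lia.
have DD' : emb0 D' = D by rewrite /D' emb_hh.
have oD : (D^T *m D = 1%:M)%R by exact: hh_orthogonal.
have oD' : (D'^T *m D' = 1%:M)%R by exact: hh_orthogonal.
have dD : \det D = (-1)%R by rewrite det_hh ?e_neq0.
have dD' : \det D' = (-1)%R by rewrite det_hh ?e_neq0.
have DE d : (D *m pE R n d *m D^T = pE R n d)%R by exact: hh_e_conj.
have Dy : (D *m y = y)%R by rewrite -scalemxAr hh_e//; lia.
have Dt : D^T = D by exact: hh_tr.
rewrite (haarO_haar n0 (haarP n) oD dD mY Y0); last first.
  move=> a; rewrite (YE (a *m _)%R) (YE a); apply: mule_congr.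
  have mGa : measurable_fun setT (fun g : bmx R m m => G a g).
    by apply: mG; [exact: mmx_cst|exact: mmx_id].
  rewrite -(haar_mull_orthogonal (haarP m) oD' mGa (G0 a)); last first.
    move=> _; exists D'; split; [exact: oD'|exact: dD'|move=> g].
    have xD : x' (g *m D')%R = (D *m x' g)%R.
      by rewrite /x' -(emb_mul hm) trmx_mul DD' Dt !mulmxA -(qE_comm oD (DE k)).
    rewrite /G xD /Vw (dot_orthogonal _ _ oD) -(emb_mul hm) DD' mulmxA (Fe_mulr _ _ _ (DE k)).
    by rewrite mulmxA -{1}Dt oD mul1mx.
  apply: eq_integral => g _; rewrite /G.
  have -> : x' (D' *m g)%R = x' g.
    by rewrite /x' -(emb_mul hm) trmx_mul DD' Dt -!mulmxA Dy.
  by rewrite (Fe_mulr _ _ _ (DE j)) Dy -(emb_mul hm) DD' mulmxA.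
transitivity (\int[hO]_a (c * \int[haar m]_g G a g)).
  by apply: eq_integral => a _; rewrite YE.
rewrite ge0_integralZl//; apply: mule_congr.
transitivity (\int[haar m]_g \int[hO]_a H (a, g)).
  exact: (fubini_tonelli H mH H0).
pose h (g : bmx R m m) := K (I *m (g *m ym))%R.
have mh : measurable_fun setT h.
  apply: measurable_K; apply: mmxM; first exact: mmx_cst.
  by apply: mmxM; [exact: mmx_id|exact: mmx_cst].
(* The foot point involves the transpose of g, while polar coordinates use g itself. *)
rewrite -[RHS](haar_tr (haarP m) mh) => [|g]; last exact: K_ge0.
apply: (eq_haar (haarP m)).
- exact: (measurable_fun_fubini_tonelli_G H mH H0).
- by move=> g; exact: integral_ge0.
- apply: (measurableT_comp mh); apply: mmx_measurable; apply: mmxT; exact: mmx_id.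
- by move=> g; exact: K_ge0.
move=> g [og _]; have oE := emb_orthogonal hm og; have oE' := ortho_tr oE.
have hmm : (0 < m <= m)%N by lia.
have zE : (I *m (g^T *m ym) = (emb0 g)^T *m y)%R.
  have ye : y = (I *m ym)%R by rewrite -scalemxAr sel_e// add0n.
  by rewrite [in RHS]ye emb_tr [in RHS]mulmxA (emb_sel hm) mulmxA.
rewrite /h zE /K mulmxA.
pose h2 (a : bmx R n n) := Fe j f0 a ((emb0 g)^T *m y)%R * Fe k phi0 a (x' g).
have mh2 : measurable_fun setT h2 by apply: mJ; [exact: mmx_id|exact: mmx_cst|exact: mmx_cst].
have JE : J ((emb0 g)^T *m y)%R = \int[hO]_a h2 a.
  by apply: eq_integral => a _; rewrite /h2 /x' mulmxA.
pose v := (Vw j (x' g))%:E; have v0 : 0 <= v by rewrite lee_fin powR_ge0.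
have mh3 : measurable_fun setT (fun a => v * h2 a) by exact: measurable_funeM.
transitivity (\int[hO]_a (v * h2 a)); last first.
  by rewrite JE (ge0_integralZl hO measurableT mh2 (fun a _ => J0' a _ _) v0).
rewrite -[RHS](haarO_mulr n0 (haarP n) oE mh3) => [|a]; last first.
  by apply: mule_ge0; [exact: v0|exact: J0'].
have gE := emb0_pE_conj hn hjk hkn g.
apply: eq_integral => a _; rewrite /H /G /h2/= (Fe_mulr _ _ _ gE).
by rewrite (mulmxA (emb0 g)) oE' mul1mx muleCA.
Qed.

End Duality.

(** * The two sides in coordinates *)

Section Sides.
Context (R : realType) (n j k : nat).
Hypotheses (hn : (1 < n)%N) (hjk : (j < k)%N) (hkn : (k < n)%N).
Variable haar : forall m, probability (@borel_mx R m) R.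
Hypothesis haarP : forall m, is_haar (rotations m) (haar m).
Variable nu : {vspace 'cV[R]_n} -> probability (borel_vspace R n) R.
Hypothesis nuP : forall xi, \dim xi = j -> is_fiber_measure k xi (nu xi).
Variable dj : {measure set (borel_geod R n j) -> \bar R}.
Hypothesis djP : is_geod_measure haar dj.
Variable dk : {measure set (borel_geod R n k) -> \bar R}.
Hypothesis dkP : is_geod_measure haar dk.
Local Notation M1 := (bmx R (n + 1) (n + 1)).
Local Notation m := (n - j)%N.
Local Notation emb0 := (@emb R n m 0).
Variables f phi : set 'cV[R]_(n + 1) -> \bar R.
Variables f0 phi0 : M1 -> \bar R.
Hypotheses (mf0 : measurable_fun setT f0) (mphi0 : measurable_fun setT phi0).
Hypotheses (f00 : forall M, (0 <= f0 M)%E) (phi00 : forall M, (0 <= phi0 M)%E).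
Hypotheses (hf : forall t, GammaH n j t -> f t = f0 (gmx t)).
Hypotheses (hphi : forall t, GammaH n k t -> phi t = phi0 (gmx t)).
Hypotheses (f_ge0 : forall t, (0 <= f t)%E) (phi_ge0 : forall t, (0 <= phi t)%E).
Local Open Scope ereal_scope.

Lemma measurable_RH : measurable_fun (GammaH n k : set (borel_geod R n k))
  (RH haar j k f : borel_geod R n k -> \bar R).
Proof.
have mRHm : measurable_fun setT (RHm j k haar f0) by exact: measurable_RHm.
apply: (measurable_comp_gmx mRHm) => t tG.
exact: (RH_gmx hn hjk hkn haarP mf0 f00 hf).
Qed.

(** The normalization of [dk] runs through the geodesics [Ge k a (tanh r *: e (n - k))], where
    [RH_Ge] computes the transform in the frame a itself; [integral_X] then evaluates the integral
    over a. *)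
Lemma lhs_formula :
  \int[dk]_(z in GammaH n k) (RH haar j k f z * phi z) =
  (sigma (n - k - 1))%:E * wint (fun r : R => sinh r ^+ (n - k - 1) * cosh r ^+ k)%R (fun r =>
    (sigma (k - j - 1))%:E * wint (fun s : R => sinh s ^+ (k - j - 1) * cosh s ^+ j)%R (fun s =>
      J j k haar f0 phi0 (x0 n j k (tanh r) (tanh s / cosh r)%R))).
Proof.
pose psi : borel_geod R n k -> \bar R := fun z => RH haar j k f z * phi z.
have mpsi : measurable_fun (GammaH n k : set (borel_geod R n k)) psi.
  apply: emeasurable_funM; first exact: measurable_RH.
  exact: (measurable_comp_gmx mphi0).
have psi0 t : GammaH n k t -> 0 <= psi t.
  by move=> _; apply: mule_ge0; [exact: RH_ge0|exact: phi_ge0].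
rewrite (dkP.2 psi mpsi psi0); apply: mule_congr.
apply: eq_wint => r r0; apply: mule_congr.
rewrite -(integral_X hn hjk hkn haarP mf0 mphi0 f00 phi00 (ltW r0)).
apply: eq_integral => a; rewrite inE => -[oa _].
rewrite hrot_Hsub//; have Ex : (pE R n k *m (tanh r *: e (n - k)) = 0)%R.
  by rewrite -scalemxAr pE_e0 ?scaler0.
have x1 : (dot (tanh r *: e (n - k) : 'cV[R]_n) (tanh r *: e (n - k)) < 1)%R.
  by rewrite dotZl dotZr dot_e ?mulr1 -?expr2 ?tanh_lt1//; lia.
have [g1 g2] := gmx_Ge (ltnW hkn) oa Ex x1.
by rewrite /psi (RH_Ge hn hjk hkn haarP mf0 f00 hf oa (ltW r0)) hphi// g1.
Qed.

(** The dual transform as a function of the projection matrix, with cosh^(k-n) written as a power of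
    the square root of 1 - |u|^2. *)
Definition RSm (M : M1) : \bar R :=
  (Num.sqrt (1 - enorm (uM M) ^+ 2) ^+ (n - k))%:E * \int[haar m]_g
    (let x := (qE R n k *m (emb0 g)^T *m (enorm (uM M) *: e m))%R in
     (Vw j x)%:E * Fe k phi0 (flag j (PM M) (uM M) *m emb0 g)%R x).

Lemma RHstar_gmx t : GammaH n j t -> RHstar nu j k phi t = RSm (gmx t).
Proof.
have hj : (j < n)%N by lia.
move=> /(GammaH_Ge hj)[P [u [r /= [oA r0 tE gE ur]]]].
rewrite gE tE (RHstar_Ge hn hjk hkn haarP nuP mphi0 phi00 hphi oA r0) /RSm uM_Pm PM_Pm ur.
rewrite (cosh_exprz hkn) tanh2 sqrtrV ?sqr_ge0// sqrtr_sqr ger0_norm// ltW//.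
exact: cosh_gt0.
Qed.

Lemma measurable_RSm : measurable_fun setT RSm.
Proof.
have mM1 : @mmx R _ M1 _ _ id by exact: mmx_id.
apply: emeasurable_funM.
  apply/measurable_EFinP; apply: measurable_funX; apply: measurable_sqrt.
  apply: measurable_funB => //; apply: measurable_funX; apply: measurable_enorm.
  exact: mmx_uM.
pose x' (p : M1 * bmx R m m) := (qE R n k *m (emb0 p.2)^T *m (enorm (uM p.1) *: e m))%R.
pose H (p : M1 * bmx R m m) :=
  (Vw j (x' p))%:E * Fe k phi0 (flag j (PM p.1) (uM p.1) *m emb0 p.2)%R (x' p).
have mp1 : @mmx R _ (M1 * bmx R m m)%type _ _ fst.
  by apply: mmx_of_measurable; exact: measurable_fst.
have mp2 : @mmx R _ (M1 * bmx R m m)%type _ _ snd.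
  by apply: mmx_of_measurable; exact: measurable_snd.
have mu := mmx_uM mp1; have mP := mmx_PM mp1.
have mx' : mmx x'.
  apply: mmxM; last by apply: mmxZ; [exact: measurable_enorm|exact: mmx_cst].
  by apply: mmxM; [exact: mmx_cst|apply: mmxT; exact: mmx_emb].
apply: (@measurable_fun_fubini_tonelli_F _ _ _ _ R (haar m) H).
  apply: emeasurable_funM; first by apply/measurable_EFinP; exact: measurable_Vw.
  by apply: measurable_Fe => //; apply: mmxM; [exact: mmx_flag|exact: mmx_emb].
by move=> p; apply: mule_ge0; [rewrite lee_fin powR_ge0|exact: phi00].
Qed.

Lemma measurable_RHstar : measurable_fun (GammaH n j : set (borel_geod R n j))
  (RHstar nu j k phi : borel_geod R n j -> \bar R).
Proof. exact: (measurable_comp_gmx measurable_RSm RHstar_gmx). Qed.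

Lemma RHstar_ge0 t : GammaH n j t -> 0 <= RHstar nu j k phi t.
Proof.
move=> tG; rewrite RHstar_gmx//; apply: mule_ge0; first by rewrite lee_fin exprn_ge0// sqrtr_ge0.
by apply: integral_ge0 => g _; apply: mule_ge0; [rewrite lee_fin powR_ge0|exact: phi00].
Qed.

Lemma rhs_formula :
  \int[dj]_(t in GammaH n j) (f t * RHstar nu j k phi t) =
  (sigma (n - j - 1))%:E * wint (fun s : R => sinh s ^+ (n - j - 1) * cosh s ^+ j)%R (fun s =>
    (cosh s ^ (k%:Z - n%:Z)%R)%:E *
      \int[haar m]_g K j k haar f0 phi0 (sel R n m 0 *m (g *m (tanh s *: e m)))%R).
Proof.
have hj : (j < n)%N by lia.
pose psi : borel_geod R n j -> \bar R := fun t => f t * RHstar nu j k phi t.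
have mpsi : measurable_fun (GammaH n j : set (borel_geod R n j)) psi.
  apply: emeasurable_funM; last exact: measurable_RHstar.
  exact: (measurable_comp_gmx mf0).
have psi0 t : GammaH n j t -> 0 <= psi t.
  by move=> tG; apply: mule_ge0; [exact: f_ge0|exact: RHstar_ge0].
rewrite (djP.2 psi mpsi psi0); apply: mule_congr.
apply: eq_wint => s s0; apply: mule_congr.
rewrite -(integral_Y hn hjk hkn haarP mf0 mphi0 f00 phi00).
apply: eq_integral => a; rewrite inE => -[oa _].
rewrite hrot_Hsub//; have Ex : (pE R n j *m (tanh s *: e (n - j)) = 0)%R.
  by rewrite -scalemxAr pE_e0 ?scaler0.
have x1 : (dot (tanh s *: e (n - j) : 'cV[R]_n) (tanh s *: e (n - j)) < 1)%R.
  by rewrite dotZl dotZr dot_e ?mulr1 -?expr2 ?tanh_lt1//; lia.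
have [g1 g2] := gmx_Ge (ltnW hj) oa Ex x1.
by rewrite /psi (RHstar_Ge hn hjk hkn haarP nuP mphi0 phi00 hphi oa (ltW s0)) hf// g1.
Qed.

End Sides.

(** * The integral identity *)

Section HyperbolicSubstitution.
Context (R : realType).
Local Notation mu := (@lebesgue_measure R).

Lemma is_derive_sinh (s : R) : is_derive s 1 (@sinh R) (cosh s).
Proof.
have hN : is_derive s 1 (-%R : R -> R) (- 1) by apply: is_deriveN.
have h2 : is_derive s 1 (@expR R \o -%R) (expR (- s) * - 1).
  exact: (is_derive1_comp (is_derive_expR _) hN).
have h3 : is_derive s 1 (2^-1 \*: (@expR R - (expR \o -%R))) (2^-1 *: (expR s - (expR (- s) * - 1))).
  by apply: is_deriveZ; apply: is_deriveB.
rewrite (_ : @sinh R = 2^-1 \*: (@expR R - (expR \o -%R))); last first.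
  by apply/funext => x; rewrite /sinh/= mulrC.
by apply: (is_derive_eq h3); rewrite /cosh mulrN1 opprK -[_ *: _]/(_ * _) mulrC.
Qed.

Lemma is_derive_cosh (s : R) : is_derive s 1 (@cosh R) (sinh s).
Proof.
have hN : is_derive s 1 (-%R : R -> R) (- 1) by apply: is_deriveN.
have h2 : is_derive s 1 (@expR R \o -%R) (expR (- s) * - 1).
  exact: (is_derive1_comp (is_derive_expR _) hN).
have h3 : is_derive s 1 (2^-1 \*: (@expR R + (expR \o -%R))) (2^-1 *: (expR s + (expR (- s) * - 1))).
  by apply: is_deriveZ; apply: is_deriveD.
rewrite (_ : @cosh R = 2^-1 \*: (@expR R + (expR \o -%R))); last first.
  by apply/funext => x; rewrite /cosh/= mulrC.
by apply: (is_derive_eq h3); rewrite /sinh mulrN1 -[_ *: _]/(_ * _) mulrC.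
Qed.

Lemma is_derive_tanh (s : R) : is_derive s 1 (@tanh R) (cosh s ^+ 2)^-1.
Proof.
have hV : is_derive s 1 (fun x : R => (cosh x)^-1) (- (cosh s) ^- 2 *: sinh s).
  by apply: is_deriveV; [exact: cosh_neq0|exact: is_derive_cosh].
have hM : is_derive s 1 (@sinh R * (fun x : R => (cosh x)^-1)) _ :=
  is_deriveM (is_derive_sinh s) hV.
apply: (is_derive_eq hM); rewrite /= -![_ *: _]/(_ * _).
have := cosh2 s; have := cosh_neq0 s; move: (cosh s) (sinh s) => c t c0 E.
have -> : t * (- c ^- 2 * t) + c^-1 * c = (c ^+ 2 - t ^+ 2) * (c ^+ 2)^-1.
  by field.
by rewrite E addrK mul1r.
Qed.

Lemma continuous_cosh (s : R) : {for s, continuous (@cosh R)}.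
Proof.
apply: differentiable_continuous; apply/derivable1_diffP.
exact: (@ex_derive _ _ _ _ _ _ _ (is_derive_cosh s)).
Qed.

Local Open Scope ereal_scope.

(** The map s -> c tanh s takes ]0, +oo[ onto ]0, c[, and h vanishes on the rest of the
    half-line. *)
Lemma tanh_substitution (c : R) (h : R -> \bar R) : (0 < c)%R ->
  measurable_fun setT h -> (forall x, 0 <= h x) -> (forall t, (c <= t)%R -> h t = 0) ->
  \int[mu]_(t in `]0%R, +oo[) h t =
  wint (fun s : R => c / cosh s ^+ 2)%R (fun s => h (c * tanh s)%R).
Proof.
move=> c0 mh h0 hc0.
have hd (s : R) : (0 < s)%R -> is_derive s 1%R (fun s => c * tanh s)%R (c / cosh s ^+ 2)%R.
  by move=> _; apply: is_deriveZ; exact: is_derive_tanh.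
have hc (s : R) : (0 < s)%R -> {for s, continuous (fun s : R => c / cosh s ^+ 2)%R}.
  move=> _; apply: cvgM; first exact: cvg_cst.
  apply: cvgV; first by rewrite expf_eq0 cosh_neq0.
  by apply: (@continuous_comp _ _ _ (@cosh R) (fun x => x ^+ 2)%R);
    [exact: continuous_cosh|exact: exprn_continuous].
have hp (s : R) : (0 < s)%R -> (0 < c / cosh s ^+ 2)%R.
  by move=> _; rewrite divr_gt0// exprn_gt0// cosh_gt0.
rewrite /wint (@ge0_change_of_variable R _ _ hd hc hp h mh h0).
have im (t : R) : (0 < t)%R -> (t < c)%R -> ((fun s => c * tanh s)%R @` `]0%R, +oo[) t.
  move=> t0 tc; have q0 : (0 <= t / c)%R by rewrite divr_ge0// ltW.
  have q1 : (t / c < 1)%R by rewrite ltr_pdivrMr// mul1r.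
  have [s s0 sE] := tanh_surj q0 q1; exists s; last by rewrite sE mulrC divfK// gt_eqF.
  rewrite /= in_itv/= andbT lt0r s0 andbT; apply/eqP => s00.
  move: sE; rewrite s00 /tanh /sinh oppr0 subrr !mul0r => /esym/eqP.
  by rewrite mulf_eq0 invr_eq0 !gt_eqF.
rewrite integral_mkcond [RHS]integral_mkcond; apply: eq_integral => t _; rewrite !patchE.
case: ifPn => [|t0]; case: ifPn => //.
- rewrite notin_setE => ti; rewrite inE/= in_itv/= andbT => t0.
  have [tc|/hc0//] := ltP t c.
  by case: ti; exact: im.
- rewrite inE/= => -[s]; rewrite in_itv/= andbT => s0 st; move: t0; rewrite notin_setE/=.
  case; rewrite in_itv/= andbT -st mulr_gt0// divr_gt0 ?sinh_gt0//.
  exact: cosh_gt0.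
Qed.

End HyperbolicSubstitution.

(** * Orthogonal blocks of coordinates and polar coordinates *)

Section Blocks.
Context (R : realType).
Implicit Types n p q s d k : nat.

Lemma pE_sel n k s d : (n - d <= s)%N -> pE R n d *m sel R n k s = sel R n k s.
Proof.
move=> h; apply/matrixP => i l; rewrite pE_mul !mxE; case: eqP => [->|]; last by rewrite mulr0.
by rewrite (leq_trans h) ?leq_addr// mul1r.
Qed.

Lemma pE_sel0 n k s d : (s + k <= n - d)%N -> pE R n d *m sel R n k s = 0.
Proof.
move=> h; apply/matrixP => i l; rewrite pE_mul !mxE; case: eqP => [->|]; last by rewrite mulr0.
have -> : (n - d <= s + l)%N = false by have := ltn_ord l; lia.
by rewrite mul0r.
Qed.

Lemma emb_pE_conj n k s d (A : 'M[R]_k) : (s + k <= n)%N -> A^T *m A = 1%:M ->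
  (s + k <= n - d)%N || (n - d <= s)%N ->
  emb n s A *m pE R n d *m (emb n s A)^T = pE R n d.
Proof.
move=> skn oA h; have oE := ortho_tr (emb_orthogonal skn oA).
suff E : emb n s A *m pE R n d = pE R n d *m emb n s A.
  by rewrite E -mulmxA oE mulmx1.
rewrite /emb mulmxDl mulmxDr mul1mx mulmx1; congr (_ + _).
have [h1|h2] := orP h.
  have z := pE_sel0 h1.
  have zt : (sel R n k s)^T *m pE R n d = 0 by rewrite -[LHS]trmxK trmx_mul pE_tr trmxK z trmx0.
  by rewrite -mulmxA zt mulmx0 !mulmxA z !mul0mx.
have z := pE_sel k h2.
have zt : (sel R n k s)^T *m pE R n d = (sel R n k s)^T.
  by rewrite -[LHS]trmxK trmx_mul pE_tr trmxK z.
by rewrite -mulmxA zt !mulmxA z.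
Qed.

Lemma sel_col_mx n p q (x : 'cV[R]_p) (y : 'cV[R]_q) :
  sel R n (p + q) 0 *m col_mx x y = sel R n p 0 *m x + sel R n q p *m y.
Proof.
rewrite -mul_row_col; congr (_ *m _); apply/matrixP => i l; rewrite !mxE.
by case: fintype.splitP => l' E; rewrite !mxE E; congr (nat_of_bool _)%:R; apply/eqP/eqP; lia.
Qed.

(** The case d = 0 of [flagP]: the subspace is 0, and e_n is sent to the direction of x. *)
Lemma rotate_to n (x : 'cV[R]_n) : (0 < n)%N ->
  exists2 A : 'M[R]_n, A^T *m A = 1%:M & A *m (enorm x *: e n) = x.
Proof.
move=> n0; have i0 : isproj 0 (0 : 'M[R]_n) by split; rewrite ?trmx0 ?mul0mx ?mxtrace0.
have [oA _ Ax] := flagP (u := x) n0 i0 (mul0mx _ _).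
by exists (flag 0 0 x) => //; rewrite -scalemxAr; move: Ax; rewrite subn0.
Qed.

End Blocks.

Section Polar.
Context (R : realType).
Local Open Scope ereal_scope.

(** The integral is averaged over rotations g of the variable. For fixed x, a rotation C takes |x|
    e_m to x and is absorbed on the right of g, which leaves a function of |x|, treated by
    [lint_radial]. The reflection in e_1 that corrects a determinant -1 fixes e_m because m > 1. *)
Lemma lint_polar m (mu : probability (bmx R m m) R) (h : bmx R m 1 -> \bar R) :
  (1 < m)%N -> is_haar (rotations m) mu -> measurable_fun setT h -> (forall x, 0 <= h x) ->
  lint h = (sigma (m - 1))%:E * rint (m - 1) (fun t => \int[mu]_g h (g *m (t *: e m))%R).
Proof.
case: m mu h => [//|m] mu h m1 muP mh h0; rewrite subn1/=.
have mrot := @measurable_rotations R m.+1.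
have I0 : 0 <= lint h by exact: lint_ge0.
pose H (p : bmx R m.+1 m.+1 * bmx R m.+1 1) := h (p.1 *m p.2)%R.
have mH : measurable_fun setT H.
  apply: (measurableT_comp mh); apply: mmx_measurable; apply: mmxM.
    by apply: mmx_of_measurable; exact: measurable_fst.
  by apply: mmx_of_measurable; exact: measurable_snd.
have H0 p : 0 <= H p by exact: h0.
have mL : measurable_fun setT (fun g : bmx R m.+1 m.+1 => lint (fun x => H (g, x))).
  exact: measurable_lint.
pose ht (t : R) : \bar R := \int[mu]_g h (g *m (t *: e m.+1))%R.
have mht : measurable_fun setT ht.
  pose H' (p : measurableTypeR R * bmx R m.+1 m.+1) := h (p.2 *m ((p.1 : R) *: e m.+1))%R.
  apply: (@measurable_fun_fubini_tonelli_F _ _ _ _ R mu H'); last by move=> p; exact: h0.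
  apply: (measurableT_comp mh); apply: mmx_measurable; apply: mmxM.
    by apply: mmx_of_measurable; exact: measurable_snd.
  by apply: mmxZ; [exact: measurable_fst|exact: mmx_cst].
have ht0 t : 0 <= ht t by apply: integral_ge0 => g _; exact: h0.
rewrite -(lint_radial m mht ht0).
rewrite -[LHS](prob_integral_cst mrot muP.1 I0).
transitivity (\int[mu]_(g in rotations m.+1) lint (fun x => H (g, x))).
  by apply: eq_integral => g; rewrite inE => -[og _]; rewrite -(lint_orthogonal og mh h0).
rewrite (haar_rotations muP mL) => [|g]; last exact: lint_ge0.
rewrite -(lint_integral mu mH H0); apply: eq_lint => x.
have [A oA Ax] := rotate_to x (ltn0Sn m).
have dD : \det (hh (e 1 : 'cV[R]_m.+1)) = (-1)%R by rewrite det_hh// e_neq0.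
have [C rC CA] := to_rotation oA (hh_orthogonal (e 1)) dD.
have Cx : (C *m (enorm x *: e m.+1) = x)%R.
  case: CA => -> //; rewrite -[RHS]Ax -!scalemxAr -mulmxA hh_e//; lia.
have mhx : measurable_fun setT (fun g : bmx R m.+1 m.+1 => h (g *m (enorm x *: e m.+1))%R).
  apply: (measurableT_comp mh); apply: mmx_measurable.
  by apply: mmxM; [exact: mmx_id|exact: mmx_cst].
rewrite /ht -[RHS](haar_mulr muP rC mhx) => [|g]; last exact: h0.
by apply: eq_integral => g _; rewrite /H/= -mulmxA Cx.
Qed.

End Polar.

(** * The identity for a function with the symmetries of [J] *)

Section Identity.
Context (R : realType) (n j k : nat).
Hypotheses (hn : (1 < n)%N) (hjk : (j < k)%N) (hkn : (k < n)%N).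
Local Notation m := (n - j)%N.
Local Notation p := (n - k)%N.
Local Notation q := (k - j)%N.
Variable mum : probability (bmx R m m) R.
Hypothesis mumP : is_haar (rotations m) mum.
Variable j0 : bmx R n 1 -> \bar R.
Hypotheses (mj0 : measurable_fun setT j0) (j00 : forall x, (0 <= j0 x)%E).
Hypothesis j0_inv : forall (A : 'M[R]_n) x, A^T *m A = 1%:M ->
  A *m pE R n j *m A^T = pE R n j -> A *m pE R n k *m A^T = pE R n k -> j0 (A *m x) = j0 x.
Local Open Scope ereal_scope.

(* With d = |x|^2: the density of the measure on geodesics in the Klein model times
   the factor cosh^(k-n) of [opQ]. *)
Definition Uw (d : R) : R := if (d < 1)%R then ((1 - d) `^ (- (k.+1%:R / 2)))%R else 0%R.

Lemma Uw_ge0 d : (0 <= Uw d)%R. Proof. by rewrite /Uw; case: ifP => // _; exact: powR_ge0. Qed.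

Lemma measurable_Uw : measurable_fun setT Uw.
Proof.
apply: measurable_fun_ifT; last exact: measurable_cst.
  exact: measurable_fun_ltr.
apply: (@measurableT_comp _ _ _ _ _ _ (fun y : R => (y `^ (- (k.+1%:R / 2)))%R)).
  exact: measurable_powR.
exact: measurable_funB.
Qed.

Lemma powR_inv2 (x : R) N : (0 < x)%R -> (((x ^+ 2)^-1) `^ (- (N%:R / 2)) = x ^+ N)%R.
Proof.
move=> x0; rewrite -powR_inv1 ?sqr_ge0// -powRrM mulrN mulN1r opprK.
rewrite -[X in (X `^ _)%R]powR_mulrn ?(ltW x0)// -powRrM mulrC divfK//.
by rewrite powR_mulrn// ltW.
Qed.

Lemma Uw_cosh (s : R) (d : R) : (1 - d = (cosh s ^+ 2)^-1)%R -> Uw d = (cosh s ^+ k.+1)%R.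
Proof.
move=> E; have d1 : (d < 1)%R by rewrite -subr_gt0 E invr_gt0 exprn_gt0// cosh_gt0.
by rewrite /Uw d1 E powR_inv2// cosh_gt0.
Qed.

Let K0 (z : 'cV[R]_n) : \bar R := (Vw j (qE R n k *m z)%R)%:E * j0 z.

Let FF (z : 'cV[R]_n) : \bar R := (Uw (dot z z))%:E * K0 z.

Let mj d (T : measurableType d) (x : T -> 'cV[R]_n) : mmx x ->
  measurable_fun setT (fun t => j0 (x t)).
Proof. by move=> mx; apply: (measurableT_comp mj0); exact: mmx_measurable. Qed.

Let mK0 d (T : measurableType d) (x : T -> 'cV[R]_n) : mmx x ->
  measurable_fun setT (fun t => K0 (x t)).
Proof.
move=> mx; apply: emeasurable_funM; last exact: mj.
by apply/measurable_EFinP; apply: measurable_Vw; apply: mmxM => //; exact: mmx_cst.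
Qed.

Let K00 z : 0 <= K0 z.
Proof. by apply: mule_ge0; [rewrite lee_fin powR_ge0|exact: j00]. Qed.

Let mFF d (T : measurableType d) (x : T -> 'cV[R]_n) : mmx x ->
  measurable_fun setT (fun t => FF (x t)).
Proof.
move=> mx; apply: emeasurable_funM; last exact: mK0.
apply/measurable_EFinP; apply: (measurableT_comp measurable_Uw).
exact: measurable_dot.
Qed.

Let FF0 z : 0 <= FF z.
Proof. by apply: mule_ge0; [rewrite lee_fin Uw_ge0|exact: K00]. Qed.

Lemma FF_invariant (A : 'M[R]_n) x : (A^T *m A = 1%:M)%R ->
  (A *m pE R n j *m A^T = pE R n j)%R -> (A *m pE R n k *m A^T = pE R n k)%R ->
  FF (A *m x)%R = FF x.
Proof.
move=> oA Aj Ak; rewrite /FF /K0 (dot_orthogonal _ _ oA) (j0_inv x oA Aj Ak).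
rewrite (mulmxA (qE R n k)) -(qE_comm oA Ak) -mulmxA /Vw (dot_orthogonal _ _ oA).
reflexivity.
Qed.

(** Polar coordinates on R^m followed by t = tanh s. The powers of cosh s agree: those of [Uw], of
    the derivative and of tanh^(m-1) add up to (k + 1) - 2 - (m - 1) = j + k - n. *)
Lemma rhs_lint :
  (sigma (n - j - 1))%:E * wint (fun s : R => sinh s ^+ (n - j - 1) * cosh s ^+ j)%R (fun s =>
    (cosh s ^ (k%:Z - n%:Z)%R)%:E *
      \int[mum]_g K0 (sel R n m 0 *m (g *m (tanh s *: e m)))%R) =
  lint (fun x : 'cV[R]_m => FF (sel R n m 0 *m x)%R).
Proof.
have m1 : (1 < m)%N by lia.
have skm : (0 + m <= n)%N by lia.
have mlin : measurable_fun setT (fun x : bmx R m 1 => FF (sel R n m 0 *m x)%R).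
  by apply: mFF; apply: mmxM; [exact: mmx_cst|exact: mmx_id].
rewrite (lint_polar m1 mumP mlin) => [|x]; last exact: FF0.
apply: mule_congr.
pose kt (t : R) : \bar R := \int[mum]_g K0 (sel R n m 0 *m (g *m (t *: e m)))%R.
have mkt : measurable_fun setT kt.
  pose H' (z : measurableTypeR R * bmx R m m) :=
    K0 (sel R n m 0 *m (z.2 *m ((z.1 : R) *: e m)))%R.
  apply: (@measurable_fun_fubini_tonelli_F _ _ _ _ R mum H'); last by move=> z; exact: K00.
  apply: mK0; apply: mmxM; first exact: mmx_cst.
  apply: mmxM; first by apply: mmx_of_measurable; exact: measurable_snd.
  by apply: mmxZ; [exact: measurable_fst|exact: mmx_cst].
have kt0 t : 0 <= kt t by apply: integral_ge0 => g _; exact: K00.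
(* The absolute value makes h nonnegative on the whole line; the integral is over t > 0. *)
pose h (t : R) : \bar R := (`|t| ^+ (m - 1) * Uw (t ^+ 2))%R%:E * kt t.
have mh : measurable_fun setT h.
  apply: emeasurable_funM => //; apply/measurable_EFinP; apply: measurable_funM.
    by apply: measurable_funX; exact: normr_measurable.
  by apply: (measurableT_comp measurable_Uw); exact: measurable_funX.
have h0 t : 0 <= h t by rewrite mule_ge0// lee_fin mulr_ge0 ?Uw_ge0// exprn_ge0.
have ht1 t : (1 <= t)%R -> h t = 0.
  move=> t1; rewrite /h /Uw ltNge (_ : (1 <= t ^+ 2)%R) ?mulr0 ?mul0e//.
  by rewrite exprn_ege1.
transitivity (\int[@lebesgue_measure R]_(t in `]0%R, +oo[) h t).
  rewrite (tanh_substitution ltr01 mh h0 ht1); apply: eq_wint => s s0.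
  have Es : (sinh s ^+ (m - 1) * cosh s ^+ j * cosh s ^ (k%:Z - n%:Z) =
      1 / cosh s ^+ 2 * (`|tanh s| ^+ (m - 1) * Uw (tanh s ^+ 2)))%R.
    rewrite (cosh_exprz hkn) (Uw_cosh (tanh2 s)) (ger0_norm (tanh_ge0 (ltW s0))) /tanh (expr_div_n (sinh s)).
    have C0 := cosh_neq0 s; move: (cosh s) (sinh s ^+ (m - 1))%R C0 => C Q C0.
    have E : (C ^+ j * (C ^+ (m - 1) * C ^+ 2) = C ^+ k.+1 * C ^+ (n - k))%R.
      by rewrite -!exprD; congr (_ ^+ _)%R; lia.
    have Ca : (C ^+ (m - 1) != 0)%R by rewrite expf_neq0.
    have Cb : (C ^+ (n - k) != 0)%R by rewrite expf_neq0.
    rewrite exprVn; move: (C ^+ (m - 1))%R (C ^+ (n - k))%R (C ^+ j)%R (C ^+ k.+1)%R E Ca Cb.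
    move=> V W Z T E Vn Wn; apply: (mulfI (mulf_neq0 (mulf_neq0 Vn (expf_neq0 2 C0)) Wn)).
    transitivity (Q * (Z * (V * C ^+ 2)))%R; first by field.
    by rewrite E; field; rewrite C0 Vn.
  rewrite (mul1r (tanh s)) /h -/(kt (tanh s)) [LHS]muleA [RHS]muleA -2!EFinM.
  by rewrite Es.
apply: eq_integral => t; rewrite inE/= in_itv/= andbT => t0.
rewrite /h (ger0_norm (ltW t0)) EFinM -muleA; apply: mule_congr.
have zE (g : 'M[R]_m) : (g^T *m g = 1%:M)%R ->
    dot (sel R n m 0 *m (g *m (t *: e m)))%R (sel R n m 0 *m (g *m (t *: e m)))%R = (t ^+ 2)%R.
  move=> og; rewrite !dot_orthogonal ?tr_sel_sel// dotZl dotZr dot_e ?mulr1//.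
  by rewrite leqnn; lia.
have mgt : @mmx R _ (bmx R m m) n 1 (fun g => sel R n m 0 *m (g *m (t *: e m)))%R.
  apply: mmxM; first exact: mmx_cst.
  by apply: mmxM; [exact: mmx_id|exact: mmx_cst].
have U0 : 0 <= (Uw (t ^+ 2)%R)%:E by rewrite lee_fin Uw_ge0.
transitivity (\int[mum]_g ((Uw (t ^+ 2)%R)%:E * K0 (sel R n m 0 *m (g *m (t *: e m)))%R)).
  exact: (esym (ge0_integralZl mum measurableT (mK0 mgt) (fun g _ => K00 _) U0)).
apply: (eq_haar mumP).
- by apply: measurable_funeM; exact: mK0.
- by move=> g; apply: mule_ge0; [rewrite lee_fin Uw_ge0|exact: K00].
- exact: mFF.
- by move=> g; exact: FF0.
by move=> g [og _]; rewrite /FF zE.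
Qed.

Lemma lint_radial_pos l (h : R -> \bar R) : (0 < l)%N ->
  measurable_fun setT h -> (forall x, 0 <= h x) ->
  lint (fun x : 'cV[R]_l => h (enorm x)) = (sigma (l - 1))%:E * rint (l - 1) h.
Proof. by case: l => // l _ mh h0; rewrite subn1; exact: lint_radial. Qed.

(** A acts on the first n - k coordinates and B on the next k - j. Both preserve R^k and R^j, so by
    [FF_invariant] the blocks x and y may be turned into |x| e_(n-k) and |y| e_(n-j). *)
Lemma FF_blocks (x : 'cV[R]_p) (y : 'cV[R]_q) :
  FF (sel R n (p + q) 0 *m col_mx x y)%R = FF (x0 n j k (enorm x) (enorm y)).
Proof.
have p0 : (0 < p)%N by lia.
have q0 : (0 < q)%N by lia.
have [A oA Ax] := rotate_to x p0; have [B oB By] := rotate_to y q0.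
have sp : (0 + p <= n)%N by lia.
have sq : (p + q <= n)%N by lia.
rewrite sel_col_mx -{1}Ax -{1}By.
have cAj := @emb_pE_conj R n p 0 j A sp oA; have cAk := @emb_pE_conj R n p 0 k A sp oA.
have cBj := @emb_pE_conj R n q p j B sq oB; have cBk := @emb_pE_conj R n q p k B sq oB.
rewrite -[RHS](FF_invariant (A := emb n p B) _ (emb_orthogonal sq oB)); last 2 first.
- by apply: cBj; apply/orP; left; lia.
- by apply: cBk; apply/orP; right.
rewrite -[RHS](FF_invariant (A := emb n 0 A) _ (emb_orthogonal sp oA)); last 2 first.
- by apply: cAj; apply/orP; left; lia.
- by apply: cAk; apply/orP; left; lia.
congr FF; have e1 : (e p = sel R n p 0 *m e p :> 'cV_n)%R by rewrite sel_e ?add0n// p0 leqnn.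
have e2 : (e m = sel R n q p *m e q :> 'cV_n)%R.
  by rewrite sel_e ?q0 ?leqnn//; congr e; lia.
have fB : (emb n p B *m e p = e p :> 'cV_n)%R by apply: emb_fix; rewrite tr_sel_e// ltnn.
have fA (z : 'cV[R]_q) : (emb n 0 A *m (sel R n q p *m z) = sel R n q p *m z)%R.
  rewrite mulmxA emb_fix//; apply/matrixP => a b; rewrite !mxE big1// => l _; rewrite !mxE.
  case: eqP => [la|]; last by rewrite mul0r.
  case: eqP => [lb|]; last by rewrite mulr0.
  by have := ltn_ord a; lia.
have Bz : (emb n p B *m x0 n j k (enorm x) (enorm y) =
    enorm x *: e p + enorm y *: (sel R n q p *m (B *m e q)))%R.
  rewrite /x0 (mulmxDr (emb n p B)) -!scalemxAr fB e2 (mulmxA (emb n p B)) (emb_sel sq).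
  by rewrite -(mulmxA _ B).
rewrite Bz (mulmxDr (emb n 0 A)) -!scalemxAr fA e1 (mulmxA (emb n 0 A)) (emb_sel sp).
by rewrite -(mulmxA _ A).
Qed.

Lemma measurable_rint_x0 : measurable_fun setT
  (fun a : R => rint (q - 1) (fun b => FF (x0 n j k a b))).
Proof.
pose H (z : measurableTypeR R * measurableTypeR R) := FF (x0 n j k (z.1 : R) (z.2 : R)).
apply: (@measurable_wint R (fun t => t ^+ (q - 1))%R _ _ _ (measurableTypeR R) H).
- by apply: measurable_funX.
- by move=> s s0; rewrite exprn_ge0// ltW.
- by apply: mFF; apply: mmx_x0; [exact: measurable_fst|exact: measurable_snd].
- by move=> z; exact: FF0.
Qed.

Lemma lint_blocks : lint (fun x : 'cV[R]_m => FF (sel R n m 0 *m x)%R) =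
  (sigma (p - 1))%:E * rint (p - 1) (fun a =>
    (sigma (q - 1))%:E * rint (q - 1) (fun b => FF (x0 n j k a b))).
Proof.
have p0 : (0 < p)%N by lia.
have q0 : (0 < q)%N by lia.
have -> : lint (fun x : 'cV[R]_m => FF (sel R n m 0 *m x)%R) =
    lint (fun x : 'cV[R]_(p + q) => FF (sel R n (p + q) 0 *m x)%R).
  have E : m = (p + q)%N by lia.
  (* The type of the variable depends on m, so m is generalized before it is replaced by p + q. *)
  by move: (m) E => m' ->.
have rint0 a : 0 <= rint (q - 1) (fun b => FF (x0 n j k a b)) by exact: rint_ge0.
rewrite lint_split -(lint_radial_pos p0); last 2 first.
- by apply: measurable_funeM; exact: measurable_rint_x0.
- by move=> a; apply: mule_ge0 => //; rewrite lee_fin sigma_ge0.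
apply: eq_lint => x; rewrite -(lint_radial_pos q0); last 2 first.
- by apply: mFF; apply: mmx_x0; [exact: measurable_cst|exact: measurable_id].
- by move=> b; exact: FF0.
by apply: eq_lint => y; exact: FF_blocks.
Qed.

(** The power k + 1 comes from [Uw]; the power n - j comes from [Vw], which sees only the component
    tanh r along e_(n-k). *)
Lemma FF_x0 (r s : R) : FF (x0 n j k (tanh r) ((cosh r)^-1 * tanh s)%R) =
  ((cosh r * cosh s) ^+ k.+1 * cosh r ^+ m)%R%:E * j0 (x0 n j k (tanh r) (tanh s / cosh r)%R).
Proof.
have -> : ((cosh r)^-1 * tanh s = tanh s / cosh r)%R by rewrite mulrC.
rewrite /FF /K0 muleA -EFinM; congr (_%:E * _); congr (_ * _)%R.
  rewrite /Uw (x0_lt1 hn hjk hkn) (dot_x0 hn hjk hkn).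
  have -> : (1 - (tanh r ^+ 2 + (tanh s / cosh r) ^+ 2) = ((cosh r * cosh s) ^+ 2)^-1)%R.
    have -> : ((tanh s / cosh r) ^+ 2 = tanh s ^+ 2 * (1 - tanh r ^+ 2))%R.
      by rewrite tanh2; field; exact: cosh_neq0.
    by rewrite (exprMn _ (cosh r)) invfM -!tanh2; ring.
  by rewrite powR_inv2// mulr_gt0 ?cosh_gt0.
rewrite /Vw (qE_x0 hn hjk hkn) dotZl dotZr dot_e; last by lia.
rewrite mulr1 -expr2 tanh2 (_ : (j%:R - n%:R) / 2 = - (m%:R / 2))%R.
  by rewrite powR_inv2// cosh_gt0.
by rewrite natrB; [field|lia].
Qed.

Lemma FF_eq0 (a b : R) : (1 <= a ^+ 2 + b ^+ 2)%R -> FF (x0 n j k a b) = 0.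
Proof. by move=> h; rewrite /FF /Uw (dot_x0 hn hjk hkn) ltNge h mul0e. Qed.

(** The substitution is b = tanh s / cosh r: from b = 1 / cosh r on, the point is outside the open
    unit ball and [Uw] vanishes. *)
Lemma inner_substitution (r : R) :
  rint (q - 1) (fun b => FF (x0 n j k (tanh r) b)) =
  wint (fun s : R => (cosh r)^-1 / cosh s ^+ 2)%R (fun s =>
    (`|(cosh r)^-1 * tanh s| ^+ (q - 1) * ((cosh r * cosh s) ^+ k.+1 * cosh r ^+ m))%R%:E *
      j0 (x0 n j k (tanh r) (tanh s / cosh r)%R)).
Proof.
have C0 := cosh_gt0 r.
pose h (b : R) : \bar R := (`|b| ^+ (q - 1))%R%:E * FF (x0 n j k (tanh r) b).
have mh : measurable_fun setT h.
  apply: emeasurable_funM.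
    by apply/measurable_EFinP; apply: measurable_funX; exact: normr_measurable.
  by apply: mFF; apply: mmx_x0; [exact: measurable_cst|exact: measurable_id].
have h0 b : 0 <= h b by rewrite mule_ge0// lee_fin exprn_ge0.
have hz b : ((cosh r)^-1 <= b)%R -> h b = 0.
  move=> hb; rewrite /h FF_eq0 ?mule0//.
  have : (1 - tanh r ^+ 2 <= b ^+ 2)%R.
    by rewrite tanh2 -exprVn ler_pXn2r// nnegrE ?(le_trans _ hb)// invr_ge0 ltW.
  by lra.
have Ci : (0 < (cosh r)^-1)%R by rewrite invr_gt0.
transitivity (\int[@lebesgue_measure R]_(t in `]0%R, +oo[) h t).
  apply: eq_integral => t; rewrite inE/= in_itv/= andbT => t0.
  by rewrite /h ger0_norm// ltW.
rewrite (tanh_substitution Ci mh h0 hz); apply: eq_wint => s s0.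
by apply: mule_congr; rewrite /h FF_x0 muleA -EFinM.
Qed.

Lemma hyperbolic_identity :
  (sigma (n - k - 1))%:E * wint (fun r : R => sinh r ^+ (n - k - 1) * cosh r ^+ k)%R (fun r =>
    (sigma (k - j - 1))%:E * wint (fun s : R => sinh s ^+ (k - j - 1) * cosh s ^+ j)%R (fun s =>
      j0 (x0 n j k (tanh r) (tanh s / cosh r)%R))) =
  (sigma (n - j - 1))%:E * wint (fun s : R => sinh s ^+ (n - j - 1) * cosh s ^+ j)%R (fun s =>
    (cosh s ^ (k%:Z - n%:Z)%R)%:E *
      \int[mum]_g ((Vw j (qE R n k *m (sel R n m 0 *m (g *m (tanh s *: e m))))%R)%:E *
        j0 (sel R n m 0 *m (g *m (tanh s *: e m)))%R)).
Proof.
refine (etrans _ (esym rhs_lint)); rewrite lint_blocks; apply: mule_congr.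
pose G a := (sigma (q - 1))%:E * rint (q - 1) (fun b => FF (x0 n j k a b)).
have mG : measurable_fun setT G by apply: measurable_funeM; exact: measurable_rint_x0.
have G0 a : 0 <= G a by rewrite mule_ge0 ?lee_fin ?sigma_ge0//; exact: rint_ge0.
pose h (a : R) : \bar R := (`|a| ^+ (p - 1))%R%:E * G a.
have mh : measurable_fun setT h.
  apply: emeasurable_funM => //.
  by apply/measurable_EFinP; apply: measurable_funX; exact: normr_measurable.
have h0 b : 0 <= h b by rewrite mule_ge0// lee_fin exprn_ge0.
have hz a : (1 <= a)%R -> h a = 0.
  move=> a1; rewrite /h /G /rint integral0_eq ?mule0// => b _.
  by rewrite FF_eq0 ?mule0//; have := sqr_ge0 b; nra.
transitivity (\int[@lebesgue_measure R]_(t in `]0%R, +oo[) h t); last first.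
  apply: eq_integral => t; rewrite inE/= in_itv/= andbT => t0.
  by rewrite /h ger0_norm// ltW.
rewrite (tanh_substitution ltr01 mh h0 hz); apply: eq_wint => r r0.
rewrite /h /G (mul1r (tanh r)) inner_substitution [RHS]muleA -EFinM [LHS]muleCA [RHS]muleCA.
apply: mule_congr.
have C0 := cosh_gt0 r; have C1 := cosh_neq0 r.
have mD : measurable_fun setT (fun s : R => (cosh r)^-1 / cosh s ^+ 2)%R.
  apply: measurable_funM => //; apply: measurable_inv; apply: measurable_funX.
  exact: measurable_cosh.
have D0 (s : R) : (0 < s)%R -> (0 <= (cosh r)^-1 / cosh s ^+ 2)%R.
  by move=> _; rewrite divr_ge0 ?sqr_ge0// invr_ge0 ltW.
have mx : measurable_fun setT (fun s : R => j0 (x0 n j k (tanh r) (tanh s / cosh r)%R)).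
  apply: mj; apply: mmx_x0; first exact: measurable_cst.
  by apply: measurable_funM => //; exact: measurable_tanh.
rewrite -(wintZ (@measurable_wI R j k) (@wI_ge0 R j k) _ mx); last 2 first.
- by rewrite lee_fin mulr_ge0// exprn_ge0 ?sinh_ge0// ltW.
- by move=> s; exact: j00.
rewrite -(wintZ mD D0); last 3 first.
- by rewrite lee_fin mul1r mulr_ge0 ?invr_ge0 ?sqr_ge0// exprn_ge0.
- apply: emeasurable_funM => //; apply/measurable_EFinP.
  apply: measurable_funM.
    apply: measurable_funX; apply: (measurableT_comp (@normr_measurable R setT)).
    by apply: measurable_funM => //; exact: measurable_tanh.
  apply: measurable_funM => //; apply: measurable_funX.
  by apply: measurable_funM => //; exact: measurable_cosh.
- by move=> s; rewrite mule_ge0// lee_fin !mulr_ge0// ?exprn_ge0// ?mulr_ge0// ltW// cosh_gt0.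
apply: eq_wint => s s0; rewrite !muleA -!EFinM; congr (_%:E * _).
have D1 := cosh_neq0 s; have Dp := cosh_gt0 s.
rewrite (ger0_norm (tanh_ge0 (ltW r0))) ger0_norm; last first.
  by rewrite mulr_ge0 ?tanh_ge0 ?(ltW s0)// invr_ge0 ltW.
rewrite /tanh; move: (cosh r) (cosh s) (sinh r) (sinh s) C1 D1 => C D A B C1 D1.
(* Powers of cosh r: the substitution for a accounts for 2 from the derivative and p - 1 from
   a^(p-1), the one for b for 1 and q - 1. For cosh s below, they are 2 and q - 1. *)
have EC : (C ^+ k.+1 * C ^+ m = C ^+ k * (C ^+ 2 * C ^+ (p - 1) * (C * C ^+ (q - 1))))%R.
  by rewrite -!exprS -!exprD; congr (_ ^+ _)%R; lia.
have ED : (D ^+ k.+1 = D ^+ j * (D ^+ 2 * D ^+ (q - 1)))%R.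
  by rewrite -!exprD; congr (_ ^+ _)%R; lia.
have -> : ((C * D) ^+ k.+1 * C ^+ m = (C ^+ k.+1 * C ^+ m) * D ^+ k.+1)%R.
  by rewrite (exprMn _ C D) mulrAC.
rewrite EC ED (exprMn _ A) (exprMn _ (C^-1)%R) (exprMn _ B) !exprVn.
have c1 : (C ^+ (p - 1) != 0)%R by rewrite expf_neq0.
have c2 : (C ^+ (q - 1) != 0)%R by rewrite expf_neq0.
have d1 : (D ^+ (q - 1) != 0)%R by rewrite expf_neq0.
move: (C ^+ (p - 1))%R (C ^+ (q - 1))%R (D ^+ (q - 1))%R c1 c2 d1 => X Y Z X0 Y0 Z0.
move: (A ^+ (p - 1))%R (B ^+ (q - 1))%R (C ^+ k)%R (D ^+ j)%R => U V W T.
by field; rewrite C1 D1 X0 Y0 Z0.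
Qed.

End Identity.

(** * Signed and complex functions *)

Section Pairing.
Context (R : realType) d (T : measurableType d) (mu : {measure set T -> \bar R}).
Variables (D : set T) (A Ap Am : T -> \bar R) (x : T -> R).
Hypotheses (mD : measurable D) (mA : measurable_fun D A) (mAp : measurable_fun D Ap).
Hypotheses (mAm : measurable_fun D Am) (mx : measurable_fun D x).
Local Open Scope ereal_scope.
Hypotheses (Ap0 : forall t, D t -> 0 <= Ap t) (Am0 : forall t, D t -> 0 <= Am t).
Hypothesis AE : forall t, D t -> Ap t < +oo -> Am t < +oo -> A t = Ap t - Am t.
Local Notation ex := (fun t => (x t)%:E).
Hypothesis Apx : \int[mu]_(t in D) (Ap t * `|(x t)%:E|) < +oo.
Hypothesis Amx : \int[mu]_(t in D) (Am t * `|(x t)%:E|) < +oo.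

Let posx := ex^\+.
Let negx := ex^\-.

Let px0 t : 0 <= posx t. Proof. exact: funepos_ge0. Qed.
Let nx0 t : 0 <= negx t. Proof. exact: funeneg_ge0. Qed.

Let mex : measurable_fun D ex. Proof. exact/measurable_EFinP. Qed.
Let mpx : measurable_fun D posx. Proof. exact: measurable_funepos. Qed.
Let mnx : measurable_fun D negx. Proof. exact: measurable_funeneg. Qed.

Let leabs t : posx t <= `|(x t)%:E| /\ negx t <= `|(x t)%:E|.
Proof.
rewrite /posx /negx funeposE funenegE/= -!EFin_max !lee_fin !ge_max normr_ge0 !andbT.
by rewrite ler_norm -normrN ler_norm.
Qed.

Let integrable_mul (B X : T -> \bar R) : measurable_fun D B -> measurable_fun D X ->
  (forall t, D t -> 0 <= B t) -> (forall t, 0 <= X t) -> (forall t, X t <= `|(x t)%:E|) ->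
  \int[mu]_(t in D) (B t * `|(x t)%:E|) < +oo -> mu.-integrable D (fun t => B t * X t).
Proof.
move=> mB mX B0 X0 Xx fin; apply/integrableP; split; first exact: emeasurable_funM.
apply: le_lt_trans fin; apply: ge0_le_integral => //.
- by apply: measurableT_comp => //; exact: emeasurable_funM.
- by apply: emeasurable_funM => //; apply: measurableT_comp.
move=> t Dt; rewrite gee0_abs; first by apply: lee_wpmul2l; [exact: B0|exact: Xx].
by apply: mule_ge0; [exact: B0|exact: X0].
Qed.

(** [A] stands for the transform of a signed function, [Ap] and [Am] for those of its positive and
    negative parts; A x is multiplied out into four products of nonnegative functions. *)
Let cross t := (Ap t * posx t + Am t * negx t) - (Am t * posx t + Ap t * negx t).

(** If x t = 0 both sides vanish, whatever the transforms; otherwise the finite products make [Ap t]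
    and [Am t] finite, and [AE] applies. *)
Let crossE t : D t -> Ap t * `|(x t)%:E| < +oo -> Am t * `|(x t)%:E| < +oo ->
  (fine (A t) * x t)%:E = cross t.
Proof.
move=> Dt; rewrite /cross /posx /negx funeposE funenegE/= -!EFin_max.
have [->|xn] := eqVneq (x t) 0%R.
  by rewrite oppr0 !maxxx !mule0 mulr0 !adde0 oppe0 adde0.
have n0 : (0 < `|x t|)%R by rewrite normr_gt0.
move=> h1 h2; have h B : 0 <= B -> B * `|x t|%:E < +oo -> B < +oo.
  by case: B => [b| |]//; rewrite ?ltry// gt0_mulye ?lte_fin.
have a1 := h _ (Ap0 Dt) h1; have a2 := h _ (Am0 Dt) h2.
rewrite (AE Dt a1 a2); move: (Ap0 Dt) (Am0 Dt) a1 a2.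
case: (Ap t) => [a| |]//; case: (Am t) => [b| |]// _ _ _ _.
rewrite -!EFinM /=; congr _%:E.
have [x0|x0] := ltP 0%R (x t).
  by rewrite max_r ?oppr_le0 ?(ltW x0)//; ring.
by rewrite max_l ?oppr_ge0//; ring.
Qed.

Let icross : mu.-integrable D cross.
Proof.
have lep t : posx t <= `|(x t)%:E| by have [] := leabs t.
have len t : negx t <= `|(x t)%:E| by have [] := leabs t.
by apply: integrableB => //; apply: integrableD => //; apply: integrable_mul.
Qed.

Let mAx : measurable_fun D (fun t => (fine (A t) * x t)%:E).
Proof.
apply/measurable_EFinP; apply: measurable_funM => //.
exact: (measurableT_comp (@fine_measurable R setT measurableT) mA).
Qed.

Let iabs (B : T -> \bar R) : measurable_fun D B -> (forall t, D t -> 0 <= B t) ->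
  \int[mu]_(t in D) (B t * `|(x t)%:E|) < +oo ->
  mu.-integrable D (fun t => B t * `|(x t)%:E|).
Proof. by move=> mB B0 fin; apply: integrable_mul => //; apply: measurableT_comp. Qed.

(** The products of [Ap] and [Am] with |x| are integrable, hence finite almost everywhere, which is
    what [crossE] asks for. *)
Lemma ae_pairing : ae_eq mu D (fun t => (fine (A t) * x t)%:E) cross.
Proof.
have := integrable_ae mD (iabs mAp Ap0 Apx); have := integrable_ae mD (iabs mAm Am0 Amx).
apply: filterS2 => t hm hp Dt; apply: crossE => //.
  by move: (hp Dt); rewrite fin_numE => /andP[_]; rewrite ltey.
by move: (hm Dt); rewrite fin_numE => /andP[_]; rewrite ltey.
Qed.

Lemma integrable_pairing : mu.-integrable D (fun t => (fine (A t) * x t)%:E).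
Proof.
have /integrableP[mc ci] := icross.
apply/integrableP; split => //.
rewrite (@ae_eq_integral _ _ _ mu D (fun t => `|cross t|)) //.
- exact: measurableT_comp.
- exact: measurableT_comp.
- by apply: filterS ae_pairing => t E /E ->.
Qed.

Lemma integral_pairing : \int[mu]_(t in D) (fine (A t) * x t)%:E =
  (\int[mu]_(t in D) (Ap t * posx t) + \int[mu]_(t in D) (Am t * negx t)) -
  (\int[mu]_(t in D) (Am t * posx t) + \int[mu]_(t in D) (Ap t * negx t)).
Proof.
have lep t : posx t <= `|(x t)%:E| by have [] := leabs t.
have len t : negx t <= `|(x t)%:E| by have [] := leabs t.
have /integrableP[mc ci] := icross.
rewrite (ae_eq_integral _ _ mD mAx mc ae_pairing) integralB//; last 2 first.
- by apply: integrableD => //; apply: integrable_mul.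
- by apply: integrableD => //; apply: integrable_mul.
by rewrite !integralD//; apply: integrable_mul.
Qed.

End Pairing.

(** * The transforms of signed functions *)

Section SignedTransforms.
Context (R : realType) (n j k : nat).
Hypotheses (hn : (1 < n)%N) (hjk : (j < k)%N) (hkn : (k < n)%N).
Variable haar : forall m, probability (@borel_mx R m) R.
Hypothesis haarP : forall m, is_haar (rotations m) (haar m).
Variable nu : {vspace 'cV[R]_n} -> probability (borel_vspace R n) R.
Hypothesis nuP : forall xi, \dim xi = j -> is_fiber_measure k xi (nu xi).
Variable dj : {measure set (borel_geod R n j) -> \bar R}.
Hypothesis djP : is_geod_measure haar dj.
Variable dk : {measure set (borel_geod R n k) -> \bar R}.
Hypothesis dkP : is_geod_measure haar dk.
Local Notation M1 := (bmx R (n + 1) (n + 1)).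
Local Notation Gj := (GammaH n j : set (borel_geod R n j)).
Local Notation Gk := (GammaH n k : set (borel_geod R n k)).
Local Open Scope ereal_scope.

(** Both functions are factored through projections, the two sides become integrals of the same [J],
    and [J] has the symmetries required by [hyperbolic_identity]. *)
Lemma duality_ge0 (f : borel_geod R n j -> \bar R) (phi : borel_geod R n k -> \bar R) :
  measurable_fun Gj f -> measurable_fun Gk phi ->
  (forall t, 0 <= f t) -> (forall t, 0 <= phi t) ->
  \int[dk]_(z in GammaH n k) (RH haar j k f z * phi z) =
  \int[dj]_(t in GammaH n j) (f t * RHstar nu j k phi t).
Proof.
move=> mf mphi f_ge0 phi_ge0.
have [f0 [mf0 f00 hf]] := doob_dynkin mf f_ge0.
have [phi0 [mphi0 phi00 hphi]] := doob_dynkin mphi phi_ge0.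
rewrite (lhs_formula hn hjk hkn haarP dkP mf0 mphi0 f00 phi00 hf hphi f_ge0 phi_ge0).
refine (etrans _ (esym (rhs_formula hn hjk hkn haarP nuP djP mf0 mphi0 f00 phi00 hf hphi f_ge0))).
apply: (hyperbolic_identity hn hjk hkn (haarP (n - j)) (j0 := J j k haar f0 phi0)).
- by apply: (measurable_J _ _ _ mf0 mphi0 f00 phi00); exact: mmx_id.
- by move=> x; exact: J_ge0.
- by move=> A x oA; exact: J_invariant.
Qed.

(** Distributivity for a finite positive factor, valid for infinite a and b as well. *)
Lemma mulEFin_subr (c : R) (a b : \bar R) : (0 < c)%R ->
  c%:E * (a - b) = c%:E * a - c%:E * b.
Proof.
move=> c0; have c1 : 0 < c%:E by rewrite lte_fin.
case: a b => [a| |] [b| |]; rewrite ?gt0_muley ?gt0_muleNy//=.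
by congr _%:E; ring.
Qed.

Section SignedRH.
Variable g : borel_geod R n j -> \bar R.
Hypothesis mg : measurable_fun Gj g.

Let dp := doob_dynkin (measurable_funepos mg) (funepos_ge0 g).
Let dm := doob_dynkin (measurable_funeneg mg) (funeneg_ge0 g).

Let wI (s : R) : R := (sinh s ^+ (k - j - 1) * cosh s ^+ j)%R.

Let RHin_diff z s : RHin j k haar g z s = RHin j k haar g^\+ z s - RHin j k haar g^\- z s.
Proof.
rewrite /RHin integralE; congr (_ - _); apply: eq_integral => a _.
  by rewrite !funeposE.
by rewrite !funenegE.
Qed.

(** The inner integral splits by definition over the parts of g; the outer one is split by
    integrability of both parts, which is where the finiteness of the two transforms enters. *)
Lemma RH_diff z : GammaH n k z -> RH haar j k g^\+ z < +oo -> RH haar j k g^\- z < +oo ->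
  RH haar j k g z = RH haar j k g^\+ z - RH haar j k g^\- z.
Proof.
have [gp [mgp gp0 hgp]] := dp; have [gm [mgm gm0 hgm]] := dm.
move=> zG; rewrite !RH_RHin.
have Pp s := RHin_gmx hn hjk hkn haarP s mgp gp0 hgp zG.
have Pm s := RHin_gmx hn hjk hkn haarP s mgm gm0 hgm zG.
have s0 := sigma_gt0 R (k - j - 1).
have fin (P : R -> \bar R) : measurable_fun setT P -> (forall s, 0 <= P s) ->
    (sigma (k - j - 1))%:E * wint wI P < +oo ->
    (@lebesgue_measure R).-integrable `]0%R, +oo[ (fun s => (wI s)%:E * P s).
  move=> mP P0 h; apply/integrableP; split.
    apply: emeasurable_funM; last exact: measurable_funTS.
    by apply: measurable_funTS; apply/measurable_EFinP; exact: measurable_wI.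
  have h0 : wint wI P < +oo.
    by move: h; case: (wint wI P) => [r| |]//; rewrite ?ltry// gt0_muley ?lte_fin.
  rewrite (_ : \int[_]_(s in _) _ = wint wI P)//; apply: eq_integral => s.
  rewrite inE/= in_itv/= andbT => sp; rewrite gee0_abs// mule_ge0// lee_fin.
  exact: wI_ge0.
move=> /(fin _) ip /(fin _) im.
have mP f0 : measurable_fun setT f0 -> (forall M : M1, 0 <= f0 M) ->
    measurable_fun setT (fun s : R => RHinm j k haar f0 (gmx z, s)).
  move=> mf0 f00; apply: (measurableT_comp (measurable_RHinm j k haar mf0 f00)).
  exact: measurable_fun_pair.
have {}ip : (@lebesgue_measure R).-integrable `]0%R, +oo[ (fun s => (wI s)%:E * RHin j k haar g^\+ z s).
  by apply: ip; [rewrite (funext Pp); exact: mP|move=> s; rewrite Pp; exact: RHinm_ge0].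
have {}im : (@lebesgue_measure R).-integrable `]0%R, +oo[ (fun s => (wI s)%:E * RHin j k haar g^\- z s).
  by apply: im; [rewrite (funext Pm); exact: mP|move=> s; rewrite Pm; exact: RHinm_ge0].
rewrite -mulEFin_subr//; apply: mule_congr; rewrite /wint -integralB//.
apply: eq_integral => s; rewrite inE/= in_itv/= andbT => sp.
rewrite RHin_diff mulEFin_subr// mulr_gt0// exprn_gt0 ?cosh_gt0//; exact: sinh_gt0.
Qed.

(** An integral is by definition the difference of the integrals of the positive and negative parts
    of its integrand, and each of these is measurable in the parameter by Tonelli's theorem. This
    holds also where the transform is infinite. *)
Lemma measurable_RH_signed : measurable_fun Gk (RH haar j k g : borel_geod R n k -> \bar R).
Proof.
have [gp [mgp gp0 hgp]] := dp; have [gm [mgm gm0 hgm]] := dm.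
pose F (p : M1 * measurableTypeR R) : \bar R := ((0 < p.2 :> R)%R%:R * wI p.2)%:E *
  (RHinm j k haar gp p - RHinm j k haar gm p).
have mF : measurable_fun setT F.
  apply: emeasurable_funM; last by apply: emeasurable_funB; exact: measurable_RHinm.
  apply/measurable_EFinP.
  have mw : measurable_fun setT (fun s : R => (0 < s)%R%:R * wI s)%R.
    by apply: measurable_funM; [exact: measurable_pos|exact: measurable_wI].
  exact: (@measurableT_comp _ _ _ _ (measurableTypeR R) _ _ _ _ mw measurable_snd).
have mI : measurable_fun setT (fun M : M1 => \int[@lebesgue_measure R]_s F (M, s)).
  rewrite (_ : (fun M => _) = (fun M : M1 => \int[@lebesgue_measure R]_s F^\+ (M, s) -
    \int[@lebesgue_measure R]_s F^\- (M, s))); last first.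
    apply/funext => M; rewrite integralE; congr (_ - _); apply: eq_integral => s _.
      by rewrite !funeposE.
    by rewrite !funenegE.
  apply: emeasurable_funB.
    apply: (@measurable_fun_fubini_tonelli_F _ _ _ (measurableTypeR R) R _ F^\+).
      exact: measurable_funepos.
    by move=> p; exact: funepos_ge0.
  apply: (@measurable_fun_fubini_tonelli_F _ _ _ (measurableTypeR R) R _ F^\-).
    exact: measurable_funeneg.
  by move=> p; exact: funeneg_ge0.
have mS : measurable_fun setT (fun M : M1 => (sigma (k - j - 1))%:E * \int[@lebesgue_measure R]_s F (M, s)).
  exact: measurable_funeM.
apply: (measurable_comp_gmx mS) => z zG.
rewrite RH_RHin; apply: mule_congr; rewrite /wint ge0_integral_pos.
apply: eq_integral => s _; rewrite /F/=; apply: mule_congr.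
rewrite RHin_diff; congr (_ - _).
  exact: (RHin_gmx hn hjk hkn haarP s mgp gp0 hgp zG).
exact: (RHin_gmx hn hjk hkn haarP s mgm gm0 hgm zG).
Qed.

End SignedRH.

Section SignedRHstar.
Variable g : borel_geod R n k -> \bar R.
Hypothesis mg : measurable_fun Gk g.

(** A single integral, which splits by definition, so that, unlike in [RH_diff], the equality holds
    at infinite values too. Nonnegative weights and extension by 0 commute with taking parts. *)
Lemma RHstar_diff t : RHstar nu j k g t = RHstar nu j k g^\+ t - RHstar nu j k g^\- t.
Proof.
rewrite /RHstar /opQ -mulEFin_subr; last by rewrite exprz_gt0// cosh_gt0.
apply: mule_congr; rewrite /RBstar /RAstar integralE.
congr (_ - _); apply: eq_integral => eta _.
  rewrite funeposE /patch; case: ifPn => _; last by rewrite maxxx.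
  by rewrite /opP funeposE maxe_pMr ?mule0// lee_fin powR_ge0.
rewrite funenegE /patch; case: ifPn => _; last by rewrite oppe0 maxxx.
by rewrite /opP funenegE -muleN maxe_pMr ?mule0// lee_fin powR_ge0.
Qed.

Lemma measurable_RHstar_signed : measurable_fun Gj (RHstar nu j k g : borel_geod R n j -> \bar R).
Proof.
have [gp [mgp gp0 hgp]] := doob_dynkin (measurable_funepos mg) (funepos_ge0 g).
have [gm [mgm gm0 hgm]] := doob_dynkin (measurable_funeneg mg) (funeneg_ge0 g).
rewrite (funext RHstar_diff); apply: emeasurable_funB.
  exact: (measurable_RHstar hn hjk hkn haarP nuP mgp gp0 hgp).
exact: (measurable_RHstar hn hjk hkn haarP nuP mgm gm0 hgm).
Qed.

End SignedRHstar.

Let pos_abs (x : R) : maxe x%:E 0 <= `|x%:E| /\ maxe (- x%:E) 0 <= `|x%:E|.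
Proof.
rewrite /= -!EFin_max !lee_fin !ge_max normr_ge0 !andbT; split; first exact: ler_norm.
by rewrite -normrN ler_norm.
Qed.

(** * Duality for dominated real functions *)

Section Bounded.
Variables (F : borel_geod R n j -> \bar R) (Phi : borel_geod R n k -> \bar R).
Hypotheses (mF : measurable_fun Gj F) (mPhi : measurable_fun Gk Phi).
Hypotheses (F0 : forall t, 0 <= F t) (Phi0 : forall t, 0 <= Phi t).
Hypothesis lhs_fin : \int[dk]_(z in GammaH n k) (RH haar j k F z * Phi z) < +oo.
Variables (g : borel_geod R n j -> R) (h : borel_geod R n k -> R).
Hypotheses (mg : measurable_fun Gj g) (mh : measurable_fun Gk h).
Hypotheses (gF : forall t, `|(g t)%:E| <= F t) (hPhi : forall t, `|(h t)%:E| <= Phi t).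
Let G t := (g t)%:E.
Let H t := (h t)%:E.
Let mG : measurable_fun Gj G. Proof. exact/measurable_EFinP. Qed.
Let mH : measurable_fun Gk H. Proof. exact/measurable_EFinP. Qed.
Let mGj := @measurable_GammaH R n j.
Let mGk := @measurable_GammaH R n k.

Let mR (X : borel_geod R n j -> \bar R) : measurable_fun Gj X -> (forall t, 0 <= X t) ->
  measurable_fun Gk (RH haar j k X : borel_geod R n k -> \bar R).
Proof.
move=> mX X0; have [x [mx x0 hx]] := doob_dynkin mX X0.
exact: (measurable_RH hn hjk hkn haarP mx x0 hx).
Qed.

Let mS (X : borel_geod R n k -> \bar R) : measurable_fun Gk X -> (forall t, 0 <= X t) ->
  measurable_fun Gj (RHstar nu j k X : borel_geod R n j -> \bar R).
Proof.
move=> mX X0; have [x [mx x0 hx]] := doob_dynkin mX X0.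
exact: (measurable_RHstar hn hjk hkn haarP nuP mx x0 hx).
Qed.

Let S0 (X : borel_geod R n k -> \bar R) : measurable_fun Gk X -> (forall t, 0 <= X t) ->
  forall t, GammaH n j t -> 0 <= RHstar nu j k X t.
Proof.
move=> mX X0; have [x [mx x0 hx]] := doob_dynkin mX X0 => t.
exact: (RHstar_ge0 hn hjk hkn haarP nuP mx x0 hx).
Qed.

Let R0 (X : borel_geod R n j -> \bar R) : (forall t, 0 <= X t) -> forall z, 0 <= RH haar j k X z.
Proof. by move=> X0 z; exact: RH_ge0. Qed.

Let rhs_fin : \int[dj]_(t in GammaH n j) (F t * RHstar nu j k Phi t) < +oo.
Proof. by rewrite -(duality_ge0 mF mPhi F0 Phi0). Qed.

(** The bound |h| <= Phi is used on the left; duality then passes to the right, where X <= F is a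
    pointwise bound on the first factor. *)
Let finR (X : borel_geod R n j -> \bar R) : measurable_fun Gj X -> (forall t, 0 <= X t) ->
  (forall t, X t <= F t) -> \int[dk]_(z in GammaH n k) (RH haar j k X z * `|(h z)%:E|) < +oo.
Proof.
move=> mX X0 XF; have mHa : measurable_fun Gk (fun z => `|(h z)%:E|) by exact: measurableT_comp.
apply: (@le_lt_trans _ _ (\int[dk]_(z in GammaH n k) (RH haar j k X z * Phi z))).
  apply: (ge0_le_integral dk mGk).
  - by move=> z _; apply: mule_ge0; [exact: R0|exact: abse_ge0].
  - by apply: emeasurable_funM => //; exact: mR.
  - by apply: emeasurable_funM => //; exact: mR.
  - by move=> z _; apply: lee_wpmul2l; [exact: R0|exact: hPhi].
rewrite (duality_ge0 mX mPhi X0 Phi0); apply: le_lt_trans rhs_fin.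
apply: (ge0_le_integral dj mGj).
- by move=> t tG; apply: mule_ge0; [exact: X0|exact: S0].
- by apply: emeasurable_funM => //; exact: mS.
- by apply: emeasurable_funM => //; exact: mS.
- by move=> t tG; apply: lee_wpmul2r; [exact: S0|exact: XF].
Qed.

(** Symmetrically, |g| <= F is used on the right and, after duality, X <= Phi on the left. *)
Let finS (X : borel_geod R n k -> \bar R) : measurable_fun Gk X -> (forall t, 0 <= X t) ->
  (forall t, X t <= Phi t) -> \int[dj]_(t in GammaH n j) (RHstar nu j k X t * `|(g t)%:E|) < +oo.
Proof.
move=> mX X0 XF; have mGa : measurable_fun Gj (fun z => `|(g z)%:E|) by exact: measurableT_comp.
apply: (@le_lt_trans _ _ (\int[dj]_(t in GammaH n j) (F t * RHstar nu j k X t))).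
  apply: (ge0_le_integral dj mGj).
  - by move=> z zG; apply: mule_ge0; [exact: S0|exact: abse_ge0].
  - by apply: emeasurable_funM => //; exact: mS.
  - by apply: emeasurable_funM => //; exact: mS.
  - by move=> z zG; rewrite muleC; apply: lee_wpmul2r; [exact: S0|exact: gF].
rewrite -(duality_ge0 mF mX F0 X0); apply: le_lt_trans lhs_fin.
apply: (ge0_le_integral dk mGk).
- by move=> t tG; apply: mule_ge0; [exact: R0|exact: X0].
- by apply: emeasurable_funM => //; exact: mR.
- by apply: emeasurable_funM => //; exact: mR.
- by move=> t tG; apply: lee_wpmul2l; [exact: R0|exact: XF].
Qed.

Let mGp : measurable_fun Gj G^\+. Proof. exact: measurable_funepos. Qed.
Let mGm : measurable_fun Gj G^\-. Proof. exact: measurable_funeneg. Qed.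
Let mHp : measurable_fun Gk H^\+. Proof. exact: measurable_funepos. Qed.
Let mHm : measurable_fun Gk H^\-. Proof. exact: measurable_funeneg. Qed.
Let Gp0 t : 0 <= G^\+ t. Proof. exact: funepos_ge0. Qed.
Let Gm0 t : 0 <= G^\- t. Proof. exact: funeneg_ge0. Qed.
Let Hp0 t : 0 <= H^\+ t. Proof. exact: funepos_ge0. Qed.
Let Hm0 t : 0 <= H^\- t. Proof. exact: funeneg_ge0. Qed.

Let GpF t : G^\+ t <= F t.
Proof. by rewrite funeposE; apply: (le_trans (pos_abs (g t)).1). Qed.
Let GmF t : G^\- t <= F t.
Proof. by rewrite funenegE; apply: (le_trans (pos_abs (g t)).2). Qed.
Let HpF t : H^\+ t <= Phi t.
Proof. by rewrite funeposE; apply: (le_trans (pos_abs (h t)).1). Qed.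
Let HmF t : H^\- t <= Phi t.
Proof. by rewrite funenegE; apply: (le_trans (pos_abs (h t)).2). Qed.

Lemma integrable_RH : dk.-integrable Gk (fun z => (fine (RH haar j k G z) * h z)%:E).
Proof.
apply: (integrable_pairing mGk (measurable_RH_signed mG) (mR mGp Gp0) (mR mGm Gm0) mh).
- by move=> z _; exact: R0.
- by move=> z _; exact: R0.
- by move=> z; exact: RH_diff.
- exact: finR.
- exact: finR.
Qed.

Lemma integrable_RHstar : dj.-integrable Gj (fun t => (fine (RHstar nu j k H t) * g t)%:E).
Proof.
apply: (integrable_pairing mGj (measurable_RHstar_signed mH) (mS mHp Hp0) (mS mHm Hm0) mg).
- by move=> t; exact: S0.
- by move=> t; exact: S0.
- by move=> t _ _ _; exact: RHstar_diff.
- exact: finS.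
- exact: finS.
Qed.

Lemma duality_real : \int[dk]_(z in GammaH n k) (fine (RH haar j k G z) * h z)%:E =
  \int[dj]_(t in GammaH n j) (fine (RHstar nu j k H t) * g t)%:E.
Proof.
rewrite (integral_pairing mGk (measurable_RH_signed mG) (mR mGp Gp0) (mR mGm Gm0) mh); first last.
- exact: finR.
- exact: finR.
- by move=> z; exact: RH_diff.
- by move=> z _; exact: R0.
- by move=> z _; exact: R0.
rewrite (integral_pairing mGj (measurable_RHstar_signed mH) (mS mHp Hp0) (mS mHm Hm0) mg); first last.
- exact: finS.
- exact: finS.
- by move=> t _ _ _; exact: RHstar_diff.
- by move=> t; exact: S0.
- by move=> t; exact: S0.
(* The two mixed products come in opposite orders on the two sides. *)
rewrite [X in _ - X = _]addeC.
have mulC (X Y : borel_geod R n j -> \bar R) :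
    \int[dj]_(t in GammaH n j) (X t * Y t) = \int[dj]_(t in GammaH n j) (Y t * X t).
  by apply: eq_integral => t _; rewrite muleC.
congr ((_ + _) - (_ + _)).
- exact: (etrans (duality_ge0 mGp mHp Gp0 Hp0) (mulC _ _)).
- exact: (etrans (duality_ge0 mGm mHm Gm0 Hm0) (mulC _ _)).
- exact: (etrans (duality_ge0 mGp mHm Gp0 Hm0) (mulC _ _)).
- exact: (etrans (duality_ge0 mGm mHp Gm0 Hp0) (mulC _ _)).
Qed.

End Bounded.

End SignedTransforms.

(** * Complex functions *)

Section Complex.
Context (R : realType).

Lemma le_normc_Re (z : R[i]) : `|complex.Re z| <= ComplexField.Normc.normc z.
Proof.
by case: z => a b /=; rewrite -sqrtr_sqr ler_wsqrtr// lerDl sqr_ge0.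
Qed.

Lemma le_normc_Im (z : R[i]) : `|complex.Im z| <= ComplexField.Normc.normc z.
Proof.
by case: z => a b /=; rewrite -sqrtr_sqr ler_wsqrtr// lerDr sqr_ge0.
Qed.

Lemma eabs_ge0 (X : Type) (f : X -> R[i]) x : (0 <= eabs f x)%E.
Proof. by rewrite lee_fin; case: (f x) => a b; exact: sqrtr_ge0. Qed.

Lemma measurable_eabs d (T : measurableType d) (D : set T) (f : T -> R[i]) : measurable D ->
  cmeasurable D f -> measurable_fun D (eabs f).
Proof.
move=> mD [mr mi]; apply/measurable_EFinP.
rewrite (_ : (fun x => _) = (fun x => Num.sqrt (complex.Re (f x) ^+ 2 + complex.Im (f x) ^+ 2))).
  apply: (@measurableT_comp _ _ _ _ _ _ (@Num.sqrt R)).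
    by apply: measurable_sqrt; exact: measurable_id.
  by apply: measurable_funD; exact: measurable_funX.
by apply/funext => x; case: (f x).
Qed.

End Complex.

Theorem theorem5p3 (R : realType) (n j k : nat)
  (hn : (2 <= n)%N) (hjk : (j < k)%N) (hkn : (k <= n - 1)%N)
  (haar : forall m, probability (@borel_mx R m) R)
  (haarP : forall m, is_haar (rotations m) (haar m))
  (nu : {vspace 'cV[R]_n} -> probability (borel_vspace R n) R)
  (nuP : forall xi, \dim xi = j -> is_fiber_measure k xi (nu xi))
  (dj : {measure set (borel_geod R n j) -> \bar R})
  (djP : is_geod_measure haar dj)
  (dk : {measure set (borel_geod R n k) -> \bar R})
  (dkP : is_geod_measure haar dk)
  (f : borel_geod R n j -> R[i]) (mf : cmeasurable (GammaH n j : set (borel_geod R n j)) f)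
  (phi : borel_geod R n k -> R[i]) (mphi : cmeasurable (GammaH n k : set (borel_geod R n k)) phi) :
  let lhs_abs :=
    (\int[dk]_(z in GammaH n k) (RH haar j k (eabs f) z * eabs phi z))%E in
  let rhs_abs :=
    (\int[dj]_(t in GammaH n j) (eabs f t * RHstar nu j k (eabs phi) t))%E in
  (lhs_abs < +oo \/ rhs_abs < +oo)%E ->
  [/\ (lhs_abs < +oo)%E, (rhs_abs < +oo)%E &
      cintegral dk (GammaH n k)
        (fun z => complexify (RH haar j k) f z * phi z) =
      cintegral dj (GammaH n j)
        (fun t => f t * complexify (RHstar nu j k) phi t)].
Proof.
move=> lhs_abs rhs_abs hfin.
have kn : (k < n)%N by lia.
have mFa := measurable_eabs (@measurable_GammaH R n j) mf.
have mPa := measurable_eabs (@measurable_GammaH R n k) mphi.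
have E : lhs_abs = rhs_abs.
  exact: (duality_ge0 hn hjk kn haarP nuP djP dkP mFa mPa (eabs_ge0 f) (eabs_ge0 phi)).
have fin : (lhs_abs < +oo)%E by case: hfin => //; rewrite E.
have fin' : (rhs_abs < +oo)%E by rewrite -E.
split => //; rewrite /cintegral.
have fR t : (`|(complex.Re (f t))%:E| <= eabs f t)%E by rewrite lee_fin le_normc_Re.
have fI t : (`|(complex.Im (f t))%:E| <= eabs f t)%E by rewrite lee_fin le_normc_Im.
have pR t : (`|(complex.Re (phi t))%:E| <= eabs phi t)%E by rewrite lee_fin le_normc_Re.
have pI t : (`|(complex.Im (phi t))%:E| <= eabs phi t)%E by rewrite lee_fin le_normc_Im.
have [mfR mfI] := mf; have [mpR mpI] := mphi.
(* |f| and |phi| dominate the real and imaginary parts, so duality and integrability hold for each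
   of the four pairings of parts. *)
have Dual g h mg mh := @duality_real R n j k hn hjk kn haar haarP nu nuP dj djP dk dkP
  _ _ mFa mPa (eabs_ge0 f) (eabs_ge0 phi) fin g h mg mh.
have iL g h mg mh := @integrable_RH R n j k hn hjk kn haar haarP nu nuP dj djP dk dkP
  _ _ mFa mPa (eabs_ge0 f) (eabs_ge0 phi) fin g h mg mh.
have iR g h mg mh := @integrable_RHstar R n j k hn hjk kn haar haarP nu nuP dj djP dk dkP
  _ _ mFa mPa (eabs_ge0 f) fin g h mg mh.
pose RHR z := fine (RH haar j k (fun t => (complex.Re (f t))%:E) z).
pose RHI z := fine (RH haar j k (fun t => (complex.Im (f t))%:E) z).
pose RSR t := fine (RHstar nu j k (fun z => (complex.Re (phi z))%:E) t).
pose RSI t := fine (RHstar nu j k (fun z => (complex.Im (phi z))%:E) t).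
(* Each part of the product is a combination of two real pairings, which may be integrated
   separately because both are integrable. *)
congr Complex.
  transitivity (\int[dk]_(z in GammaH n k)
      (RHR z * complex.Re (phi z) - RHI z * complex.Im (phi z))).
    by apply: eq_Rintegral => z _; case: (phi z).
  transitivity (\int[dj]_(t in GammaH n j)
      (RSR t * complex.Re (f t) - RSI t * complex.Im (f t))); last first.
    apply: eq_Rintegral => t _; rewrite (mulrC (RSR t)) (mulrC (RSI t)).
    by case: (f t).
  rewrite RintegralB; [|exact: measurable_GammaH|exact: iL|exact: iL].
  rewrite RintegralB; [|exact: measurable_GammaH|exact: iR|exact: iR].
  by congr (_ - _); congr fine; exact: Dual.
transitivity (\int[dk]_(z in GammaH n k)
    (RHR z * complex.Im (phi z) + RHI z * complex.Re (phi z))).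
  by apply: eq_Rintegral => z _; case: (phi z).
transitivity (\int[dj]_(t in GammaH n j)
    (RSI t * complex.Re (f t) + RSR t * complex.Im (f t))); last first.
  apply: eq_Rintegral => t _; rewrite (mulrC (RSR t)) (mulrC (RSI t)).
  by case: (f t).
rewrite RintegralD; [|exact: measurable_GammaH|exact: iL|exact: iL].
rewrite RintegralD; [|exact: measurable_GammaH|exact: iR|exact: iR].
by congr (_ + _); congr fine; exact: Dual.
Qed.
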